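(* There exist universal numerical constants $c_1,c_2,c_3,C>0$ such that the following holds. Let $n\ge2$, $A\ge1$, and let $\varphi:\mathbb R\to[0,A]$ be a symmetric (even) and unimodal function. Let $V_1,\dots,V_n$ be i.i.d. uniform on $[0,1]$, let $X_{i,j}=\varphi(V_i-V_j)$ for $i,j\in[n]$, and let $Y=X+E$, where $E$ is independent of $(V_1,\dots,V_n)$ and its $n^2$ entries are independent, centered and subgaussian with subgaussian norm at most $1$. Let $\hat{\mathrm d}$ be the estimated distance built from $Y$ (defined in the context, with constant $c_1$), and let $\hat\Pi$ be the output of the procedure PINES (defined in the context) run on $\hat{\mathrm d}$ with $$\rho_3=\delta+\varepsilon,\qquad \rho_2=\alpha\delta+2(1+\alpha)\varepsilon,\qquad \rho_1=\alpha^2\delta+(2\alpha^2+3\alpha+2)\varepsilon,$$ where $\alpha=\sqrt2$, $\delta=c_2A(\log n)^{1/2}$ and $\varepsilon=c_3A(n\log n)^{1/4}$. Then $$\mathbb E\big[\ell_2(\hat\Pi)\big]\le C\,A\,n^{3/4}\log^{1/4}(n).$$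
   Context: $[n]=\{1,\dots,n\}$. A permutation $\pi$ of $[n]$ is identified with its permutation matrix $\Pi$, and $\Pi\cdot M:=\Pi M\Pi^\top$, i.e. $(\Pi\cdot M)_{\pi(i),\pi(j)}=M_{i,j}$. A symmetric matrix $R\in\mathbb R^{n\times n}$ is Robinson if each row is unimodal with mode at its diagonal index: $R_{i,1}\le\dots\le R_{i,i}\ge\dots\ge R_{i,n}$ for each $i$; $\mathcal R_n$ is the set of such matrices. The loss is $\ell_2(\Pi)=\inf_{R\in\mathcal R_n}\|\Pi\cdot X-R\|_F$ (it depends on the random matrix $X$). A function on $\mathbb R$ is unimodal if it is nondecreasing on $(-\infty,t]$ and nonincreasing on $[t,\infty)$ for some $t$. A centered real variable $Z$ is subgaussian with norm at most $1$ if $\mathbb E e^{sZ}\le e^{s^2/2}$ for all $s\in\mathbb R$. Estimated distance. Let $Y_i$ be the $i$-th row of $Y$, $S_i=\sum_{j=1}^nY_{i,j}$, $\mathcal N_i=\{j\in[n]\setminus\{i\}:|S_j-S_i|\le c_1A\sqrt{n\log n}\}$, and $U_i=\max\{\langle Y_i,Y_j\rangle:j\in\mathcal N_i\}$ ($U_i=0$ if $\mathcal N_i=\emptyset$). For $i\ne j$, $\hat{\mathrm d}(i,j)=\sqrt{\max(0,\,U_i+U_j-2\langle Y_i,Y_j\rangle)}$, and $\hat{\mathrm d}(i,i)=0$. PINES with input $\hat{\mathrm d}$ and radii $\rho_1,\rho_2,\rho_3>0$: 1. Choose a maximal $\rho_1$-packing $\mathcal P\subset[n]$ for $\hat{\mathrm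 d}$, i.e. a subset, maximal for inclusion, with $\hat{\mathrm d}(i,j)>\rho_1$ for all distinct $i,j\in\mathcal P$, together with a partition $[n]=\bigsqcup_{i\in\mathcal P}P_i$ such that $i\in P_i\subset\{j:\hat{\mathrm d}(i,j)\le\rho_1\}$. 2. For each $i\in\mathcal P$, let $G_i$ be the graph with vertex set $\{j\in[n]:\hat{\mathrm d}(i,j)>\rho_2\}$ in which two distinct vertices $j,k$ are joined by an edge iff $\hat{\mathrm d}(j,k)\le\rho_3$. It is required that $\mathcal P\setminus\{i\}$ is contained in the union of at most two connected components of $G_i$; the traces of these components on $\mathcal P\setminus\{i\}$ are denoted $\mathcal C_i^-$ and $\mathcal C_i^+$, with $\mathcal C_i^+=\emptyset$ if $\mathcal P\setminus\{i\}$ lies in a single component (or is empty). 3. Choose $i_1\in\mathcal P$ with $\mathcal C_{i_1}^+=\emptyset$. Then for $k=2,\dots,|\mathcal P|$ recursively choose $i_k\in\mathcal P$ such that $\mathcal C^-_{i_k}$ or $\mathcal C^+_{i_k}$ equals $\{i_1,\dots,i_{k-1}\}$. 4. Output a permutation $\hat\Pi$ of $[n]$ ($\hat\Pi(j)$ is the rank of object $j$) that ranks all elements of $P_{i_1}$ first, then all elements of $P_{i_2}$, and so on, the order inside each $P_{i_k}$ being arbitrary. If some required choice is impossible, the output is an arbitrary fixed permutation. Arbitrary choices are made by any fixed deterministic (measurable) rule. *)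

(* Defs.v *)
From HB Require Import structures.
From mathcomp Require Import all_boot all_order all_algebra fingroup perm.
From mathcomp Require Import all_classical all_reals all_analysis.

Set Implicit Arguments.
Unset Strict Implicit.
Unset Printing Implicit Defensive.

Import Order.TTheory GRing.Theory Num.Theory.
Import numFieldNormedType.Exports.

Local Open Scope classical_set_scope.
Local Open Scope ring_scope.

Section Probability.
Context d (T : measurableType d) (R : realType) (P : probability T R).

Definition sigma_generated (aT I : Type) (X : I -> aT -> R) : set (set aT) :=
  <<s \bigcup_i preimage_set_system setT (X i) measurable >>.

Definition mutually_independent (I : finType) (X : I -> T -> R) : Prop :=
  forall (J : {set I}) (B : I -> set R),
    (forall i, i \in J -> measurable (B i)) ->
    P (\bigcap_(i in [set` J]) X i @^-1` B i) =
    (\prod_(i in J) P (X i @^-1` B i))%E.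

Definition independent_families (I J : Type)
    (X : I -> T -> R) (Y : J -> T -> R) : Prop :=
  forall A B : set T, sigma_generated X A -> sigma_generated Y B ->
    P (A `&` B) = (P A * P B)%E.

(* ['M_P Z] is the moment generating function [s |-> 'E_P[expR (s Z)]]. *)
Definition centered_subgaussian1 (Z : {RV P >-> R}) : Prop :=
  'E_P[Z]%E = 0%E /\ forall s : R, ('M_P Z s <= (expR (s ^+ 2 / 2))%:E)%E.

Definition uniform01 (Z : {RV P >-> R}) : Prop :=
  forall B : set R, measurable B ->
    distribution P Z B = uniform_prob (@ltr01 R) B.

End Probability.

Section Seriation.
Context (R : realType) (n : nat).

Definition unimodal (f : R -> R) : Prop :=
  exists t : R,
    (forall x y, x <= y -> y <= t -> f x <= f y) /\
    (forall x y, t <= x -> x <= y -> f y <= f x).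

Definition robinson (M : 'M[R]_n) : Prop :=
  M^T = M /\
  forall i : 'I_n,
    (forall j k : 'I_n, (j <= k)%N -> (k <= i)%N -> M i j <= M i k) /\
    (forall j k : 'I_n, (i <= j)%N -> (j <= k)%N -> M i k <= M i j).

Definition frobenius (M : 'M[R]_n) : R :=
  Num.sqrt (\sum_i \sum_j M i j ^+ 2).

(* [perm_mx s] has its unit entries at [(i, s i)], hence the inverse: the
   matrix attached to [s] here has its unit entries at [(s i, i)]. *)
Definition perm_conj (s : 'S_n) (M : 'M[R]_n) : 'M[R]_n :=
  perm_mx s^-1%g *m M *m (perm_mx s^-1%g)^T.

Lemma perm_conjE s M i j : perm_conj s M (s i) (s j) = M i j.
Proof.
rewrite /perm_conj -row_permE tr_perm_mx invgK.
have -> : perm_mx s = perm_mx (s^-1)^-1%g :> 'M[R]_n by rewrite invgK.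
by rewrite -col_permE !mxE !permK.
Qed.

Definition ell2 (X : 'M[R]_n) (s : 'S_n) : R :=
  inf [set frobenius (perm_conj s X - M) | M in robinson].

End Seriation.

Section EstimatedDistance.
Context (R : realType) (n : nat) (c1 A : R) (Y : 'M[R]_n).

Definition row_sum (i : 'I_n) : R := \sum_j Y i j.

Definition row_dot (i j : 'I_n) : R := \sum_k Y i k * Y j k.

Definition nbhd (i : 'I_n) : {set 'I_n} :=
  [set j | (j != i) &&
    (`|row_sum j - row_sum i| <= c1 * A * Num.sqrt (n%:R * ln n%:R))]%SET.

(* The inner products may be negative, so the iterated maximum starts from one
   of its own terms. *)
Definition max_dot (i : 'I_n) : R :=
  if [pick j in nbhd i] is Some j0
  then \big[Num.max/row_dot i j0]_(j in nbhd i) row_dot i j else 0.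

Definition dhat : 'M[R]_n :=
  \matrix_(i, j) if i == j then 0
    else Num.sqrt (Num.max 0 (max_dot i + max_dot j - 2 * row_dot i j)).

Lemma max_dot_set0 i : nbhd i = finset.set0 -> max_dot i = 0.
Proof.
move=> N0; rewrite /max_dot; case: pickP => // j.
by rewrite N0 inE.
Qed.

Lemma max_dot_ge i j : j \in nbhd i -> row_dot i j <= max_dot i.
Proof.
move=> jN; rewrite /max_dot; case: pickP => [j0 _|/(_ j)]; last by rewrite jN.
exact: le_bigmax_cond.
Qed.

Lemma max_dot_attained i :
  nbhd i != finset.set0 -> exists2 j, j \in nbhd i & max_dot i = row_dot i j.
Proof.
move=> /set0Pn[k kN]; rewrite /max_dot.
case: pickP => [j0 j0N|/(_ k)]; last by rewrite kN.
apply: (big_ind (fun m => exists2 j, j \in nbhd i & m = row_dot i j)).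
- by exists j0.
- by move=> x y [a aN ->] [b bN ->]; rewrite maxEle; case: ifP => _;
    [exists b | exists a].
- by move=> j jN; exists j.
Qed.

Lemma dhat_sym i j : dhat i j = dhat j i.
Proof.
rewrite !mxE eq_sym; case: eqP => // _.
rewrite (addrC (max_dot i)); congr (Num.sqrt (Num.max 0 (_ - 2 * _))).
by apply: eq_bigr => k _; rewrite mulrC.
Qed.

End EstimatedDistance.

Section Pines.
Context (R : realType) (n : nat) (D : 'M[R]_n) (rho1 rho2 rho3 : R).

Definition packing (p : {set 'I_n}) : bool :=
  [forall i in p, forall j in p, (i != j) ==> (rho1 < D i j)].

Definition packing_partition (p : {set 'I_n}) (cell : 'I_n -> {set 'I_n}) :
    Prop :=
  [/\ maxset packing p,
      (\bigcup_(i in p) cell i = [set: 'I_n])%SET,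
      {in p &, forall i j, i != j -> [disjoint cell i & cell j]%B} &
      {in p, forall i, i \in cell i /\ cell i \subset [set j | D i j <= rho1]%SET}].

Definition graph_vertices (i : 'I_n) : {set 'I_n} := [set j | rho2 < D i j]%SET.

Definition graph_edge (i : 'I_n) : rel 'I_n := fun j k =>
  [&& j \in graph_vertices i, k \in graph_vertices i, j != k & D j k <= rho3].

Definition graph_components (i : 'I_n) : {set {set 'I_n}} :=
  [set [set k | connect (graph_edge i) j k] | j in graph_vertices i]%SET.

(* [sides p i Cm Cp]: [p :\ i] is covered by at most two components of the
   graph of [i], with traces [Cm] and [Cp]; which of two traces is called [Cm]
   is left open. *)
Variant sides (p : {set 'I_n}) (i : 'I_n) : {set 'I_n} -> {set 'I_n} -> Prop :=
| OneSide : p :\ i = finset.set0 \/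
    (exists2 K, K \in graph_components i & p :\ i \subset K) ->
    sides p i (p :\ i) finset.set0
| TwoSides (K1 K2 : {set 'I_n}) :
    K1 \in graph_components i -> K2 \in graph_components i ->
    p :\ i \subset (K1 :|: K2)%SET ->
    p :\ i != finset.set0 ->
    (forall K, K \in graph_components i -> ~~ (p :\ i \subset K)) ->
    sides p i ((p :\ i) :&: K1)%SET ((p :\ i) :&: K2)%SET.

Definition admissible_next (p : {set 'I_n}) (Cm Cp : 'I_n -> {set 'I_n})
    (s : seq 'I_n) (i : 'I_n) : bool :=
  (i \in p) &&
  (if s is [::] then Cp i == finset.set0
   else (Cm i == [set:: s]%SET) || (Cp i == [set:: s]%SET)).

Inductive ordering_run (p : {set 'I_n}) (Cm Cp : 'I_n -> {set 'I_n}) :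
    seq 'I_n -> Prop :=
| RunNil : ordering_run p Cm Cp [::]
| RunRcons s i : ordering_run p Cm Cp s -> admissible_next p Cm Cp s i ->
    ordering_run p Cm Cp (rcons s i).

Definition ranks_cells (cell : 'I_n -> {set 'I_n}) (s : seq 'I_n) (r : 'S_n) :
    Prop :=
  forall i j, i \in s -> j \in s -> (index i s < index j s)%N ->
  forall a b, a \in cell i -> b \in cell j -> (r a < r b)%N.

(* [pines_output r0 r]: [r] can be returned under some way of making the
   arbitrary choices; [r0] is the permutation returned when the requirement on
   the graphs fails or when the ordering cannot be continued. *)
Variant pines_output (r0 : 'S_n) : 'S_n -> Prop :=
| PinesSuccess p cell Cm Cp s r :
    packing_partition p cell ->
    {in p, forall i, sides p i (Cm i) (Cp i)} ->
    ordering_run p Cm Cp s -> size s = #|p| ->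
    ranks_cells cell s r ->
    pines_output r0 r
| PinesNoSides p cell i :
    packing_partition p cell ->
    i \in p -> (forall Cm Cp, ~ sides p i Cm Cp) ->
    pines_output r0 r0
| PinesStuck p cell Cm Cp s :
    packing_partition p cell ->
    {in p, forall i, sides p i (Cm i) (Cp i)} ->
    ordering_run p Cm Cp s -> (size s < #|p|)%N ->
    (forall i, ~~ admissible_next p Cm Cp s i) ->
    pines_output r0 r0.

End Pines.

(* A deterministic rule, given as a measurable function of the input distance
   matrix (Borel sigma-algebra generated by the entries), which makes all the
   arbitrary choices of the procedure on every possible estimated distance. *)
Definition pines_rule (R : realType) (n : nat) (c1 A rho1 rho2 rho3 : R)
    (pines : 'M[R]_n -> 'S_n) : Prop :=
  (forall s : 'S_n,
     sigma_generated (fun (p : 'I_n * 'I_n) (M : 'M[R]_n) => M p.1 p.2)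
       (pines @^-1` [set s])) /\
  exists r0 : 'S_n, forall Y : 'M[R]_n,
    pines_output (dhat c1 A Y) rho1 rho2 rho3 r0 (pines (dhat c1 A Y)).

(* Main.v *)
(* The samples are compared with a regular grid. By the layer-cake formula, row
   sums and inner products of the rows of X depend only on the numbers of V_k in
   intervals, so up to O(A^2 sqrt(n log n)) they equal those of the Toeplitz
   matrix f|a - m| at a = trunc(n V_i). On the grid, reflections show that the
   distance between rows is monotone away from a point up to the factor sqrt 2,
   and the row sum controls the norm of the row. The noise changes inner products
   by O(A^2 sqrt(n log n)), so the estimated distance is eps-close to the grid
   one. For such an input the graph of a packing point i has no edge across i but
   connects all packing points on either side, so PINES recovers the order of the
   packing, up to reversal, and misplaces objects by O(rho_1) only. Summing the
   squared displacements over the n objects bounds the loss by O(sqrt n rho_1). *)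

Require Import Defs.
From HB Require Import structures.
From mathcomp Require Import all_boot all_order all_algebra fingroup perm.
From mathcomp Require Import all_classical all_reals all_analysis.
From mathcomp Require Import zify ring lra measurable_realfun.

Import Order.TTheory GRing.Theory Num.Theory.
Import numFieldNormedType.Exports.

Set Implicit Arguments.
Unset Strict Implicit.
Unset Printing Implicit Defensive.

Local Open Scope classical_set_scope.
Local Open Scope ring_scope.

(** * Toeplitz rows on a regular grid *)

(** The diagonal products [row_dot Y i i] carry the bias [\sum_k E i k ^+ 2], which can be of order
    n, while off-diagonal products are accurate up to order [sqrt (n ln n)]. Hence squared norms are
    read off from [max_dot]: a sample a few cells away yields almost the squared norm, and no
    admissible neighbour yields much more, because rows with close sums have close norms.

    A superlevel set of a row is a window in the order of the latent positions, whatever [phi] and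
    the level are. So it is enough to control the noise on the windows bounded by two samples, a
    finite family. For the same reason [phi] is never discretized and needs no continuity modulus.

    Distances are square roots of combinations of inner products, so the error of order
    [e0 ^+ 2 = sqrt (n ln n)] becomes [eps] of order [e0]. The other scale, [delta], comes from gaps
    of about [4 ln n] cells between consecutive samples. Distances cannot tell a line from its
    reversal, hence the systematic use of [perm_flip]. *)

Section LayerCake.

(* Peeling off the smallest positive level of [g] gives an exact finite
   layer-cake decomposition, so no discretization error occurs. *)
Lemma layer_cake (R : realFieldType) (I : finType) (g e : I -> R) (A t : R) :
  0 <= A -> (forall k, 0 <= g k <= A) ->
  (forall s, 0 < s -> `|\sum_(k | s <= g k) e k| <= t) ->
  `|\sum_k g k * e k| <= A * t.
Proof.
move=> A0 gA gt.
have [m] := ubnP #|[pred k | 0 < g k]|.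
elim: m => // m IH in g A A0 gA gt * => /ltnSE gm.
have t0 : 0 <= t by apply: le_trans (gt 1 ltr01); rewrite normr_ge0.
have [/existsP[k1 k1P]|/existsPn gN] := boolP [exists k, 0 < g k]; last first.
  rewrite big1 ?normr0 ?mulr_ge0// => k _.
  have := gN k; rewrite -leNgt => gk0; have /andP[g0 _] := gA k.
  by have -> : g k = 0; [apply/eqP; rewrite eq_le gk0 | rewrite mul0r].
pose k0 := [arg min_(k < k1 | 0 < g k) g k]%O.
have [k0P k0min] : 0 < g k0 /\ forall k, 0 < g k -> g k0 <= g k.
  by rewrite /k0; case: Order.TotalTheory.arg_minP.
set v := g k0 in k0P k0min.
pose g' k := if 0 < g k then g k - v else 0.
have g'E k : g k * e k = (if v <= g k then v * e k else 0) + g' k * e k.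
  rewrite /g'; case: ltrP => [gk|gk0]; first by rewrite k0min// -mulrDl addrC subrK.
  by rewrite leNgt (le_lt_trans gk0 k0P)/= add0r; congr (_ * _); apply/eqP;
    rewrite eq_le gk0; have /andP[-> _] := gA k.
rewrite (eq_bigr _ (fun k _ => g'E k)) big_split/= -big_mkcond/= -mulr_sumr.
have vA : v <= A by have /andP[] := gA k0.
have -> : A * t = v * t + (A - v) * t by rewrite -mulrDl addrC subrK.
apply: le_trans (ler_normD _ _) (lerD _ _).
  by rewrite normrM gtr0_norm// ler_wpM2l ?gt// ltW.
apply: IH; first by rewrite subr_ge0.
- move=> k; rewrite /g'; case: ifPn => [gk|_]; last by rewrite lexx subr_ge0.
  by rewrite subr_ge0 k0min// lerB//; have /andP[] := gA k.
- move=> s s0; rewrite (eq_bigl (fun k => s + v <= g k)); last first.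
    move=> k; rewrite /g'; case: ifPn => [gk|]; first by rewrite lerBrDr.
    rewrite -leNgt => gk; apply/idP/idP => [|sv]; first by rewrite leNgt s0.
    by have := le_trans sv gk; rewrite leNgt addr_gt0.
  by apply: gt; rewrite addr_gt0.
- apply: leq_trans gm; apply: proper_card; apply/properP; split.
    by apply/fintype.subsetP => k; rewrite !inE /g'; case: ifP => //; rewrite ltxx.
  by exists k0; rewrite !inE ?k0P// /g' k0P subrr ltxx.
Qed.

Lemma layer_cake2 (R : realFieldType) (I : finType) (g1 g2 e : I -> R) (A t : R) :
  0 <= A -> (forall k, 0 <= g1 k <= A) -> (forall k, 0 <= g2 k <= A) ->
  (forall s1 s2, 0 < s1 -> 0 < s2 ->
     `|\sum_(k | (s1 <= g1 k) && (s2 <= g2 k)) e k| <= t) ->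
  `|\sum_k g1 k * g2 k * e k| <= A ^+ 2 * t.
Proof.
move=> A0 g1A g2A gt; under eq_bigr do rewrite -mulrA.
rewrite expr2 -mulrA; apply: layer_cake => // s1 s10.
rewrite big_mkcond/=.
rewrite (eq_bigr (fun k => g2 k * (if s1 <= g1 k then e k else 0))); last first.
  by move=> k _; case: ifP => // _; rewrite mulr0.
by apply: layer_cake => // s2 s20; rewrite -big_mkcondr/= (eq_bigl _ _ (fun k => andbC _ _)) gt.
Qed.

End LayerCake.

Section Grid.
Context (R : realFieldType) (f : nat -> R) (A : R).
Hypothesis fA : forall k, 0 <= f k <= A.
Hypothesis fmono : forall k l, (k <= l)%N -> f l <= f k.

Let A0 : 0 <= A.
Proof. by have /andP[h0 hA] := fA 0; exact: le_trans hA. Qed.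

(** Subtraction is truncated, so one of the two terms vanishes and the argument of [f] is |a -
    m|. *)
Definition grid_row (a m : nat) : R := f ((a - m) + (m - a)).

Lemma grid_row_bound a m : 0 <= grid_row a m <= A.
Proof. exact: fA. Qed.

(** A charging argument: each index outside [B] is charged to itself and each index in [B] to its
    image, so no term of [H] is charged more than twice. *)
Lemma sum_le_twofold n (h H : 'I_n -> R) (B : pred 'I_n) (T : 'I_n -> 'I_n) :
  (forall m, 0 <= H m) -> (forall m, ~~ B m -> h m <= H m) ->
  (forall m, B m -> h m <= H (T m)) -> {in B &, injective T} ->
  \sum_m h m <= 2 * \sum_m H m.
Proof.
move=> H0 hN hB Tinj; rewrite (bigID B)/= mulr_natl mulr2n lerD//.
  apply: (@le_trans _ _ (\sum_(m | B m) H (T m))); first exact: ler_sum.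
  rewrite -(big_imset H (A := mem B))//= [leRHS](bigID (mem [set T x | x in B]%SET))/=.
  by rewrite lerDl sumr_ge0.
apply: (@le_trans _ _ (\sum_(m | ~~ B m) H m)); first exact: ler_sum.
by rewrite [leRHS](bigID B)/= lerDr sumr_ge0.
Qed.

Let sqrB_le (p q r s : R) : p <= q -> q <= r -> s <= p -> (p - q) ^+ 2 <= (s - r) ^+ 2.
Proof.
move=> pq qr sp; rewrite -sqrrN opprB -[leRHS]sqrrN opprB.
by rewrite lerXn2r ?nnegrE ?subr_ge0 ?lerB//; apply: le_trans qr; apply: le_trans pq.
Qed.

(* Indices left of the midpoint of [x, y] or right of the midpoint of [y, z]
   satisfy the bound as they are; the others satisfy it after a reflection about
   one of these two midpoints. Every index is then used at most twice, which is
   where the distortion [alpha = sqrt 2] comes from. *)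
Lemma grid_dist_monol n x y z : (x <= y)%N -> (y <= z)%N -> (z < n)%N ->
  \sum_(m < n) (grid_row x m - grid_row y m) ^+ 2 <=
  2 * \sum_(m < n) (grid_row x m - grid_row z m) ^+ 2.
Proof.
case: n => // n xy yz zn.
pose B (m : 'I_n.+1) := (x + y < m.*2)%N && (m.*2 <= y + z)%N.
pose T (m : 'I_n.+1) : 'I_n.+1 := if (m <= y)%N then inord (x + y - m) else inord (y + z - m).
apply: (@sum_le_twofold _ _ _ B T).
- by move=> m; exact: sqr_ge0.
- move=> m; rewrite /B negb_and -!leqNgt -ltnNge => /orP[mxy|mxy].
    rewrite -sqrrN opprB -[leRHS]sqrrN opprB.
    by apply: sqrB_le; apply: fmono; lia.
  by apply: sqrB_le; apply: fmono; lia.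
- move=> m /andP[m1 m2]; rewrite /T; case: ifP => my.
    rewrite inordK; last by lia.
    rewrite -sqrrN opprB -[leRHS]sqrrN opprB.
    have -> : grid_row y m = grid_row x (x + y - m) by rewrite /grid_row; congr f; lia.
    have -> : grid_row x m = grid_row y (x + y - m) by rewrite /grid_row; congr f; lia.
    rewrite -sqrrN opprB.
    by apply: sqrB_le; apply: fmono; lia.
  rewrite inordK; last by lia.
  by apply: sqrB_le; apply: fmono; lia.
(* The two reflections cannot collide: the first lands strictly left of the midpoint of [[x, y]],
   the second at or right of the midpoint of [[y, z]]. *)
- move=> m1 m2; rewrite !unfold_in /B /T => /andP[? ?] /andP[? ?].
  have ? := ltn_ord m1; have ? := ltn_ord m2.
  by case: ifP => ?; case: ifP => ?; move=> /(congr1 val) /=; rewrite !inordK; try lia;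
    move=> ?; apply/val_inj => /=; lia.
Qed.

Lemma grid_row_rev n a m : (a < n)%N -> (m < n)%N ->
  grid_row (n - a.+1) (n - m.+1) = grid_row a m.
Proof. by move=> an mn; rewrite /grid_row; congr f; lia. Qed.

Lemma grid_sum_rev n (F : nat -> R) : \sum_(m < n) F m = \sum_(m < n) F (n - m.+1)%N.
Proof. by rewrite (reindex_inj rev_ord_inj). Qed.

Lemma grid_dist_monor n x y z : (x <= y)%N -> (y <= z)%N -> (z < n)%N ->
  \sum_(m < n) (grid_row y m - grid_row z m) ^+ 2 <=
  2 * \sum_(m < n) (grid_row x m - grid_row z m) ^+ 2.
Proof.
move=> xy yz zn.
have revE a b : (a < n)%N -> (b < n)%N ->
    \sum_(m < n) (grid_row (n - a.+1) m - grid_row (n - b.+1) m) ^+ 2 =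
    \sum_(m < n) (grid_row b m - grid_row a m) ^+ 2.
  move=> an bn.
  rewrite (grid_sum_rev n (fun m => (grid_row (n - a.+1) m - grid_row (n - b.+1) m) ^+ 2)).
  by apply: eq_bigr => m _; rewrite !grid_row_rev// -sqrrN opprB.
have := @grid_dist_monol n (n - z.+1) (n - y.+1) (n - x.+1).
by rewrite !revE; try lia; apply; lia.
Qed.

Lemma grid_sumE (F : nat -> R) n a : (a < n)%N ->
  \sum_(m < n) F ((a - m) + (m - a))%N =
  \sum_(0 <= t < a.+1) F t + \sum_(1 <= t < n - a) F t.
Proof.
move=> an; rewrite -(big_mkord xpredT (fun m => F ((a - m) + (m - a))%N)).
rewrite (@big_cat_nat _ _ _ a.+1)//=; congr (_ + _).
  rewrite big_nat_rev/= add0n !big_mkord; apply: eq_bigr => t _; congr F.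
  by have := ltn_ord t; lia.
rewrite -[a.+1](add1n a) big_addn; apply: eq_big_nat => t /andP[t1 t2].
by congr F; lia.
Qed.

(* When [a + b < n], the part of row [b] lost on the right pairs with the part
   gained on the left, and all the differences of the pairs have the same sign. *)
Let tail_diffE (F : nat -> R) n a b : (a <= b)%N -> (a + b < n)%N ->
  (\sum_(m < n) F ((b - m) + (m - b))%N - \sum_(m < n) F ((a - m) + (m - a))%N) =
  \sum_(a.+1 <= t < b.+1) (F t - F (t + (n - (a + b).+1))%N).
Proof.
move=> ab abn; rewrite !grid_sumE; try lia.
rewrite (@big_cat_nat _ _ _ a.+1 0 b.+1)//=.
rewrite (@big_cat_nat _ _ _ (n - b) 1 (n - a))//=; try lia.
rewrite sumrB.
have -> : \sum_(a.+1 <= t < b.+1) F (t + (n - (a + b).+1))%N = \sum_(n - b <= t < n - a) F t.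
  have -> : (n - b = a.+1 + (n - (a + b).+1))%N by lia.
  rewrite big_addn.
  by have -> : (n - a - (n - (a + b).+1) = b.+1)%N by lia.
by ring.
Qed.

Definition grid_sum n a := \sum_(m < n) grid_row a m.
Definition grid_dot n a b := \sum_(m < n) grid_row a m * grid_row b m.

Let grid_sqnorm_lip0 n a b : (a <= b)%N -> (a + b < n)%N ->
  `|grid_dot n a a - grid_dot n b b| <= 2 * A * `|grid_sum n a - grid_sum n b|.
Proof.
move=> ab abn; rewrite distrC [X in _ <= _ * X]distrC /grid_dot /grid_sum.
rewrite tail_diffE// (tail_diffE (fun t => f t * f t))//.
have D0 t : 0 <= f t - f (t + (n - (a + b).+1))%N by rewrite subr_ge0 fmono// leq_addr.
rewrite !ger0_norm ?sumr_ge0//; last first.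
  by move=> t _; rewrite -!expr2 subr_sqr mulr_ge0// addr_ge0//; have /andP[] := fA t;
      have /andP[] := fA (t + (n - (a + b).+1))%N.
rewrite mulr_sumr ler_sum// => t _.
rewrite -!expr2 subr_sqr mulrC ler_wpM2r// mulr_natl mulr2n.
have /andP[_ h1] := fA t; have /andP[_ h2] := fA (t + (n - (a + b).+1))%N.
exact: lerD.
Qed.

Let grid_sumV n a : (a < n)%N -> grid_sum n (n - a.+1) = grid_sum n a.
Proof.
move=> an; rewrite /grid_sum (grid_sum_rev n (grid_row (n - a.+1))).
by apply: eq_bigr => m _; rewrite grid_row_rev.
Qed.

Let grid_dotV n a : (a < n)%N -> grid_dot n (n - a.+1) (n - a.+1) = grid_dot n a a.
Proof.
move=> an; rewrite /grid_dot.
rewrite (grid_sum_rev n (fun m => grid_row (n - a.+1) m * grid_row (n - a.+1) m)).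
by apply: eq_bigr => m _; rewrite grid_row_rev.
Qed.

(* Row sums determine squared norms: [F^2 - F'^2] is [F - F'] times a factor at
   most [2 A], term by term in the pairing above. *)
Lemma grid_sqnorm_lip n a b : (a < n)%N -> (b < n)%N ->
  `|grid_dot n a a - grid_dot n b b| <= 2 * A * `|grid_sum n a - grid_sum n b|.
Proof.
wlog ab : a b / (a <= b)%N.
  move=> W an bn; have [ab|/ltnW ba] := leqP a b; first exact: W.
  by rewrite distrC (distrC (grid_sum _ _)); exact: W.
move=> an bn; have [abn|abn] := ltnP (a + b) n; first exact: grid_sqnorm_lip0.
(* Reversing the grid brings the case [n <= a + b] back to the previous one, since the mirrored
   indices add up to at most [n - 2]. *)
rewrite -(grid_sumV an) -(grid_sumV bn) -(grid_dotV an) -(grid_dotV bn).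
rewrite distrC (distrC (grid_sum _ _)).
by apply: grid_sqnorm_lip0; lia.
Qed.

(** Row [a] is row [a.+1] shifted by one cell. On either side of the peak the differences are thus
    increments of a monotone sequence, and they telescope to at most [A]. *)
Let grid_l1_step n a : (a.+1 < n)%N ->
  \sum_(m < n) `|grid_row a m - grid_row a.+1 m| <= 2 * A.
Proof.
move=> an.
rewrite -(big_mkord xpredT (fun m => `|grid_row a m - grid_row a.+1 m|)).
rewrite (@big_cat_nat _ _ _ a.+1)//=; last by lia.
rewrite mulr_natl mulr2n lerD//.
  rewrite big_nat (eq_bigr (fun m => grid_row a.+1 m.+1 - grid_row a.+1 m)); last first.
    move=> m /andP[_ ma]; have -> : grid_row a m = grid_row a.+1 m.+1.
      by rewrite /grid_row; congr f; lia.
    by rewrite ger0_norm// subr_ge0 fmono//; lia.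
  rewrite -big_nat telescope_sumr//.
  by have /andP[? ?] := grid_row_bound a.+1 0; have /andP[? ?] := grid_row_bound a.+1 a.+1; lra.
rewrite big_nat (eq_bigr (fun m => - (grid_row a.+1 m.+1 - grid_row a.+1 m))); last first.
  move=> m /andP[am mn]; have -> : grid_row a.+1 m.+1 = grid_row a m.
    by rewrite /grid_row; congr f; lia.
  by rewrite ler0_norm ?opprB// subr_le0 fmono//; lia.
rewrite -big_nat sumrN telescope_sumr; last by lia.
by have /andP[? ?] := grid_row_bound a.+1 n; have /andP[? ?] := grid_row_bound a.+1 a.+1; lra.
Qed.

Lemma grid_l1 n a b : (a <= b)%N -> (b < n)%N ->
  \sum_(m < n) `|grid_row a m - grid_row b m| <= 2 * A * (b - a)%:R.
Proof.
move=> ab; rewrite -(subnKC ab); move: (b - a)%N => c {b ab}.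
rewrite addKn; elim: c => [|c IH] ac.
  by rewrite addn0 mulr0 big1// => m _; rewrite subrr normr0.
apply: (@le_trans _ _ (\sum_(m < n) (`|grid_row a m - grid_row (a + c) m| + `|grid_row (a + c)
    m - grid_row (a + c).+1 m|))).
  by apply: ler_sum => m _; rewrite addnS ler_distD.
rewrite big_split/= -[c.+1%:R]natr1 mulrDr mulr1 lerD//; first by apply: IH; lia.
by apply: grid_l1_step; lia.
Qed.

Lemma grid_sum_lip n a b : (a <= b)%N -> (b < n)%N ->
  `|grid_sum n a - grid_sum n b| <= 2 * A * (b - a)%:R.
Proof.
move=> ab bn; apply: le_trans (grid_l1 ab bn).
by rewrite /grid_sum -sumrB; exact: ler_norm_sum.
Qed.

Lemma grid_dist_l1 n a b c : (a <= b)%N -> (b < n)%N ->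
  `|\sum_(m < n) grid_row c m * (grid_row a m - grid_row b m)| <= 2 * A ^+ 2 * (b - a)%:R.
Proof.
move=> ab bn; apply: le_trans (ler_norm_sum _ _ _) _.
apply: (@le_trans _ _ (\sum_(m < n) A * `|grid_row a m - grid_row b m|)).
  apply: ler_sum => m _; rewrite normrM ler_wpM2r//.
  by have /andP[? ?] := grid_row_bound c m; rewrite ger0_norm.
rewrite -mulr_sumr expr2 mulrCA -!mulrA ler_wpM2l// mulrA.
exact: grid_l1.
Qed.

Definition grid_sqdist n a b := \sum_(m < n) (grid_row a m - grid_row b m) ^+ 2.

Lemma grid_sqdistE n a b :
  grid_sqdist n a b = grid_dot n a a + grid_dot n b b - 2 * grid_dot n a b.
Proof.
rewrite /grid_sqdist /grid_dot mulr_sumr -big_split/= -sumrB; apply: eq_bigr => m _; ring.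
Qed.

(** A squared difference is at most [A] times its absolute value, which makes the bound linear in
    [b - a]. This turns gaps of order [ln n] into a [delta] of order [A * sqrt (ln n)]. *)
Lemma grid_sqdist_le n a b : (a <= b)%N -> (b < n)%N ->
  grid_sqdist n a b <= 2 * A ^+ 2 * (b - a)%:R.
Proof.
move=> ab bn.
apply: (@le_trans _ _ (\sum_(m < n) A * `|grid_row a m - grid_row b m|)).
  apply: ler_sum => m _; rewrite -(real_normK (num_real _)) expr2 ler_wpM2r//.
  have /andP[? ?] := grid_row_bound a m; have /andP[? ?] := grid_row_bound b m.
  by rewrite ler_norml; lra.
by rewrite -mulr_sumr expr2 mulrCA -!mulrA ler_wpM2l// mulrA grid_l1.
Qed.

End Grid.

(** * PINES for a distance close to a line *)

Section PermFlip.
Context (n : nat).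
Implicit Types s : 'S_n.

Definition perm_flip s : 'S_n := (s * perm (@rev_ord_inj n))%g.

Lemma perm_flipE s i : perm_flip s i = (n - (s i).+1)%N :> nat.
Proof. by rewrite /perm_flip permM permE. Qed.

Lemma perm_flip_lt s i j : (perm_flip s i < perm_flip s j)%N = (s j < s i)%N.
Proof. by rewrite !perm_flipE; have := ltn_ord (s i); have := ltn_ord (s j); lia. Qed.

End PermFlip.

Section PinesOnALine.
Context (R : realType) (n : nat) (dd : 'I_n -> 'I_n -> R) (alpha delta eps : R).
Hypotheses (dd0 : forall i, dd i i = 0) (ddC : forall i j, dd i j = dd j i).
Hypothesis dd_triangle : forall i j k, dd i k <= dd i j + dd j k.
Hypotheses (alpha1 : 1 <= alpha) (delta0 : 0 <= delta) (eps0 : 0 <= eps).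

(* [s] ranks the objects along a line on which [dd] is, up to the factor [alpha],
   monotone away from each object, and consecutive objects are [delta]-close. *)
Definition line_order (s : 'S_n) : Prop :=
  (forall i j k, (s i <= s j)%N -> (s j <= s k)%N ->
     dd i j <= alpha * dd i k /\ dd j k <= alpha * dd i k) /\
  (forall i j, s j = (s i).+1 :> nat -> dd i j <= delta).

(** The two inequalities of the first clause exchange their roles. Every statement about the left of
    an object therefore also serves for its right. *)
Lemma line_order_flip s : line_order s -> line_order (perm_flip s).
Proof.
move=> [h1 h2]; split.
  move=> i j k; rewrite !perm_flipE.
  have := ltn_ord (s i); have := ltn_ord (s j); have := ltn_ord (s k) => ? ? ? ij jk.
  have [||? ?] := h1 k j i; try lia.
  by rewrite (ddC i j) (ddC j k) (ddC i k).
move=> i j; rewrite !perm_flipE; have := ltn_ord (s i); have := ltn_ord (s j) => ? ? ij.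
by rewrite ddC h2//; lia.
Qed.

Context (D : 'M[R]_n).
Hypothesis DC : forall i j, D i j = D j i.
Hypothesis Ddd : forall i j, `|D i j - dd i j| <= eps.

(** The radii satisfy [rho2 = alpha * (rho3 + eps) + 2 * eps] and
    [rho1 = alpha * (rho2 + eps) + 2 * eps]: each one leaves room for one use of monotonicity up to
    [alpha] and for the passages between [D] and [dd]. *)
Let rho3 := delta + eps.
Let rho2 := alpha * delta + 2 * (1 + alpha) * eps.
Let rho1 := alpha ^+ 2 * delta + (2 * alpha ^+ 2 + 3 * alpha + 2) * eps.

Let D_le i j : D i j <= dd i j + eps.
Proof. by have := Ddd i j; rewrite ler_norml => /andP[_]; rewrite lerBlDl. Qed.

Let D_ge i j : dd i j <= D i j + eps.
Proof. by have := Ddd i j; rewrite ler_norml => /andP[h _]; lra. Qed.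

Let dd_ge0 i j : 0 <= dd i j.
Proof. by have := dd_triangle i j i; rewrite dd0 (ddC j) -mulr2n pmulrn_lge0. Qed.

Let alpha_ge0 : 0 <= alpha.
Proof. exact: le_trans alpha1. Qed.

Let alpha_eps : eps <= alpha * eps.
Proof. by rewrite ler_peMl. Qed.

Let alpha_delta : 0 <= alpha * delta.
Proof. exact: mulr_ge0. Qed.

Let perm_neq (s : 'S_n) i j : i != j -> s i != s j :> nat.
Proof. by apply: contraNneq => /val_inj/perm_inj->. Qed.

Section Side.
Variables (s : 'S_n) (p : {set 'I_n}) (i : 'I_n).
Hypotheses (sP : line_order s) (pP : packing D rho1 p) (ip : i \in p).

(* No edge of the graph of [i] jumps over [i]: a short edge doing so would have
   its endpoints too close to [i] to be vertices. *)
Let edge_side_lt j k : graph_edge D rho2 rho3 i j k -> (s j < s i)%N -> (s k < s i)%N.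
Proof.
move=> /and4P[jV kV _ jk] ji; rewrite ltnNge; apply/negP => ik.
have [h _] := sP.1 j i k (ltnW ji) ik.
have h1 : alpha * dd j k <= alpha * (delta + 2 * eps).
  by rewrite ler_wpM2l// (le_trans (D_ge _ _))//; move: jk; rewrite /rho3 => ?; lra.
have := D_le i j; have := (alpha_eps, eps0); rewrite (ddC i).
by move: jV; rewrite inE /rho2 => ? [? ?] ?; lra.
Qed.

Lemma graph_edgeC j k : graph_edge D rho2 rho3 i j k = graph_edge D rho2 rho3 i k j.
Proof. by rewrite /graph_edge eq_sym DC; case: (j \in _); case: (k \in _). Qed.

Lemma connect_edgeC : connect_sym (graph_edge D rho2 rho3 i).
Proof. by apply: sym_connect_sym => j k; exact: graph_edgeC. Qed.

Lemma connect_side j k : connect (graph_edge D rho2 rho3 i) j k ->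
  (s j < s i)%N = (s k < s i)%N.
Proof.
move=> /connectP[q + ->]; elim: q j => //= x q IH j /andP[jx /IH <-].
by apply/idP/idP; apply: edge_side_lt; rewrite // graph_edgeC.
Qed.

Let packing_gt j : j \in p -> j != i -> rho1 < D i j.
Proof.
move=> jp ji; have /forall_inP/(_ _ ip)/forall_inP/(_ _ jp)/implyP := pP.
by apply; rewrite eq_sym.
Qed.

(** [u] lies beyond the packing point [j], so up to the factor [alpha] it is at least as far from
    [i], and [rho1] exceeds [rho2] by more than this loss. *)
Lemma left_vertex j u : j \in p -> (s j < s i)%N -> (s u <= s j)%N ->
  u \in graph_vertices D rho2 i.
Proof.
move=> jp ji uj; have jNi : j != i by apply: contraTneq ji => ->; rewrite ltnn.
have := packing_gt jp jNi.
have [_ h] := sP.1 u j i uj (ltnW ji).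
have := D_ge i u; have := D_le i j.
rewrite inE /rho1 /rho2 (ddC i u) (ddC i j) => h1 h2 h3.
rewrite -(@ltr_pM2l _ alpha); last exact: lt_le_trans alpha1.
have h4 : alpha * dd u i <= alpha * (D i u + eps) by rewrite ler_wpM2l.
by have := (alpha_eps, eps0); move=> [? ?]; lra.
Qed.

(** The path visits all the objects between [j] and [k] one rank at a time. Consecutive objects are
    within [rho3] for [D], and the packing point closer to [i] guarantees that all of them are
    vertices. *)
Lemma left_connected j k : j \in p -> k \in p -> (s j < s i)%N -> (s k < s i)%N ->
  connect (graph_edge D rho2 rho3 i) j k.
Proof.
wlog jk : j k / (s j <= s k)%N.
  move=> W jp kp ji ki; have [jk|/ltnW kj] := leqP (s j) (s k); first exact: W.
  by rewrite connect_edgeC; exact: W.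
move=> jp kp ji ki.
have {jp ji} : forall c u, (s u + c = s k)%N -> connect (graph_edge D rho2 rho3 i) u k.
  elim => [|c IH] u uk.
    by have -> : u = k by apply/(@perm_inj _ s)/val_inj => /=; rewrite -uk addn0.
  have un : ((s u).+1 < n)%N.
    by apply: leq_trans (ltn_ord (s k)); rewrite -uk addnS !ltnS leq_addr.
  pose w := (s^-1)%g (Ordinal un).
  have sw : s w = (s u).+1 :> nat by rewrite /w permKV.
  apply: connect_trans (IH w _); last by rewrite sw addSnnS.
  apply: connect1; apply/and4P; split.
  - by apply: (left_vertex kp) => //; rewrite -uk leq_addr.
  - by apply: (left_vertex kp) => //; rewrite sw -uk addnS ltnS leq_addr.
  - by apply/eqP => uw; move: sw; rewrite -uw => /n_Sn.
  - by rewrite (le_trans (D_le _ _))// lerD2r; apply: sP.2.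
by move/(_ (s k - s j)%N j); apply; rewrite subnKC.
Qed.

End Side.

(** The right part is the left part for [perm_flip s]. *)
Definition left_part (s : 'S_n) (p : {set 'I_n}) i := [set x in p | (s x < s i)%N]%SET.

Section Sides.
Variables (s : 'S_n) (p : {set 'I_n}).
Hypotheses (sP : line_order s) (pP : packing D rho1 p).

Let L i := left_part s p i.
Let Rt i := left_part (perm_flip s) p i.

Let in_Rt i x : (x \in Rt i) = (x \in p) && (s i < s x)%N.
Proof. by rewrite inE perm_flip_lt. Qed.

Let same_side i j k : i \in p -> j \in p :\ i -> k \in p :\ i ->
  connect (graph_edge D rho2 rho3 i) j k = ((s j < s i)%N == (s k < s i)%N).
Proof.
move=> ip; rewrite !inE => /andP[/(perm_neq s) ji jp] /andP[/(perm_neq s) ki kp].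
apply/idP/eqP => [|jk]; first exact: connect_side.
have [si|si] := ltnP (s j) (s i).
  by apply: (@left_connected s p) => //; rewrite -jk.
apply: (@left_connected (perm_flip s) p) => //; first exact: line_order_flip.
  by rewrite perm_flip_lt ltn_neqAle eq_sym ji.
by rewrite perm_flip_lt ltn_neqAle eq_sym ki leqNgt -jk -leqNgt.
Qed.

Let side_vertex i x : i \in p -> x \in p :\ i -> x \in graph_vertices D rho2 i.
Proof.
move=> ip; rewrite !inE => /andP[/(perm_neq s) xi xp].
have [si|si] := ltnP (s x) (s i).
  by have := left_vertex sP pP ip xp si (leqnn _); rewrite inE.
have := left_vertex (line_order_flip sP) pP ip xp _ (leqnn _); rewrite inE; apply.
by rewrite perm_flip_lt ltn_neqAle eq_sym xi.
Qed.

Let comp i j := [set k | connect (graph_edge D rho2 rho3 i) j k]%SET.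

Let comp_mem i x : i \in p -> x \in p :\ i -> comp i x \in graph_components D rho2 rho3 i.
Proof. by move=> ip xp; apply/imsetP; exists x => //; exact: side_vertex. Qed.

Let comp_in i K x y : i \in p -> K \in graph_components D rho2 rho3 i ->
  x \in p :\ i -> y \in p :\ i -> x \in K -> (y \in K) = ((s x < s i)%N == (s y < s i)%N).
Proof.
move=> ip /imsetP[j jV ->] xp yp; rewrite !inE => jx.
by rewrite -(same_side ip xp yp) (same_connect (@connect_edgeC i) jx).
Qed.

Let side_split i K x : i \in p -> K \in graph_components D rho2 rho3 i ->
  x \in p :\ i -> x \in K ->
  ((p :\ i) :&: K)%SET = if (s x < s i)%N then L i else Rt i.
Proof.
move=> ip KG xp xK; apply/setP => y; rewrite inE; apply/andP/idP => [[yp yK]|].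
  move: yK; rewrite (comp_in ip KG xp yp xK).
  move: yp; rewrite finset.in_setD1 => /andP[/(perm_neq s) yi yp].
  case: ifP => _ /eqP h; first by rewrite inE yp -h.
  by rewrite in_Rt yp /= ltn_neqAle eq_sym yi leqNgt -h.
case: ifP => xi.
  rewrite inE => /andP[yp yi].
  have yp' : y \in p :\ i by rewrite finset.in_setD1 yp andbT; apply: contraTneq yi => ->;
      rewrite ltnn.
  by rewrite (comp_in ip KG xp yp' xK) xi yi.
rewrite in_Rt => /andP[yp yi].
have yp' : y \in p :\ i by rewrite finset.in_setD1 yp andbT; apply: contraTneq yi => ->;
    rewrite ltnn.
by rewrite (comp_in ip KG xp yp' xK) xi ltnNge ltnW.
Qed.

Let LUR i : i \in p -> (p :\ i = L i :|: Rt i)%SET.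
Proof.
move=> ip; apply/setP => x; rewrite finset.in_setU in_Rt finset.in_setD1 inE -andb_orr andbC.
by congr andb; rewrite -neq_ltn; apply/idP/idP => [/(perm_neq s)//|]; apply: contraNneq => ->.
Qed.

Let one_side_empty i K : i \in p -> K \in graph_components D rho2 rho3 i ->
  p :\ i \subset K -> L i = finset.set0 \/ Rt i = finset.set0.
Proof.
move=> ip KG pK.
have [Rt0|/set0Pn[y yR]] := eqVneq (Rt i) finset.set0; [by right|left].
apply/setP => x; rewrite finset.in_set0; apply/negP => xL.
have yp : y \in p :\ i by rewrite (LUR ip) finset.in_setU yR orbT.
have xp : x \in p :\ i by rewrite (LUR ip) finset.in_setU xL.
have := comp_in ip KG yp xp (fintype.subsetP pK _ yp).
rewrite (fintype.subsetP pK _ xp).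
move: yR; rewrite in_Rt => /andP[_ yi]; move: xL; rewrite inE => /andP[_ ->].
by rewrite ltnNge ltnW.
Qed.

(** No component reaches across [i], and each side is contained in one component. The second
    conjunct serves to start a run: an end of the packing must be recognizable by its empty [Cp],
    even though the naming of the traces is free. *)
Lemma sides_parts i Cm Cp : i \in p -> sides D rho2 rho3 p i Cm Cp ->
  ((Cm = L i /\ Cp = Rt i) \/ (Cm = Rt i /\ Cp = L i)) /\
  (L i = finset.set0 \/ Rt i = finset.set0 -> Cp = finset.set0).
Proof.
move=> ip; case.
  move=> h; split=> //.
  have : L i = finset.set0 \/ Rt i = finset.set0.
    case: h => [p0|[K KG pK]]; last exact: one_side_empty pK.
    left; apply/eqP; rewrite -finset.subset0 -p0 (LUR ip); exact: finset.subsetUl.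
  by rewrite (LUR ip) => -[->|->]; rewrite ?finset.set0U ?finset.setU0; [right|left].
move=> K1 K2 K1G K2G pK12 p0 Nsub.
(* Neither component contains all of [p :\ i], so each misses a point that the other one must cover.
   These two points lie on opposite sides of [i]. *)
have /subsetPn[x xp xK1] := Nsub _ K1G.
have /subsetPn[y yp yK2] := Nsub _ K2G.
have xK2 : x \in K2.
  by have := fintype.subsetP pK12 _ xp; rewrite inE (negbTE xK1).
have yK1 : y \in K1.
  by have := fintype.subsetP pK12 _ yp; rewrite inE (negbTE yK2) orbF.
have xy : (s x < s i)%N != (s y < s i)%N.
  by rewrite -(comp_in ip K2G xp yp xK2).
split; last first.
  move: xp yp; rewrite (LUR ip) !finset.in_setU !in_Rt !inE.
  move=> xp yp [] /setP H.
    move: (H x) (H y); rewrite !inE.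
    by move: xp yp xy; case: (x \in p) => //; case: (y \in p) => //=; case: (s x < s i)%N;
        case: (s y < s i)%N.
  move: (H x) (H y); rewrite !in_Rt !finset.in_set0.
  by move: xp yp xy; case: (x \in p) => //; case: (y \in p) => //=; case: (s i < s x)%N => //;
      case: (s i < s y)%N => //; rewrite !orbF => -> ->.
rewrite (side_split ip K1G yp yK1) (side_split ip K2G xp xK2).
by move: xy; case: (s x < s i)%N; case: (s y < s i)%N => // _; [right|left].
Qed.

Lemma sides_exist i : i \in p -> exists Cm Cp, sides D rho2 rho3 p i Cm Cp.
Proof.
move=> ip.
have [p0|/set0Pn[x xp]] := eqVneq (p :\ i) finset.set0.
  by exists (p :\ i), finset.set0; constructor; left.
have [xK|/subsetPn[y yp yx]] := boolP (p :\ i \subset comp i x).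
  by exists (p :\ i), finset.set0; constructor; right; exists (comp i x) => //; exact: comp_mem.
have xx : x \in comp i x by rewrite inE connect0.
have yy : y \in comp i y by rewrite inE connect0.
have xy : (s x < s i)%N != (s y < s i)%N.
  by rewrite -(comp_in ip (comp_mem ip xp) xp yp xx).
exists ((p :\ i) :&: comp i x)%SET, ((p :\ i) :&: comp i y)%SET.
apply: TwoSides; rewrite ?comp_mem//.
- apply/fintype.subsetP => z zp; rewrite finset.in_setU.
  rewrite (comp_in ip (comp_mem ip xp) xp zp xx) (comp_in ip (comp_mem ip yp) yp zp yy).
  by move: xy; case: (s x < s i)%N; case: (s y < s i)%N => //; case: (s z < s i)%N.
- by apply/set0Pn; exists x.
- move=> K KG; apply/negP => pK.
  have := comp_in ip KG xp yp (fintype.subsetP pK _ xp).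
  by rewrite (fintype.subsetP pK _ yp) (negbTE xy).
Qed.

End Sides.

Section Runs.
Variables (p : {set 'I_n}) (Cm Cp : 'I_n -> {set 'I_n}).
Hypothesis pP : packing D rho1 p.
Hypothesis CP : {in p, forall i, sides D rho2 rho3 p i (Cm i) (Cp i)}.

(* Since [s] may be replaced by [perm_flip s], runs are only described up to the
   orientation of the line. *)
Definition initial_run (s : 'S_n) (q : seq 'I_n) : Prop :=
  [/\ {subset q <= p}, sorted (fun x y => s x < s y)%N q &
      forall x y, x \in q -> y \in p -> (s y < s x)%N -> y \in q].

Let left_flip s i : left_part (perm_flip (perm_flip s)) p i = left_part s p i.
Proof. by apply/setP => x; rewrite !inE !perm_flip_lt. Qed.

Let mem_right s i x : (x \in left_part (perm_flip s) p i) = (x \in p) && (s i < s x)%N.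
Proof. by rewrite inE perm_flip_lt. Qed.

Let initial_run_rcons s q i : initial_run s q -> i \in p -> left_part s p i = [set:: q]%SET ->
  initial_run s (rcons q i).
Proof.
move=> [qp qs qc] ip Lq; split.
- by move=> x; rewrite mem_rcons in_cons => /predU1P[->//|]; exact: qp.
- have qi x : x \in q -> (s x < s i)%N.
    by have := congr1 (fun B : {set 'I_n} => x \in B) Lq; rewrite !inE => <- /andP[].
  case: q qs qi {qp qc Lq} => //= y q qs qi.
  by rewrite rcons_path qs/=; apply: qi; exact: mem_last.
- move=> x y; rewrite !mem_rcons !in_cons => /predU1P[->|xq] yp yx; last first.
    by rewrite (qc x y) ?orbT.
  have := congr1 (fun B : {set 'I_n} => y \in B) Lq; rewrite !inE yp yx/= => <-.
  by rewrite orbT.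
Qed.

(** A run cannot change direction: if [q] were the part on the right of [i], closure to the left
    would put [i] itself in [q], hence strictly on its own right. *)
Let initial_run_next s q i : initial_run s q -> q != [::] -> i \in p ->
  left_part (perm_flip s) p i != [set:: q]%SET.
Proof.
case: q => // x q [qp qs qc] _ ip; apply/eqP => Rq.
have := congr1 (fun B : {set 'I_n} => x \in B) Rq.
rewrite mem_right inE mem_head => /andP[xp ix].
have iq := qc x i (mem_head _ _) ip ix.
have := congr1 (fun B : {set 'I_n} => i \in B) Rq.
by rewrite mem_right ltnn andbF inE iq.
Qed.

(** The first object has an empty [Cp], so it is an end of the packing, and this fixes an
    orientation. [initial_run_next] then excludes the opposite one at each later choice. *)
Lemma ordering_run_initial s q : line_order s -> ordering_run p Cm Cp q ->
  initial_run s q \/ initial_run (perm_flip s) q.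
Proof.
move=> sP; elim=> [|{}q i _ IH]; first by left.
case: q IH => [_ /andP[ip /eqP Cp0]|x q IH /andP[ip adm]].
  have [LR _] := sides_parts sP pP ip (CP ip).
  have H0 : left_part s p i = finset.set0 \/ left_part (perm_flip s) p i = finset.set0.
    by case: LR => -[_ <-]; [right|left].
  have nilE : [set:: [::]]%SET = finset.set0 :> {set 'I_n} by apply/setP => y; rewrite !inE.
  by case: H0 => h; [left|right]; apply: (@initial_run_rcons _ [::]); rewrite ?nilE.
have [LR _] := sides_parts sP pP ip (CP ip).
have {adm LR} H : left_part s p i = [set:: x :: q]%SET \/
    left_part (perm_flip s) p i = [set:: x :: q]%SET.
  by case: LR adm => -[-> ->] /orP[] /eqP->; by [left|right].
case: IH => IH.
  left; apply: initial_run_rcons => //.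
  by case: H => // /eqP h; have := initial_run_next IH isT ip; rewrite h.
right; apply: initial_run_rcons => //.
case: H => // /eqP h; have := initial_run_next IH isT ip.
by rewrite left_flip h.
Qed.

Let initial_run_uniq s q : initial_run s q -> uniq q.
Proof.
move=> [_ qs _]; apply: sorted_uniq qs => [x y z /= |x /=]; first exact: ltn_trans.
by rewrite ltnn.
Qed.

(** The witness is the leftmost packing point not yet listed; it shows that PINES never gets
    stuck. *)
Let initial_run_extend s q : initial_run s q -> (size q < #|p|)%N ->
  exists2 i, i \in p & left_part s p i = [set:: q]%SET.
Proof.
move=> qI qp; have qu := initial_run_uniq qI; case: qI => qsub qs qc.
have [x xp xq] : exists2 x, x \in p & x \notin q.
  apply/subsetPn; apply/negP => pq; move: qp; rewrite ltnNge -(card_uniqP qu).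
  by rewrite subset_leq_card.
pose i := [arg min_(i < x | (i \in p) && (i \notin q)) (s i : nat)].
have [/andP[ip iq] imin] : (i \in p) && (i \notin q) /\
    forall j, (j \in p) && (j \notin q) -> (s i <= s j)%N.
  by rewrite /i; case: arg_minnP => //; rewrite xp xq.
exists i => //; apply/setP => y; rewrite !inE; apply/andP/idP => [[yp yi]|yq].
  by apply: contraTT yi => yq; rewrite -leqNgt imin// yp.
split; first exact: qsub.
rewrite ltnNge; apply: contraNN iq => iy.
have [->//|yi] := eqVneq i y; apply: (qc y i) => //.
by rewrite ltn_neqAle iy perm_neq.
Qed.

Lemma ordering_run_extend s q : line_order s -> ordering_run p Cm Cp q -> (size q < #|p|)%N ->
  exists i, admissible_next p Cm Cp q i.
Proof.
move=> sP qR qp.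
have adm s' : line_order s' -> initial_run s' q -> exists i, admissible_next p Cm Cp q i.
  move=> s'P qI; have [i ip Li] := initial_run_extend qI qp; exists i.
  have [LR C0] := sides_parts s'P pP ip (CP ip).
  rewrite /admissible_next ip/=; case: q Li {qR qI qp} => [Li|x q Li].
    by apply/eqP/C0; left; rewrite Li; apply/setP => y; rewrite !inE.
  by case: LR => -[-> ->]; rewrite Li eqxx ?orbT.
case: (ordering_run_initial sP qR) => qI; first exact: (adm s).
by apply: (adm (perm_flip s)) => //; exact: line_order_flip.
Qed.

Lemma initial_run_index s q : initial_run s q -> size q = #|p| ->
  {in p &, forall x y, (s x < s y)%N -> (x \in q) && (y \in q) && (index x q < index y q)%N}.
Proof.
move=> qI qp; have qu := initial_run_uniq qI; case: qI => qsub qs qc.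
have pq x : x \in p -> x \in q.
  have : [set:: q]%SET == p.
    rewrite finset.eqEcard -qp cardsE (card_uniqP qu) leqnn andbT.
    by apply/fintype.subsetP => z; rewrite inE; exact: qsub.
  by move=> /eqP<-; rewrite inE.
move=> x y /pq xq /pq yq xy; rewrite xq yq/=.
rewrite ltnNge leq_eqVlt; apply/negP => /predU1P[e|yx].
  move: xy; have -> : x = y by rewrite -(nth_index x xq) -e nth_index.
  by rewrite ltnn.
have tr : transitive (fun x y : 'I_n => s x < s y)%N by move=> a b c; exact: ltn_trans.
by have := sorted_ltn_index tr qs y x yq xq yx; rewrite ltnNge ltnW.
Qed.

End Runs.

(** Cells may interleave on the line, but only at short range. Either [j] lies between [u] and [i],
    and [u] is close to [j], or [u] lies between [j] and [v], and [dd u v] is at most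
    [alpha * dd j v]. *)
Let cell_overlap s u v i j rho : line_order s -> (s u < s v)%N -> (s j <= s i)%N ->
  dd i u <= rho -> dd j v <= rho -> dd u v <= (1 + alpha) * rho.
Proof.
move=> sP uv ji ri rj; have rho0 : 0 <= rho by exact: le_trans ri.
have arho : rho <= alpha * rho by rewrite ler_peMl.
have [uj|ju] := leqP (s u) (s j).
  have [h _] := sP.1 u j i uj ji.
  have h2 : alpha * dd u i <= alpha * rho by rewrite ler_wpM2l// ddC.
  by have := dd_triangle u j v; move=> ?; lra.
have [_ h] := sP.1 j u v (ltnW ju) (ltnW uv).
have h2 : alpha * dd j v <= alpha * rho by rewrite ler_wpM2l.
by lra.
Qed.

Lemma pines_order s r0 r : line_order s -> pines_output D rho1 rho2 rho3 r0 r ->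
  exists2 s', s' = s \/ s' = perm_flip s & forall u v, (s' u < s' v)%N ->
    (1 + alpha) * (rho1 + eps) < dd u v -> (r u < r v)%N.
Proof.
move=> sP; case=> {r}[p cell Cm Cp q r [pmax cover _ cellP] CP qR qp rk|p cell i [pmax _ _ _]
    ip NS|p cell Cm Cp q [pmax _ _ _] CP qR qp N]; last 2 first.
- by have [Cm [Cp /NS]] := sides_exist sP (maxsetp pmax) ip.
- have [i] := ordering_run_extend (maxsetp pmax) CP sP qR qp.
  by rewrite (negbTE (N i)).
have pP := maxsetp pmax.
have [s' s's qI] : exists2 s', s' = s \/ s' = perm_flip s & initial_run p s' q.
  by case: (ordering_run_initial pP CP sP qR) => h; [exists s => //;
      left|exists (perm_flip s) => //; right].
exists s' => // u v uv duv.
have s'P : line_order s' by case: s's => -> //; exact: line_order_flip.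
have cellOf x : exists2 i, i \in p & x \in cell i.
  have : x \in (\bigcup_(i in p) cell i)%SET by rewrite cover inE.
  by move=> /finset.bigcupP[i ip xi]; exists i.
clear cover.
have cell_dd i x : i \in p -> x \in cell i -> dd i x <= rho1 + eps.
  move=> ip xi; have [_ /fintype.subsetP/(_ _ xi)] := cellP i ip.
  by rewrite inE => h; rewrite (le_trans (D_ge _ _))// lerD2r.
have [i ip ui] := cellOf u; have [j jp vj] := cellOf v.
have ri := cell_dd _ _ ip ui; have rj := cell_dd _ _ jp vj.
have [ij|ji] := ltnP (s' i) (s' j).
  have /andP[/andP[iq jq] idx] := initial_run_index qI qp ip jp ij.
  exact: (rk i j).
by move: duv; rewrite ltNge (cell_overlap s'P uv ji ri rj).
Qed.

(* Pigeonhole: if [k], whose true rank is the output rank of [i], were far from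
   [i], then all the objects beyond [k] would be output beyond [i], one too many. *)
Lemma misplaced_close (s r : 'S_n) (B : R) : line_order s -> 0 <= B ->
  (forall u v, (s u < s v)%N -> B < dd u v -> (r u < r v)%N) ->
  forall i k, s k = r i -> dd i k <= alpha * B.
Proof.
move=> sP B0 rB i k sk; rewrite leNgt; apply/negP => ik.
have BB : B <= alpha * B by rewrite ler_peMl.
have alpha_gt0 : 0 < alpha by exact: lt_le_trans alpha1.
(* Passing from true to output ranks injects [P] into its subset [Q], so the two coincide. Applied
   to a closed and an open half-line ending at [r i], this is absurd. *)
have contra (P Q : pred 'I_n) : (forall u, P (s u) -> Q (r u)) -> (forall x, Q x -> P x) ->
    P (r i) -> Q (r i).
  move=> PQ QP Pi.
  have sub : s @^-1: [set x | P x]%SET \subset (r @^-1: [set x | Q x])%SET.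
    by apply/fintype.subsetP => u; rewrite !inE; exact: PQ.
  have /eqP QP' : [set x | Q x]%SET == [set x | P x]%SET.
    rewrite finset.eqEcard -(card_preimset _ (@perm_inj _ s)) -(card_preimset [set x | Q x]%SET
        (@perm_inj _ r)).
    by rewrite subset_leq_card// andbT; apply/fintype.subsetP => u; rewrite !inE; exact: QP.
  have : r i \in [set x | Q x]%SET by rewrite QP' inE.
  by rewrite inE.
have [ik'|ki|e] := ltngtP (s i) (s k).
- suff : (r i < r i)%N by rewrite ltnn.
  apply: (contra (fun x : 'I_n => r i <= x)%N (fun x : 'I_n => r i < x)%N) => //;
      last by move=> x /ltnW.
  move=> u iu; have ku : (s k <= s u)%N by rewrite sk.
  apply: rB; first exact: leq_trans ku.
  have [h _] := sP.1 i k u (ltnW ik') ku.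
  by rewrite -(ltr_pM2l alpha_gt0) (lt_le_trans ik).
- suff : (r i < r i)%N by rewrite ltnn.
  apply: (contra (fun x : 'I_n => x <= r i)%N (fun x : 'I_n => x < r i)%N) => //;
      last by move=> x /ltnW.
  move=> u iu; have ku : (s u <= s k)%N by rewrite sk.
  apply: rB; first exact: leq_ltn_trans ki.
  have [_ h] := sP.1 u k i ku (ltnW ki).
  by rewrite -(ltr_pM2l alpha_gt0) (lt_le_trans ik)// ddC.
- have e' : i = k by apply/(@perm_inj _ s)/val_inj.
  by move: ik; rewrite e' dd0 ltNge mulr_ge0.
Qed.

End PinesOnALine.

(** * Loss of a permutation *)

Section Loss.
Context (R : realType) (n : nat).
Implicit Types (X M : 'M[R]_n) (s r : 'S_n).

Lemma ell2_ge0 X s : 0 <= ell2 X s.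
Proof.
apply: lb_le_inf; last by move=> _ [M _ <-]; exact: sqrtr_ge0.
exists (frobenius (perm_conj s X - 0)); exists 0 => //; split; first by rewrite trmx0.
by move=> i; split=> j k _ _; rewrite !mxE.
Qed.

Lemma ell2_le X s M : robinson M -> ell2 X s <= frobenius (perm_conj s X - M).
Proof.
move=> MR; apply: ge_inf; last by exists M.
by exists 0 => _ [N _ <-]; exact: sqrtr_ge0.
Qed.

Lemma ell2_le_dim X s A : 0 <= A -> (forall i j, 0 <= X i j <= A) -> ell2 X s <= n%:R * A.
Proof.
move=> A0 XA; have R0 : robinson (0 : 'M[R]_n).
  by split; [rewrite trmx0|move=> i; split=> j k _ _; rewrite !mxE].
apply: le_trans (ell2_le X s R0) _; rewrite subr0 /frobenius.
rewrite -[leRHS]ger0_norm ?mulr_ge0// -sqrtr_sqr ler_wsqrtr//.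
apply: (@le_trans _ _ (\sum_(i < n) \sum_(j < n) A ^+ 2)).
  apply: ler_sum => i _; apply: ler_sum => j _.
  rewrite -(permKV s i) -(permKV s j) perm_conjE.
  by have /andP[x0 xA] := XA ((s^-1)%g i) ((s^-1)%g j); rewrite lerXn2r ?nnegrE.
by rewrite !sumr_const !card_ord -mulrnA -[leLHS]mulr_natl natrM exprMn expr2.
Qed.

(** The comparison matrix is the sorted one, whose entry at [(r i, r j)] is [X (t i) (t j)], where
    the true rank of [t i] is the output rank of [i]. Changing the row index and then the column
    index costs the same by symmetry, hence the factor 2. *)
Lemma ell2_le_displacement X s r B : X^T = X -> robinson (perm_conj s X) ->
  (forall i k, s k = r i -> \sum_j (X i j - X k j) ^+ 2 <= B ^+ 2) -> 0 <= B ->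
  ell2 X r <= 2 * Num.sqrt n%:R * B.
Proof.
move=> XT sR sB B0; apply: le_trans (ell2_le X r sR) _; rewrite /frobenius.
have subE (M N : 'M[R]_n) i j : (M - N) i j = M i j - N i j by rewrite !mxE.
have XC i j : X i j = X j i by rewrite -[in LHS]XT mxE.
pose t := (r * s^-1)%g.
have st i : s (t i) = r i by rewrite /t permM permKV.
have -> : 2 * Num.sqrt n%:R * B = Num.sqrt (n%:R * (2 * B) ^+ 2).
  rewrite sqrtrM// sqrtr_sqr ger0_norm ?mulr_ge0//; ring.
apply: ler_wsqrtr.
rewrite (reindex_inj (@perm_inj _ r))/=.
under eq_bigr => i _ do rewrite (reindex_inj (@perm_inj _ r))/=.
apply: (@le_trans _ _ (\sum_i \sum_j (2 * (X i j - X (t i) j) ^+ 2 + 2 * (X j (t i) - X (t j)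
    (t i)) ^+ 2))).
  apply: ler_sum => i _; apply: ler_sum => j _.
  rewrite subE perm_conjE -st -(st j) perm_conjE (XC j) (XC (t j)).
  set a := X i j; set b := X (t i) j; set c := X (t i) (t j).
  by have := sqr_ge0 (a - b - (b - c)); nra.
under eq_bigr do rewrite big_split/=.
rewrite big_split/=.
have -> : \sum_i \sum_j 2 * (X j (t i) - X (t j) (t i)) ^+ 2 =
          \sum_i \sum_j 2 * (X i j - X (t i) j) ^+ 2.
  by rewrite exchange_big/=; apply: eq_bigr => i _; rewrite [RHS](reindex_inj (@perm_inj _ t)).
rewrite -big_split/=.
apply: (@le_trans _ _ (\sum_(i < n) 4 * B ^+ 2)).
  apply: ler_sum => i _; rewrite -mulr_sumr.
  by have := sB i (t i) (st i); move=> h; lra.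
by rewrite sumr_const card_ord -mulr_natl exprMn; lra.
Qed.

End Loss.

Section RankPermutation.
Context (R : realType) (n : nat).

Lemma rank_perm_exists (V : 'I_n -> R) :
  exists s : 'S_n, forall i j, (s i <= s j)%N -> V i <= V j.
Proof.
pose leV := [rel i j | V i <= V j].
pose q := sort leV (enum 'I_n).
have mem_q i : i \in q by rewrite mem_sort mem_enum.
have size_q : size q = n by rewrite size_sort size_enum_ord.
have idx_lt i : (index i q < n)%N by rewrite -[X in (_ < X)%N]size_q index_mem.
have inj : injective (fun i => Ordinal (idx_lt i)).
  by move=> i j /(congr1 val)/= e; rewrite -(nth_index i (mem_q i)) e nth_index.
exists (perm inj) => i j; rewrite !permE/=.
have tr : transitive leV by move=> a b c /=; exact: le_trans.
have qs : sorted leV q by apply: sort_sorted => a b; exact: le_total.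
exact: (sorted_leq_index tr (fun x => lexx (V x)) qs).
Qed.

Lemma robinson_sorted (phi : R -> R) (V : 'I_n -> R) (s : 'S_n) :
  (forall x y, `|x| <= `|y| -> phi y <= phi x) ->
  (forall i j, (s i <= s j)%N -> V i <= V j) ->
  robinson (perm_conj s (\matrix_(i, j) phi (V i - V j))).
Proof.
move=> phiM sV.
have phiC x : phi (- x) = phi x by apply/eqP; rewrite eq_le !phiM// normrN.
have E i j : perm_conj s (\matrix_(i, j) phi (V i - V j)) i j =
    phi (V ((s^-1)%g i) - V ((s^-1)%g j)).
  by rewrite -{1}(permKV s i) -{1}(permKV s j) perm_conjE mxE.
split; first by apply/matrixP => i j; rewrite mxE !E -phiC opprB.
have sV' (i j : 'I_n) : (i <= j)%N -> V ((s^-1)%g i) <= V ((s^-1)%g j).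
  by move=> ij; apply: sV; rewrite !permKV.
move=> i; split=> j k h1 h2; rewrite !E; apply: phiM.
  have v1 := sV' _ _ h1; have v2 := sV' _ _ h2.
  by rewrite !ger0_norm ?subr_ge0//; [rewrite lerB|exact: le_trans v2].
have v1 := sV' _ _ h1; have v2 := sV' _ _ h2.
rewrite distrC [leRHS]distrC !ger0_norm ?subr_ge0//; first by rewrite lerB.
exact: le_trans v2.
Qed.

End RankPermutation.

(** * Deterministic analysis of a good sample *)

Section Sampling.
Context (R : realType) (n : nat) (phi : R -> R) (A : R) (V : 'I_n -> R) (a : 'I_n -> nat).
Hypothesis n0 : (0 < n)%N.
Hypothesis phiA : forall x, 0 <= phi x <= A.
Hypothesis phiM : forall x y, `|x| <= `|y| -> phi y <= phi x.
Hypothesis aV : forall k, (a k)%:R <= n%:R * V k < (a k).+1%:R.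
Hypothesis an : forall k, (a k < n)%N.

Definition profile (k : nat) : R := phi (k%:R / n%:R).

Lemma profile_bound k : 0 <= profile k <= A. Proof. exact: phiA. Qed.

Let nR0 : 0 < n%:R :> R. Proof. by rewrite ltr0n. Qed.

Lemma profile_mono k l : (k <= l)%N -> profile l <= profile k.
Proof.
by move=> kl; apply: phiM; rewrite !ger0_norm ?divr_ge0// ler_pM2r ?invr_gt0// ler_nat.
Qed.

Local Notation row i m := (grid_row profile (a i) m).

(** The strict inequalities between cells absorb the truncation: [m] is no farther from [a i], in
    units of [1 / n], than one of [V p], [V r] is from [V i]. Monotonicity of [phi] then keeps the
    level exactly. *)
Let grid_level i p r m s : (a p < m)%N -> (m < a r)%N ->
  s <= phi (V i - V p) -> s <= phi (V i - V r) -> s <= row i m.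
Proof.
move=> pm mr sp sr; rewrite /grid_row /profile.
have /andP[i1 i2] := aV i; have /andP[p1 p2] := aV p; have /andP[r1 r2] := aV r.
have pm' : (a p).+1%:R <= m%:R :> R by rewrite ler_nat.
have mr' : m.+1%:R <= (a r)%:R :> R by rewrite ler_nat.
rewrite -natr1 in i2; rewrite -natr1 in p2; rewrite -natr1 in r2; rewrite -natr1 in mr';
    rewrite -natr1 in pm'.
have [mi|im] := leqP m (a i).
  apply: le_trans sp _; apply: phiM.
  rewrite (_ : m - a i = 0)%N ?addn0; last by apply/eqP; rewrite subn_eq0.
  rewrite natrB// ger0_norm; last by rewrite divr_ge0// subr_ge0 ler_nat.
  apply: le_trans (ler_norm _).
  by rewrite ler_pdivrMr// mulrC mulrBr; lra.
apply: le_trans sr _; apply: phiM.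
rewrite (_ : a i - m = 0)%N ?add0n; last by apply/eqP; rewrite subn_eq0 ltnW.
rewrite natrB ?(ltnW im)// ger0_norm; last by rewrite divr_ge0// subr_ge0 ler_nat ltnW.
rewrite distrC; apply: le_trans (ler_norm _).
by rewrite ler_pdivrMr// mulrC mulrBr; lra.
Qed.

Let sample_level i k p r s : (p < a k)%N -> (a k < r)%N ->
  s <= row i p -> s <= row i r -> s <= phi (V i - V k).
Proof.
move=> pk kr sp sr.
have /andP[i1 i2] := aV i; have /andP[k1 k2] := aV k.
have pk' : p.+1%:R <= (a k)%:R :> R by rewrite ler_nat.
have kr' : (a k).+1%:R <= r%:R :> R by rewrite ler_nat.
rewrite -natr1 in i2; rewrite -natr1 in k2; rewrite -natr1 in pk'; rewrite -natr1 in kr'.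
have [Vki|Vik] := leP (V k) (V i).
  apply: le_trans sp _; apply: phiM.
  rewrite ger0_norm ?subr_ge0//.
  apply: le_trans (ler_norm _); rewrite ler_pdivlMr// mulrC mulrBr.
  apply: (@le_trans _ _ ((a i)%:R - p%:R)); first by lra.
  rewrite natrD; case: (leqP p (a i)) => pi.
    by rewrite (natrB _ pi) lerDl.
  have : (a i)%:R < p%:R :> R by rewrite ltr_nat.
  by have := ler0n R (a i - p); have := ler0n R (p - a i); move=> ? ? ?; lra.
apply: le_trans sr _; apply: phiM.
rewrite distrC ger0_norm ?subr_ge0 ?(ltW Vik)//.
apply: le_trans (ler_norm _); rewrite ler_pdivlMr// mulrC mulrBr.
apply: (@le_trans _ _ (r%:R - (a i)%:R)); first by lra.
rewrite natrD; case: (leqP (a i) r) => ri.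
  by rewrite (natrB _ ri) lerDr.
have : r%:R < (a i)%:R :> R by rewrite ltr_nat.
by have := ler0n R (a i - r); have := ler0n R (r - a i); move=> ? ? ?; lra.
Qed.

Let card_ord_itv u v : (v <= n)%N -> #|[set m : 'I_n | (u <= m < v)%N]%SET| = (v - u)%N.
Proof.
move=> vn; rewrite -sum1dep_card -(big_mkord (fun m => u <= m < v)%N (fun=> 1%N)).
rewrite -(@big_nat_widen _ _ _ 0 v n (leq u) (fun=> 1%N))// big_mkord.
by rewrite -(big_geq_mkord u v xpredT (fun=> 1%N))/= sum_nat_const_nat muln1.
Qed.

Let card_lt (v : nat) := #|[set k | (a k < v)%N]%SET|.
Variable K : R.
Hypothesis cardK : forall v, (v <= n)%N -> `|(card_lt v)%:R - v%:R| <= K.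

Let card_itv u v : (u <= v)%N -> (v <= n)%N ->
  `|#|[set k | (u <= a k < v)%N]%SET|%:R - (v%:R - u%:R)| <= 2 * K.
Proof.
move=> uv vn.
have -> : [set k | (u <= a k < v)%N]%SET = [set k | (a k < v)%N]%SET :\: [set k | (a k <
    u)%N]%SET.
  by apply/setP => k; rewrite !inE -leqNgt.
rewrite cardsD (_ : _ :&: _ = [set k | (a k < u)%N])%SET; last first.
  apply/setP => k; rewrite !inE andbC; case: ltnP => //= ku; exact: leq_trans uv.
rewrite natrB; last first.
  by apply/subset_leq_card/fintype.subsetP => k; rewrite !inE => /leq_trans; apply.
have := cardK vn; have := cardK (leq_trans uv vn); rewrite /card_lt !ler_norml.
by move=> /andP[? ?] /andP[? ?]; apply/andP; split; lra.
Qed.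

(* The joint level sets of two rows are intervals, both among the samples and on
   the grid; counting errors on intervals thus control all the inner products. *)
Let levels s1 s2 i j := [set k | (s1 <= phi (V i - V k)) && (s2 <= phi (V j - V k))]%SET.
Let grid_levels s1 s2 i j := [set m : 'I_n | (s1 <= row i m) && (s2 <= row j m)]%SET.

Let K0 : 0 <= K.
Proof. by apply: le_trans (cardK (leq0n n)); rewrite normr_ge0. Qed.

Let levels_le s1 s2 i j : #|levels s1 s2 i j|%:R <= #|grid_levels s1 s2 i j|%:R + (2 * K + 2).
Proof.
have K0' := K0.
have [->|/set0Pn[k0 k0S]] := eqVneq (levels s1 s2 i j) finset.set0.
  by rewrite cards0 -[leLHS]addr0 lerD//; lra.
(* The level set fits in the closed range of cells between its extreme samples, and the open range
   lies in the grid level set. It has two cells fewer, hence the 2 next to the counting error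
   [2 * K]. *)
pose p := [arg min_(k < k0 in levels s1 s2 i j) a k].
pose r := [arg max_(k > k0 in levels s1 s2 i j) a k].
have [pS pmin] : p \in levels s1 s2 i j /\ forall k, k \in levels s1 s2 i j -> (a p <= a k)%N.
  by rewrite /p; case: arg_minnP.
have [rS rmax] : r \in levels s1 s2 i j /\ forall k, k \in levels s1 s2 i j -> (a k <= a r)%N.
  by rewrite /r; case: arg_maxnP.
have pr : (a p <= a r)%N := pmin _ rS.
have le1 : (#|levels s1 s2 i j| <= #|[set k | (a p <= a k < (a r).+1)%N]%SET|)%N.
  by apply/subset_leq_card/fintype.subsetP => k kS; rewrite inE pmin//= ltnS rmax.
have le2 : ((a r - (a p).+1)%N <= #|grid_levels s1 s2 i j|)%N.
  rewrite -(@card_ord_itv _ (a r)); last exact: ltnW.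
  apply/subset_leq_card/fintype.subsetP => m; rewrite !inE => /andP[pm mr].
  move: pS rS; rewrite !inE => /andP[p1 p2] /andP[r1 r2].
  by rewrite (grid_level pm mr p1 r1) (grid_level pm mr p2 r2).
have := @card_itv (a p) (a r).+1 (leqW pr) (an r); rewrite ler_norml => /andP[_].
rewrite -(ler_nat R) in le1; rewrite -(ler_nat R) in le2.
have le3 : (a r)%:R <= (a r - (a p).+1)%:R + ((a p)%:R + 1) :> R.
  by rewrite natr1 -natrD ler_nat addnC -leq_subLR.
rewrite -natr1; lra.
Qed.

Let levels_ge s1 s2 i j : #|grid_levels s1 s2 i j|%:R <= #|levels s1 s2 i j|%:R + (2 * K + 2).
Proof.
have K0' := K0.
have [->|/set0Pn[m0 m0S]] := eqVneq (grid_levels s1 s2 i j) finset.set0.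
  by rewrite cards0 -[leLHS]addr0 lerD//; lra.
pose p := [arg min_(k < m0 in grid_levels s1 s2 i j) k : nat].
pose r := [arg max_(k > m0 in grid_levels s1 s2 i j) k : nat].
have [pS pmin] : p \in grid_levels s1 s2 i j /\ forall k : 'I_n, k \in grid_levels s1 s2 i j ->
    (p <= k)%N.
  by rewrite /p; case: arg_minnP.
have [rS rmax] : r \in grid_levels s1 s2 i j /\ forall k : 'I_n, k \in grid_levels s1 s2 i j ->
    (k <= r)%N.
  by rewrite /r; case: arg_maxnP.
have pr : (p <= r)%N := pmin _ rS.
have le1 : (#|grid_levels s1 s2 i j| <= r.+1 - p)%N.
  rewrite -(@card_ord_itv _ r.+1)//.
  by apply/subset_leq_card/fintype.subsetP => k kS; rewrite inE pmin//= ltnS rmax.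
rewrite -(ler_nat R) natrB ?leqW// -natr1 in le1.
have [prS|rp] := leqP p.+1 r; last first.
  have : r%:R <= p%:R :> R by rewrite ler_nat -ltnS.
  by have := ler0n R #|levels s1 s2 i j|; move=> ? ?; lra.
have le2 : (#|[set k | (p < a k < r)%N]%SET| <= #|levels s1 s2 i j|)%N.
  apply/subset_leq_card/fintype.subsetP => k; rewrite !inE => /andP[pk kr].
  move: pS rS; rewrite !inE => /andP[p1 p2] /andP[r1 r2].
  by rewrite (sample_level pk kr p1 r1) (sample_level pk kr p2 r2).
rewrite -(ler_nat R) in le2.
have := @card_itv p.+1 r prS (ltnW (ltn_ord r)); rewrite ler_norml => /andP[+ _].
rewrite -natr1; lra.
Qed.

(** Samples and grid points are merged into one index set with weights 1 and -1, so that the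
    difference is a single weighted sum, to which the layer-cake bound applies. *)
Lemma gram_concentration i j :
  `|\sum_k phi (V i - V k) * phi (V j - V k) - grid_dot profile n (a i) (a j)| <= A ^+ 2 * (2 *
      K + 2).
Proof.
have A0 : 0 <= A by have /andP[/le_trans] := phiA 0; apply.
pose g (i : 'I_n) (x : 'I_n + 'I_n) := match x with inl k => phi (V i - V k) | inr m => row i m
    end.
pose e (x : 'I_n + 'I_n) : R := if x is inl _ then 1 else -1.
have -> : \sum_k phi (V i - V k) * phi (V j - V k) - grid_dot profile n (a i) (a j) =
    \sum_x g i x * g j x * e x.
  rewrite big_sumType/= /grid_dot -sumrN.
  by congr (_ + _); apply: eq_bigr => k _; rewrite ?mulr1 ?mulrN1.
apply: layer_cake2 => //.
- by case=> k /=; [exact: phiA|exact: (grid_row_bound profile_bound)].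
- by case=> k /=; [exact: phiA|exact: (grid_row_bound profile_bound)].
- move=> s1 s2 _ _; rewrite big_sumType/= sumrN !sumr_const.
  have -> : #|[pred k | (s1 <= phi (V i - V k)) && (s2 <= phi (V j - V k))]| = #|levels s1 s2 i
      j|.
    by rewrite cardsE.
  have -> : #|[pred k : 'I_n | (s1 <= row i k) && (s2 <= row j k)]| = #|grid_levels s1 s2 i j|.
    by rewrite cardsE.
  have := levels_le s1 s2 i j; have := levels_ge s1 s2 i j.
  by move=> ? ?; rewrite ler_norml; lra.
Qed.

Lemma row_sum_concentration i :
  `|\sum_k phi (V i - V k) - grid_sum profile n (a i)| <= A * (2 * K + 2).
Proof.
have A0 : 0 <= A by have /andP[/le_trans] := phiA 0; apply.
pose g (x : 'I_n + 'I_n) := match x with inl k => phi (V i - V k) | inr m => row i m end.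
pose e (x : 'I_n + 'I_n) : R := if x is inl _ then 1 else -1.
have -> : \sum_k phi (V i - V k) - grid_sum profile n (a i) = \sum_x g x * e x.
  rewrite big_sumType/= /grid_sum -sumrN.
  by congr (_ + _); apply: eq_bigr => k _; rewrite ?mulr1 ?mulrN1.
apply: layer_cake => //.
- by case=> k /=; [exact: phiA|exact: (grid_row_bound profile_bound)].
- move=> s _; rewrite big_sumType/= sumrN !sumr_const.
  have -> : #|[pred k | s <= phi (V i - V k)]| = #|levels s s i i|.
    by rewrite -[LHS]cardsE; apply: eq_card => k; rewrite !inE andbb.
  have -> : #|[pred k : 'I_n | s <= row i k]| = #|grid_levels s s i i|.
    by rewrite -[LHS]cardsE; apply: eq_card => k; rewrite !inE andbb.
  have := levels_le s s i i; have := levels_ge s s i i.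
  by move=> ? ?; rewrite ler_norml; lra.
Qed.

End Sampling.

Section EuclideanNorm.
Context (R : realType) (I : finType).

Lemma sum_cauchy_schwarz (u v : I -> R) :
  (\sum_i u i * v i) ^+ 2 <= (\sum_i u i ^+ 2) * (\sum_i v i ^+ 2).
Proof.
set b := \sum_i v i ^+ 2; set c := \sum_i u i * v i; set a := \sum_i u i ^+ 2.
have b0 : 0 <= b by apply: sumr_ge0 => i _; exact: sqr_ge0.
have H : 0 <= b * (a * b - c ^+ 2).
  have -> : b * (a * b - c ^+ 2) = \sum_i (b * u i - c * v i) ^+ 2.
    rewrite (eq_bigr (fun i => b ^+ 2 * u i ^+ 2 + c ^+ 2 * v i ^+ 2 - 2 * b * c * (u i * v i))).
      by rewrite sumrB big_split/= -!mulr_sumr -/a -/b -/c; ring.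
    by move=> i _; ring.
  by apply: sumr_ge0 => i _; exact: sqr_ge0.
have [b_gt0|] := ltP 0 b; first by rewrite -subr_ge0; move: H; rewrite pmulr_rge0.
move=> b_le0; have /eqP : b = 0 by apply/eqP; rewrite eq_le b_le0.
rewrite psumr_eq0; last by move=> i _; exact: sqr_ge0.
move=> /allP v0; have -> : c = 0.
  apply: big1 => i _; have := v0 i; rewrite mem_index_enum sqrf_eq0 => /(_ isT)/eqP->.
  by rewrite mulr0.
by rewrite expr0n mulr_ge0// sumr_ge0// => i _; exact: sqr_ge0.
Qed.

Lemma euclid_triangle (x y z : I -> R) :
  Num.sqrt (\sum_i (x i - z i) ^+ 2) <=
  Num.sqrt (\sum_i (x i - y i) ^+ 2) + Num.sqrt (\sum_i (y i - z i) ^+ 2).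
Proof.
set p := \sum_i (x i - y i) ^+ 2; set r := \sum_i (y i - z i) ^+ 2.
have p0 : 0 <= p by apply: sumr_ge0 => i _; exact: sqr_ge0.
have r0 : 0 <= r by apply: sumr_ge0 => i _; exact: sqr_ge0.
rewrite -[leRHS]ger0_norm ?addr_ge0 ?sqrtr_ge0// -sqrtr_sqr ler_wsqrtr//.
rewrite sqrrD !sqr_sqrtr// -sqrtrM//.
have -> : \sum_i (x i - z i) ^+ 2 = p + 2 * \sum_i (x i - y i) * (y i - z i) + r.
  by rewrite /p /r mulr_sumr -!big_split/=; apply: eq_bigr => i _; ring.
rewrite lerD2r lerD2l -[leRHS]mulr_natl ler_wpM2l//.
apply: le_trans (ler_norm _) _; rewrite -sqrtr_sqr ler_wsqrtr//.
exact: sum_cauchy_schwarz.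
Qed.

(** For nonnegative [s], [t] one has |s - t|^2 <= |s - t| (s + t) = |s^2 - t^2|, and truncating [x]
    at 0 only brings it closer to [y]. *)
Lemma sqrt_max0_close (x y z : R) : 0 <= y -> 0 <= z -> `|x - y| <= z ^+ 2 ->
  `|Num.sqrt (Num.max 0 x) - Num.sqrt y| <= z.
Proof.
move=> y0 z0 xy.
have m0 : 0 <= Num.max 0 x by rewrite le_max lexx.
set s := Num.sqrt _; set t := Num.sqrt y.
have s0 : 0 <= s by exact: sqrtr_ge0.
have t0 : 0 <= t by exact: sqrtr_ge0.
have H : `|s ^+ 2 - t ^+ 2| <= z ^+ 2.
  rewrite !sqr_sqrtr//; move: xy; rewrite !ler_norml.
  by have [x0|x0] := leP x 0 => // /andP[? ?]; apply/andP; split; lra.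
rewrite -(@ler_pXn2r _ 2)// ?nnegrE//; apply: le_trans H.
rewrite subr_sqr normrM expr2 ler_wpM2l// (ger0_norm (addr_ge0 s0 t0)).
by rewrite ler_norml; lra.
Qed.

End EuclideanNorm.

(** * Estimated distances and loss on a good sample *)

Section GoodSample.
Context (R : realType) (n : nat) (phi : R -> R) (A : R) (V : 'I_n -> R)
  (E : 'I_n -> 'I_n -> R) (a : 'I_n -> nat) (kappa e0 : R) (h : nat).
Let q := e0 ^+ 2.
Hypothesis n0 : (0 < n)%N.
Hypothesis A1 : 1 <= A.
Hypothesis phiA : forall x, 0 <= phi x <= A.
Hypothesis phiM : forall x y, `|x| <= `|y| -> phi y <= phi x.
Hypothesis aV : forall k, (a k)%:R <= n%:R * V k < (a k).+1%:R.
Hypothesis an : forall k, (a k < n)%N.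
Hypothesis kappa1 : 1 <= kappa.
Hypothesis e01 : 1 <= e0.
Hypothesis h2n : (h.*2 <= n)%N.
Hypothesis h5q : h%:R <= 5 * q.
Hypothesis card_good : forall v, (v <= n)%N -> `|#|[set k | (a k < v)%N]%SET|%:R - v%:R| <=
    kappa * q.
Hypothesis gap_good : forall v, (v + h <= n)%N -> exists k, (v <= a k < v + h)%N.
Hypothesis noise_good : forall j p r, `|\sum_(k | V p <= V k <= V r) E j k| <= kappa * q.
Hypothesis gram_good : forall i j, i != j -> `|\sum_k E i k * E j k| <= kappa * q.

Let f := profile n phi.
Let X : 'M[R]_n := \matrix_(i, j) phi (V i - V j).
Let Y : 'M[R]_n := X + \matrix_(i, j) E i j.
Let F i := grid_sum f n (a i).
Let Gam i j := grid_dot f n (a i) (a j).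

Let q1 : 1 <= q. Proof. by rewrite /q exprn_ege1. Qed.
Let q_ge0 : 0 <= q. Proof. exact: le_trans q1. Qed.
Let A0 : 0 <= A. Proof. exact: le_trans A1. Qed.
Let kappa0 : 0 <= kappa. Proof. exact: le_trans kappa1. Qed.
Let kq_ge1 : 1 <= kappa * q. Proof. exact: mulr_ege1. Qed.
Let kq0 : 0 <= kappa * q. Proof. exact: le_trans kq_ge1. Qed.

(** [b1] is the error scale of row sums and [b2] that of inner products; as [A], [kappa] and [q] are
    at least 1, all smaller terms are absorbed. *)
Let b1 := A * (kappa * q).
Let b2 := A ^+ 2 * (kappa * q).

Let kq_b1 : kappa * q <= b1. Proof. by rewrite /b1 ler_peMl. Qed.
Let A_b1 : A <= b1. Proof. by rewrite /b1 ler_peMr. Qed.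
Let b1_b2 : b1 <= b2. Proof. by rewrite /b1 /b2 expr2 -mulrA ler_peMl// mulr_ge0. Qed.
Let A2_b2 : A ^+ 2 <= b2. Proof. by rewrite /b2 ler_peMr// exprn_ge0. Qed.
Let q_kq : q <= kappa * q. Proof. by rewrite ler_peMl. Qed.

Let fA k : 0 <= f k <= A. Proof. exact: profile_bound. Qed.
Let fM k l : (k <= l)%N -> f l <= f k. Proof. exact: profile_mono. Qed.

(** A set convex for the order of [V] is the window between its extreme samples, so bounds on
    windows cover all the random level sets. *)
Let level_noise j (L : pred 'I_n) :
  (forall p r k, L p -> L r -> V p <= V k <= V r -> L k) ->
  `|\sum_(k | L k) E j k| <= kappa * q.
Proof.
move=> Lc.
have [/existsP[k0 k0L]|/existsPn LN] := boolP [exists k, L k]; last first.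
  by rewrite big_pred0 ?normr0// => k; exact/negbTE/LN.
pose p := [arg min_(k < k0 | L k) V k]%O.
pose r := [arg max_(k > k0 | L k) V k]%O.
have [pL pmin] : L p /\ forall k, L k -> V p <= V k.
  by rewrite /p; case: Order.TotalTheory.arg_minP.
have [rL rmax] : L r /\ forall k, L k -> V k <= V r.
  by rewrite /r; case: Order.TotalTheory.arg_maxP.
rewrite (eq_bigl (fun k => V p <= V k <= V r)); first exact: noise_good.
move=> k; apply/idP/idP => [Lk|]; last exact: Lc.
by rewrite pmin// rmax.
Qed.

Let noise_sum j : `|\sum_k E j k| <= kappa * q.
Proof. exact: level_noise. Qed.

Let noise_dot i j : `|\sum_k phi (V i - V k) * E j k| <= b1.
Proof.
apply: layer_cake => // s _; apply: level_noise => p r k sp sr /andP[pk kr].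
have [ki|ik] := leP (V k) (V i).
  apply: le_trans sp _; apply: phiM.
  by rewrite !ger0_norm ?subr_ge0// ?lerB//; apply: le_trans ki.
apply: le_trans sr _; apply: phiM; rewrite distrC [leRHS]distrC.
by rewrite !ger0_norm ?subr_ge0 ?lerB// ?(ltW ik)//; apply: le_trans kr; exact: ltW.
Qed.

Let YE i k : Y i k = phi (V i - V k) + E i k.
Proof. by rewrite !mxE. Qed.

Let row_sum_close i : `|row_sum Y i - F i| <= 5 * b1.
Proof.
have := row_sum_concentration n0 phiA phiM aV an card_good i.
have -> : row_sum Y i = \sum_k phi (V i - V k) + \sum_k E i k.
  by rewrite /row_sum -big_split/=; apply: eq_bigr => k _; rewrite YE.
have := noise_sum i; have := (kq_b1, A_b1) => -[].
have -> : A * (2 * (kappa * q) + 2) = 2 * b1 + 2 * A by rewrite /b1; ring.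
rewrite -/(F i) /F -/f !ler_norml => ? ? /andP[? ?] /andP[? ?].
by apply/andP; split; lra.
Qed.

(** Sampling costs [2 * b2 + 2 * A ^+ 2], each cross term [b1], and the product of the two noise
    rows [kappa * q]; the last bound requires distinct rows. *)
Let row_dot_close i j : i != j -> `|row_dot Y i j - Gam i j| <= 7 * b2.
Proof.
move=> ij; have := gram_concentration n0 phiA phiM aV an card_good i j.
have -> : row_dot Y i j = \sum_k phi (V i - V k) * phi (V j - V k) +
   \sum_k phi (V i - V k) * E j k + \sum_k phi (V j - V k) * E i k + \sum_k E i k * E j k.
  by rewrite /row_dot -!big_split/=; apply: eq_bigr => k _; rewrite !YE; ring.
have := noise_dot i j; have := noise_dot j i; have := gram_good ij.
have := (kq_b1, b1_b2, A2_b2) => -[[]].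
have -> : A ^+ 2 * (2 * (kappa * q) + 2) = 2 * b2 + 2 * A ^+ 2 by rewrite /b2; ring.
rewrite /Gam -/f !ler_norml => ? ? ? /andP[? ?] /andP[? ?] /andP[? ?] /andP[? ?].
by apply/andP; split; lra.
Qed.

Let F_near i j : (a i <= a j + h)%N -> (a j <= a i + h)%N -> `|F i - F j| <= 10 * b1.
Proof.
have H : 2 * A * h%:R <= 10 * b1.
  have -> : 10 * b1 = 2 * A * (5 * (kappa * q)) by rewrite /b1; ring.
  by rewrite ler_wpM2l ?mulr_ge0// (le_trans h5q)// ler_wpM2l.
move=> ij ji; apply: le_trans H; rewrite /F.
have [aij|/ltnW aji] := leqP (a i) (a j).
  apply: le_trans (grid_sum_lip fA fM aij (an j)) _.
  by rewrite ler_wpM2l ?mulr_ge0// ler_nat leq_subLR.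
rewrite distrC; apply: le_trans (grid_sum_lip fA fM aji (an i)) _.
by rewrite ler_wpM2l ?mulr_ge0// ler_nat leq_subLR.
Qed.

Let Gam_near i j : (a i <= a j + h)%N -> (a j <= a i + h)%N -> `|Gam i i - Gam i j| <= 10 * b2.
Proof.
have H : 2 * A ^+ 2 * h%:R <= 10 * b2.
  have -> : 10 * b2 = 2 * A ^+ 2 * (5 * (kappa * q)) by rewrite /b2; ring.
  by rewrite ler_wpM2l ?mulr_ge0 ?exprn_ge0// (le_trans h5q)// ler_wpM2l.
move=> ij ji; apply: le_trans H.
have -> : Gam i i - Gam i j = \sum_(m < n) grid_row f (a i) m * (grid_row f (a i) m - grid_row
    f (a j) m).
  by rewrite /Gam /grid_dot -sumrB; apply: eq_bigr => m _; rewrite mulrBr.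
have [aij|/ltnW aji] := leqP (a i) (a j).
  apply: le_trans (grid_dist_l1 fA fM _ aij (an j)) _.
  by rewrite ler_wpM2l ?mulr_ge0 ?exprn_ge0// ler_nat leq_subLR.
rewrite -normrN -sumrN.
under eq_bigr do rewrite -mulrN opprB.
apply: le_trans (grid_dist_l1 fA fM _ aji (an i)) _.
by rewrite ler_wpM2l ?mulr_ge0 ?exprn_ge0// ler_nat leq_subLR.
Qed.

(** The window of [h] cells just right of the cell of [i], or the one just left of it, fits in the
    grid because [h.*2 <= n]. It excludes the cell of [i], so its sample is a different object. *)
Let neighbour_exists i : exists j, [/\ j != i, (a i <= a j + h)%N & (a j <= a i + h)%N].
Proof.
have [ih|ih] := leqP ((a i).+1 + h) n.
  have [k /andP[k1 k2]] := gap_good ih; exists k; split.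
  - by apply: contraTneq k1 => ->; rewrite ltnn.
  - by rewrite (leq_trans (ltnW k1))// leq_addr.
  - by rewrite -ltnS.
have hi : (h <= a i)%N by move: h2n; rewrite -addnn => h2; move: (leq_ltn_trans h2 ih);
    rewrite ltn_add2r.
have [|k /andP[k1 k2]] := @gap_good (a i - h); first by rewrite subnK// ltnW.
rewrite subnK// in k2; exists k; split.
- by apply: contraTneq k2 => ->; rewrite ltnn.
- by rewrite addnC -leq_subLR.
- by rewrite (leq_trans (ltnW k2))// leq_addr.
Qed.

Let sqrt_nlogn := Num.sqrt (n%:R * ln n%:R) : R.
Hypothesis qE : sqrt_nlogn = q.
(** 20 = 5 + 10 + 5: grid row sums vary by at most [10 * b1] over [h] cells and each observed one is
    off by at most [5 * b1], so the sample of [neighbour_exists] enters [nbhd]. *)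
Let c1 := 20 * kappa.

Let nbhdE i j : (j \in nbhd c1 A Y i) = (j != i) && (`|row_sum Y j - row_sum Y i| <= 20 * b1).
Proof. by rewrite inE -/sqrt_nlogn qE /c1 /b1; congr (_ && (_ <= _)); ring. Qed.

(** From below, a sample within [h] cells loses 10 + 7. From above, a maximizer [j] has [Gam j j]
    within [60 * b2] of [Gam i i], and nonnegativity of the squared distance gives
    [Gam i j <= (Gam i i + Gam j j) / 2], so the excess is at most 30 + 7. *)
Let max_dot_close i : `|max_dot c1 A Y i - Gam i i| <= 37 * b2.
Proof.
have [j0 [ji0 ij0 ji0']] := neighbour_exists i.
have j0N : j0 \in nbhd c1 A Y i.
  rewrite nbhdE ji0/=.
  have := row_sum_close i; have := row_sum_close j0; have := F_near ij0 ji0'.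
  by rewrite !ler_norml => /andP[? ?] /andP[? ?] /andP[? ?]; apply/andP; split; lra.
have low : Gam i i - 17 * b2 <= max_dot c1 A Y i.
  apply: le_trans (max_dot_ge j0N).
  have ij : i != j0 by rewrite eq_sym.
  have := row_dot_close ij; have := Gam_near ij0 ji0'.
  by rewrite !ler_norml => /andP[? ?] /andP[? ?]; lra.
have nb2 : 0 <= b2 by rewrite (le_trans _ b1_b2)// (le_trans _ A_b1).
have up : max_dot c1 A Y i <= Gam i i + 37 * b2.
  have [|j jN ->] := @max_dot_attained _ _ c1 A Y i; first by apply/set0Pn; exists j0.
  move: jN; rewrite nbhdE eq_sym => /andP[ij Sij].
  have HF : `|F i - F j| <= 30 * b1.
    have := row_sum_close i; have := row_sum_close j; move: Sij.
    by rewrite !ler_norml => /andP[? ?] /andP[? ?] /andP[? ?]; apply/andP; split; lra.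
  have HG : `|Gam i i - Gam j j| <= 60 * b2.
    apply: le_trans (grid_sqnorm_lip fA fM (an i) (an j)) _.
    have -> : 60 * b2 = 2 * A * (30 * b1) by rewrite /b1 /b2; ring.
    by rewrite ler_wpM2l// mulr_ge0.
  have HS : 0 <= grid_sqdist f n (a i) (a j) by apply: sumr_ge0 => m _; exact: sqr_ge0.
  move: HS; rewrite grid_sqdistE -/(Gam i i) -/(Gam j j) -/(Gam i j).
  have := row_dot_close ij; move: HG; rewrite !ler_norml => /andP[? ?] /andP[? ?] ?; lra.
by rewrite ler_norml; apply/andP; split; lra.
Qed.

Definition latent_dist i j := Num.sqrt (grid_sqdist f n (a i) (a j)).
Local Notation dd := latent_dist.

Let dhat_close i j : `|dhat c1 A Y i j - dd i j| <= 100 * kappa * A * e0.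
Proof.
have z0 : 0 <= 100 * kappa * A * e0.
  by rewrite !mulr_ge0//; exact: le_trans e01.
rewrite mxE; case: eqVneq => [->|ij].
  rewrite /dd /grid_sqdist big1 ?sqrtr0 ?subrr ?normr0// => m _.
  by rewrite subrr expr0n.
apply: sqrt_max0_close => //; first by apply: sumr_ge0 => m _; exact: sqr_ge0.
(* 88 = 37 + 37 + 2 * 7, from the two maxima and twice the inner product. *)
have H : 88 * b2 <= (100 * kappa * A * e0) ^+ 2.
  have -> : (100 * kappa * A * e0) ^+ 2 = 10000 * (kappa * b2) by rewrite /b2 /q; ring.
  have nb2 : 0 <= b2 by rewrite (le_trans _ b1_b2)// (le_trans _ A_b1).
  by have : b2 <= kappa * b2 by [rewrite ler_peMl]; move=> ?; lra.
apply: le_trans H; rewrite grid_sqdistE -/(Gam i i) -/(Gam j j) -/(Gam i j).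
have := row_dot_close ij; have := max_dot_close i; have := max_dot_close j.
by rewrite !ler_norml => /andP[? ?] /andP[? ?] /andP[? ?]; apply/andP; split; lra.
Qed.

Variables (s : 'S_n) (delta : R).
Hypothesis sV : forall i j, (s i <= s j)%N -> V i <= V j.
Hypothesis delta0 : 0 <= delta.
Hypothesis h_delta : 2 * A ^+ 2 * h%:R <= delta ^+ 2.

Let sa i j : (s i <= s j)%N -> (a i <= a j)%N.
Proof.
move=> /sV Vij; rewrite -ltnS -(ltr_nat R).
have /andP[h1 _] := aV i; have /andP[_ h3] := aV j.
by apply: le_lt_trans h1 (le_lt_trans _ h3); rewrite ler_wpM2l.
Qed.

Let latent_line_order : line_order dd (Num.sqrt 2) delta s.
Proof.
split.
  move=> i j k ij jk; rewrite -!sqrtrM//; split; apply: ler_wsqrtr.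
    exact: (grid_dist_monol fA fM (sa ij) (sa jk) (an k)).
  exact: (grid_dist_monor fA fM (sa ij) (sa jk) (an k)).
move=> i j ij; have aij : (a i <= a j)%N by apply: sa; rewrite ij.
have aji : (a j <= a i + h)%N.
  have [ih|ih] := leqP ((a i).+1 + h) n; last first.
    by have := leq_trans (an j) (ltnSE ih); exact: ltnW.
  (* This sample has a larger cell than [i], so it ranks after [i], hence not before [j], the
     immediate successor of [i]. *)
  have [k /andP[k1 k2]] := gap_good ih.
  rewrite -ltnS (leq_ltn_trans _ k2)//; apply: sa; rewrite ij ltnNge.
  by apply: contraTN k1 => /sa; rewrite -leqNgt.
rewrite -[leRHS]ger0_norm// -sqrtr_sqr ler_wsqrtr// (le_trans _ h_delta)//.
apply: le_trans (grid_sqdist_le fA fM aij (an j)) _.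
by rewrite ler_wpM2l ?mulr_ge0 ?exprn_ge0// ler_nat leq_subLR.
Qed.

Let alpha : R := Num.sqrt 2.
Let eps := 100 * kappa * A * e0.
Let rho1 := alpha ^+ 2 * delta + (2 * alpha ^+ 2 + 3 * alpha + 2) * eps.
Let rho2 := alpha * delta + 2 * (1 + alpha) * eps.
Let rho3 := delta + eps.

Lemma good_sample_ell2 r0 r : pines_output (dhat c1 A Y) rho1 rho2 rho3 r0 r ->
  ell2 X r <= 2 * Num.sqrt n%:R * (alpha * ((1 + alpha) * (rho1 + eps)) + 4 * kappa * A * e0).
Proof.
move=> out.
have eps0 : 0 <= eps by rewrite !mulr_ge0//; exact: le_trans e01.
have alpha1 : 1 <= alpha by rewrite -[leLHS]sqrtr1 ler_wsqrtr// ler1n.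
have alpha0 : 0 <= alpha by exact: sqrtr_ge0.
have rho10 : 0 <= rho1.
  have a2 : 0 <= alpha ^+ 2 by exact: sqr_ge0.
  by apply: addr_ge0; apply: mulr_ge0 => //; lra.
have dd0 i : dd i i = 0.
  by rewrite /dd /grid_sqdist big1 ?sqrtr0// => m _; rewrite subrr expr0n.
have ddC i j : dd i j = dd j i.
  by congr Num.sqrt; apply: eq_bigr => m _; rewrite -sqrrN opprB.
have ddT i j k : dd i k <= dd i j + dd j k by exact: euclid_triangle.
have DC i j : dhat c1 A Y i j = dhat c1 A Y j i by exact: dhat_sym.
have [s' s's ord] := pines_order dd0 ddC ddT alpha1 delta0 eps0 DC dhat_close latent_line_order
    out.
have s'L : line_order dd alpha delta s'.
  by case: s's => ->; [|apply: line_order_flip => //]; exact: latent_line_order.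
have B0 : 0 <= (1 + alpha) * (rho1 + eps) by apply: mulr_ge0; apply: addr_ge0.
have close := misplaced_close dd0 ddC alpha1 s'L B0 ord.
have XT : X^T = X.
  apply/matrixP => i j; rewrite !mxE -opprB.
  by apply/eqP; rewrite eq_le !phiM// normrN.
apply: (@ell2_le_displacement _ _ X s' r) => //.
- case: s's => ->; first exact: robinson_sorted.
  (* The flipped ranking sorts the negated positions, which define the same matrix because [phi] is
     even. *)
  have -> : X = \matrix_(i, j) phi ((- V i) - (- V j)).
    apply/matrixP => i j; rewrite !mxE -opprD.
    by apply/eqP; rewrite eq_le !phiM// normrN.
  apply: (robinson_sorted (V := fun i => - V i)) => // i j.
  rewrite leqNgt perm_flip_lt -leqNgt lerN2; exact: sV.
- move=> i k /close ik.
  have -> : \sum_j (X i j - X k j) ^+ 2 =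
      \sum_j phi (V i - V j) * phi (V i - V j) + \sum_j phi (V k - V j) * phi (V k - V j) -
      2 * \sum_j phi (V i - V j) * phi (V k - V j).
    by rewrite mulr_sumr -big_split/= -sumrB; apply: eq_bigr => j _; rewrite !mxE; ring.
  have H1 := gram_concentration n0 phiA phiM aV an card_good i i.
  have H2 := gram_concentration n0 phiA phiM aV an card_good k k.
  have H3 := gram_concentration n0 phiA phiM aV an card_good i k.
  have H4 : A ^+ 2 * (2 * (kappa * q) + 2) <= 4 * b2.
    by have := A2_b2; rewrite /b2 => ?; lra.
  have sq0 : 0 <= grid_sqdist f n (a i) (a k) by apply: sumr_ge0 => m _; exact: sqr_ge0.
  (* Back from the grid rows to the sampled rows: the three inner products have weights 1, 1 and 2,
     and each is off by at most [4 * b2]. *)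
  apply: (@le_trans _ _ (dd i k ^+ 2 + 16 * b2)).
    rewrite sqr_sqrtr// grid_sqdistE.
    move: H1 H2 H3; rewrite -/f !ler_norml => /andP[? ?] /andP[? ?] /andP[? ?]; lra.
  have dd_ge0 : 0 <= dd i k by exact: sqrtr_ge0.
  have Ake0 : 0 <= kappa * A * e0 by rewrite !mulr_ge0//; exact: le_trans e01.
  have b2le : b2 <= (kappa * A * e0) ^+ 2.
    have -> : (kappa * A * e0) ^+ 2 = kappa * b2 by rewrite /b2 /q; ring.
    by rewrite ler_peMl// (le_trans _ b1_b2)// (le_trans _ A_b1).
  apply: (@le_trans _ _ ((dd i k + 4 * kappa * A * e0) ^+ 2)).
    rewrite sqrrD; have : 0 <= dd i k * (4 * kappa * A * e0).
      by rewrite mulr_ge0// -!mulrA mulr_ge0// mulrA.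
    have -> : (4 * kappa * A * e0) ^+ 2 = 16 * (kappa * A * e0) ^+ 2 by ring.
    by rewrite mulr2n; move=> ?; lra.
  rewrite lerXn2r ?nnegrE ?lerD2r// ?addr_ge0// ?(mulr_ge0 alpha0 B0)//.
  - by rewrite -!mulrA mulr_ge0// mulrA.
  - by rewrite -!mulrA mulr_ge0// mulrA.
- rewrite addr_ge0// ?(mulr_ge0 alpha0 B0)//.
  by rewrite !mulr_ge0//; exact: le_trans e01.
Qed.

End GoodSample.

(** * Products of independent variables *)

Section IndependentProducts.
Context d (T : measurableType d) (R : realType) (P : probability T R).
Local Open Scope ereal_scope.

Import HBNNSimple.

(** The hypothesis on indicators extends to nonnegative simple functions by linearity, then to [g]
    by monotone convergence. *)
Lemma integral_comp_mul_le d' (T' : measurableType d') (Z : T -> T') (rest : T -> R) (C : R) :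
  measurable_fun setT Z -> measurable_fun setT rest -> (forall w, 0 <= rest w)%R -> (0 <= C)%R ->
  (forall B, measurable B ->
     \int[P]_w (\1_B (Z w) * rest w)%:E <= P (Z @^-1` B) * C%:E) ->
  forall g : T' -> R, measurable_fun setT g -> (forall x, 0 <= g x)%R ->
  \int[P]_w (g (Z w) * rest w)%:E <= (\int[P]_w (g (Z w))%:E) * C%:E.
Proof.
move=> mZ mrest rest0 C0 HB g mg g0.
have mgE : measurable_fun setT (EFin \o g) by exact/measurable_EFinP.
pose g_ := nnsfun_approx measurableT mgE.
have g_nd x : {homo (fun m => g_ m x) : m1 m2 / (m1 <= m2)%N >-> (m1 <= m2)%R}.
  by move=> m1 m2 m12; have /lefP := nd_nnsfun_approx measurableT mgE m12; exact.
have g_cvg x : EFin \o g_^~ x @ \oo --> (g x)%:E.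
  by apply: (cvg_nnsfun_approx measurableT mgE) => // y _; rewrite lee_fin.
have g_le m x : (g_ m x <= g x)%R.
  rewrite -lee_fin /g_ nnsfun_approxE; apply: le_approx => // y _.
  by rewrite lee_fin.
have mgZ m : measurable_fun setT (g_ m \o Z) by exact: measurableT_comp.
pose h m w := (g_ m (Z w) * rest w)%:E.
have mh m : measurable_fun setT (h m).
  by apply/measurable_EFinP; apply: measurable_funM => //; exact: mgZ.
have h0 m w : 0 <= h m w by rewrite lee_fin mulr_ge0.
have step m : \int[P]_w h m w <= (\int[P]_w (g (Z w))%:E) * C%:E.
  pose s : seq R := finmap.enum_fset (fset_set (range (g_ m))).
  pose B y := g_ m @^-1` [set y].
  have mB y : measurable (B y) by exact: measurable_sfunP.
  have mBZ y : measurable (Z @^-1` B y) by rewrite -[X in measurable X]setTI; exact: mZ.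
  have gE x : g_ m x = (\sum_(y <- s) y * \1_(B y) x)%R.
    by rewrite fimfunE fsbig_finite//.
  have s0 y : y \in s -> (0 <= y)%R.
    by rewrite in_fset_set// inE => -[x _ <-].
  have mind y : measurable_fun setT (fun w => \1_(B y) (Z w) : R).
    by apply: measurableT_comp => //; exact: measurable_indic.
  (* Values along [s] are nonnegative, but exchanging sum and integral asks for nonnegative terms at
     every [y], hence [Num.max 0 y]. *)
  have eq1 : \int[P]_w h m w = \sum_(y <- s) \int[P]_w (Num.max 0 y * (\1_(B y) (Z w) * rest
      w))%:E.
    rewrite -ge0_integral_sum//=.
    - apply: eq_integral => w _;
        rewrite /h gE mulr_suml sumEFin big_seq_cond [in RHS]big_seq_cond.
      by congr (_%:E); apply: eq_bigr => y /andP[/s0 y0 _]; rewrite max_r// mulrA.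
    - move=> y; apply/measurable_EFinP; apply: measurable_funM => //.
      exact: measurable_funM.
    - by move=> y w _; rewrite lee_fin !mulr_ge0// le_max lexx.
  have eq2 : \sum_(y <- s) (Num.max 0 y)%:E * P (Z @^-1` B y) = \int[P]_w (g_ m (Z w))%:E.
    rewrite (eq_bigr (fun y => \int[P]_w (Num.max 0 y * \1_(B y) (Z w))%:E)); last first.
      move=> y _; under eq_integral do rewrite EFinM.
      rewrite ge0_integralZl_EFin//; last 2 first.
      + exact/measurable_EFinP.
      + by rewrite le_max lexx.
      congr (_ * _); rewrite -[X in P X]setIT -integral_indic//.
    rewrite -ge0_integral_sum//=.
    - apply: eq_integral => w _; rewrite gE sumEFin big_seq_cond [in RHS]big_seq_cond.
      by congr (_%:E); apply: eq_bigr => y /andP[/s0 y0 _]; rewrite max_r.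
    - by move=> y; apply/measurable_EFinP; exact: measurable_funM.
    - by move=> y w _; rewrite lee_fin !mulr_ge0// le_max lexx.
  rewrite eq1; apply: (@le_trans _ _ (\sum_(y <- s) (Num.max 0 y)%:E * P (Z @^-1` B y) * C%:E)).
    apply: lee_sum => y _; under eq_integral do rewrite EFinM.
    rewrite ge0_integralZl_EFin//; last 3 first.
    - by move=> w _; rewrite lee_fin mulr_ge0.
    - by apply/measurable_EFinP; exact: measurable_funM.
    - by rewrite le_max lexx.
    by rewrite -muleA lee_wpmul2l ?HB// lee_fin le_max lexx.
  rewrite -ge0_sume_distrl; last by move=> y _; rewrite mule_ge0// lee_fin le_max lexx.
  rewrite eq2 lee_wpmul2r// ge0_le_integral//=.
  - by move=> w _; rewrite lee_fin.
  - by apply/measurable_EFinP; exact: mgZ.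
  - by apply/measurable_EFinP; exact: measurableT_comp.
  - by move=> w _; rewrite lee_fin.
have h_nd w : setT w -> nondecreasing_seq (h ^~ w).
  by move=> _ m1 m2 m12; rewrite lee_fin ler_wpM2r// g_nd.
have h_lim w : limn (h ^~ w) = (g (Z w) * rest w)%:E.
  apply/cvg_lim => //; rewrite EFinM; under eq_fun do rewrite /h EFinM.
  by apply: cvgeZr => //; exact: g_cvg.
under eq_integral do rewrite -h_lim.
rewrite monotone_convergence//; apply: lime_le.
  apply: ereal_nondecreasing_is_cvgn => m1 m2 m12.
  by apply: ge0_le_integral => // w _; exact: h_nd.
exact: nearW.
Qed.

End IndependentProducts.

Section ProductMarkov.
Context d (T : measurableType d) (R : realType) (P : probability T R).
Local Open Scope ereal_scope.

Lemma integral_le_markov (W : T -> R) (b c : R) : measurable_fun setT W ->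
  (forall w, 0 <= W w)%R -> (0 < b)%R -> \int[P]_w (W w)%:E <= c%:E ->
  P [set w | b <= W w]%R <= (c / b)%:E.
Proof.
move=> mW W0 b0 Wc.
have mA : measurable [set w | b <= W w]%R.
  by rewrite -[X in measurable X]setTI; apply: measurable_fun_le.
rewrite -(setIT [set w | _]) -integral_indic//.
apply: (@le_trans _ _ (\int[P]_w ((b^-1)%:E * (W w)%:E))).
  apply: ge0_le_integral => //=.
  - by apply: measurableT_comp => //; exact: measurable_indic.
  - by apply: measurable_funeM; exact/measurable_EFinP.
  - move=> w _; rewrite -EFinM lee_fin indicE mulrC ler_pdivlMr//.
    by have [/set_mem/= wb|_] := boolP (w \in _); rewrite ?mul1r ?mul0r.
rewrite ge0_integralZl_EFin//=; last 3 first.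
- by move=> w _; rewrite lee_fin.
- exact/measurable_EFinP.
- by rewrite invr_ge0 ltW.
by rewrite mulrC EFinM lee_wpmul2l// lee_fin invr_ge0 ltW.
Qed.

Context (I : finType) (X : I -> {RV P >-> R}).
Hypothesis Xind : mutually_independent P (fun i => X i : T -> R).

Let measurable_preim i (B : set R) : measurable B -> measurable (X i @^-1` B).
Proof. by move=> mB; rewrite -[Y in measurable Y]setTI; exact: measurable_funPT. Qed.

Let integral_preim i (B : set R) : measurable B -> \int[P]_w (\1_B (X i w))%:E = P (X i @^-1` B).
Proof.
move=> mB; rewrite -[Y in _ = P Y]setIT -integral_indic//; exact: measurable_preim.
Qed.

(** [s] lists the indices whose factor may not yet be an indicator. With none left, this is the
    definition of independence; the induction frees one factor at a time through
    [integral_comp_mul_le]. *)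
Let indep_prod_le_seq (s : seq I) (f : I -> R -> R) (c : I -> R) :
  (forall i, measurable_fun setT (f i)) -> (forall i x, 0 <= f i x)%R ->
  (forall i, \int[P]_w (f i (X i w))%:E <= (c i)%:E) ->
  (forall i, i \notin s -> exists2 B, measurable B & f i = \1_B) ->
  \int[P]_w (\prod_i f i (X i w))%:E <= (\prod_i c i)%:E.
Proof.
elim: s f c => [|i0 s IH] f c mf f0 fc fB.
  have {fB} /choice[B HB] : forall i, exists B, measurable B /\ f i = \1_B.
    by move=> i; have [//|B ? ?] := fB i; exists B.
  have mB i : measurable (X i @^-1` B i) by apply: measurable_preim; case: (HB i).
  have fE i w : f i (X i w) = (w \in X i @^-1` B i)%:R.
    by rewrite (HB i).2 indicE; congr (_%:R); apply/idP/idP => /set_mem H; exact/mem_set.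
  have -> : \int[P]_w (\prod_i f i (X i w))%:E = P (\bigcap_(i in [set` [set: I]%SET]) X i
      @^-1` B i).
    rewrite -[Y in _ = P Y]setIT -integral_indic//; last first.
      by apply: fin_bigcap_measurable => // i _.
    apply: eq_integral => w _; congr (_%:E).
    rewrite indicE; have [/set_mem wB|wB] := boolP (w \in _).
      by apply: big1 => i _; rewrite fE mem_set//; apply: wB; rewrite /= finset.in_setT.
    apply/eqP; rewrite prodf_seq_eq0; apply/hasP; apply: contrapT => H.
    case/negP: wB; apply/mem_set => i _; apply: contrapT => wi; apply: H.
    by exists i; rewrite ?mem_index_enum//= fE memNset.
  rewrite (Xind (J := [set: I]%SET)); last by move=> i _; case: (HB i).
  have PE i : P (X i @^-1` B i) = (fine (P (X i @^-1` B i)))%:E.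
    by rewrite fineK// fin_num_measure.
  rewrite (eq_bigr (fun i => (fine (P (X i @^-1` B i)))%:E)); last by move=> i _; exact: PE.
  rewrite prodEFin lee_fin (eq_bigl xpredT); last by move=> i; rewrite finset.in_setT.
  apply: ler_prod => i _; rewrite fine_ge0//= -lee_fin -PE.
  by have [mBi fi] := HB i; rewrite -integral_preim// -fi.
pose rest w := (\prod_(i | i != i0) f i (X i w))%R.
have prodE w : (\prod_i f i (X i w) = f i0 (X i0 w) * rest w)%R by rewrite (bigD1 i0).
have c0 i : (0 <= c i)%R.
  by rewrite -lee_fin (le_trans _ (fc i))// integral_ge0// => w _; rewrite lee_fin.
have mrest : measurable_fun setT rest.
  rewrite /rest; under eq_fun do rewrite big_mkcond/=.
  by apply: measurable_prod => i _; case: (i != i0);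
      [exact: measurableT_comp|exact: measurable_cst].
under eq_integral do rewrite prodE.
rewrite (bigD1 i0)//= EFinM; set C := (\prod_(i | i != i0) c i)%R.
have C0 : (0 <= C)%R by apply: prodr_ge0.
apply: le_trans (lee_wpmul2r _ (fc i0)); last by rewrite lee_fin.
apply: (integral_comp_mul_le (Z := X i0)) => //; first by move=> w; apply: prodr_ge0.
move=> B mB.
pose f' i := if i == i0 then \1_B : R -> R else f i.
pose c' i := if i == i0 then fine (P (X i0 @^-1` B)) else c i.
have := IH f' c'.
have -> : (\prod_i c' i)%:E = P (X i0 @^-1` B) * C%:E.
  rewrite (bigD1 i0)//= /c' eqxx EFinM fineK ?fin_num_measure//; last exact: measurable_preim.
  by congr (_ * _%:E); apply: eq_bigr => i /negbTE->.
have E w : (\prod_i f' i (X i w) = \1_B (X i0 w) * rest w)%R.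
  by rewrite (bigD1 i0)//= /f' eqxx; congr (_ * _)%R; apply: eq_bigr => i /negbTE->.
under eq_integral do rewrite E.
apply.
- by move=> i; rewrite /f'; case: ifP => _ //; exact: measurable_indic.
- by move=> i x; rewrite /f'; case: ifP => _ //.
- move=> i; rewrite /f' /c'; case: eqP => [->|_//].
  by rewrite integral_preim// fineK ?fin_num_measure//; exact: measurable_preim.
- move=> i ins; rewrite /f'; case: eqVneq => [_|ii0]; first by exists B.
  by apply: fB; rewrite in_cons negb_or ii0.
Qed.

Lemma indep_prod_le (f : I -> R -> R) (c : I -> R) :
  (forall i, measurable_fun setT (f i)) -> (forall i x, 0 <= f i x)%R ->
  (forall i, \int[P]_w (f i (X i w))%:E <= (c i)%:E) ->
  \int[P]_w (\prod_i f i (X i w))%:E <= (\prod_i c i)%:E.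
Proof.
by move=> mf f0 fc; apply: (@indep_prod_le_seq (enum I)) => // i; rewrite mem_enum.
Qed.

Lemma indep_prod_markov (f : I -> R -> R) (c : I -> R) (b : R) :
  (forall i, measurable_fun setT (f i)) -> (forall i x, 0 <= f i x)%R ->
  (forall i, \int[P]_w (f i (X i w))%:E <= (c i)%:E) -> (0 < b)%R ->
  P [set w | b <= \prod_i f i (X i w)]%R <= (\prod_i c i / b)%:E.
Proof.
move=> mf f0 fc b0; apply: integral_le_markov => //; last exact: indep_prod_le.
  by apply: measurable_prod => i _; apply: measurableT_comp.
by move=> w; exact: prodr_ge0.
Qed.

End ProductMarkov.

(** * Concentration of the latent positions and of the noise *)

Section RareEvents.
Context d (T : measurableType d) (R : realType) (P : probability T R).
Local Open Scope ereal_scope.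

(* [B] need not be measurable: this bounds its outer probability. *)
Definition rare (B : set T) (c : R) : Prop :=
  exists2 D, measurable D /\ P D <= c%:E & B `<=` D.

Lemma rare_le (B B' : set T) (c c' : R) : B `<=` B' -> (c' <= c)%R -> rare B' c' -> rare B c.
Proof.
move=> BB cc [D [mD PD] BD]; exists D; last exact: subset_trans BD.
by split=> //; rewrite (le_trans PD)// lee_fin.
Qed.

Lemma rareU (B1 B2 : set T) (c1 c2 : R) : rare B1 c1 -> rare B2 c2 -> rare (B1 `|` B2) (c1 +
    c2)%R.
Proof.
move=> [D1 [mD1 PD1] BD1] [D2 [mD2 PD2] BD2]; exists (D1 `|` D2); last exact: setUSS.
split; first exact: measurableU.
rewrite EFinD (le_trans _ (leeD PD1 PD2))//; exact: measureU2.
Qed.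

Lemma rare_bigcup (I : finType) (B : I -> set T) (c : R) :
  (forall i, rare (B i) c) -> rare (\bigcup_i B i) (#|I|%:R * c)%R.
Proof.
move=> Bc; have /choice[D HD] : forall i, exists D, [/\ measurable D, P D <= c%:E & B i `<=` D].
  by move=> i; have [D [? ?] ?] := Bc i; exists D.
suff H (s : seq I) : rare (\bigcup_(i in [set` s]) B i) ((size s)%:R * c)%R.
  have := H (enum I); rewrite -cardE; apply: rare_le => // w [i _ iw].
  by exists i => //=; rewrite mem_enum.
elim: s => [|i s IH].
  exists set0 => //; first by rewrite measure0 mul0r.
  by move=> w [].
have := rareU (Bc i) IH; apply: rare_le; last by rewrite /= -natr1 mulrDl mul1r addrC.
move=> w [j /=]; rewrite in_cons => /predU1P[->|js] jw; first by left.
by right; exists j.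
Qed.

Lemma sum_disjoint_le1 (K : finType) (D : K -> set T) : (forall k, measurable (D k)) ->
  (forall k k' w, D k w -> D k' w -> k = k') -> \sum_k P (D k) <= 1.
Proof.
move=> mD D1; rewrite (eq_bigr (fun k => \int[P]_w (\1_(D k) w)%:E)); last first.
  by move=> k _; rewrite integral_indic// setIT.
rewrite -ge0_integral_sum//=; last first.
- by move=> k; apply: measurableT_comp => //; exact: measurable_indic.
apply: (@le_trans _ _ (\int[P]_w (cst 1 w)));
    last by rewrite integral_cst// mul1e probability_le1.
apply: ge0_le_integral => //=.
- by move=> w _; rewrite sumEFin lee_fin sumr_ge0.
- by apply: emeasurable_sum => k; apply: measurableT_comp => //; exact: measurable_indic.
- move=> w _; rewrite sumEFin lee_fin.
  have [[k0 k0w]|Nk] := pselect (exists k, D k w); last first.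
    rewrite big1 ?ler01// => k _; rewrite indicE memNset// => kw; by apply: Nk; exists k.
  rewrite (bigD1 k0)//= big1 ?addr0; first by rewrite indicE mem_set.
  move=> k kk0; rewrite indicE memNset// => kw.
  by move: kk0; rewrite (D1 _ _ _ kw k0w) eqxx.
Qed.

End RareEvents.

Section UniformVariable.
Context d (T : measurableType d) (R : realType) (P : probability T R).

Lemma uniform01_lt (Z : {RV P >-> R}) (p : R) : uniform01 Z -> 0 <= p <= 1 ->
  P [set w | Z w < p] = p%:E.
Proof.
move=> ZU /andP[p0 p1].
have -> : [set w | Z w < p] = Z @^-1` `]-oo, p[.
  by apply/seteqP; split=> w /=; rewrite in_itv.
rewrite -[LHS]/(distribution P Z `]-oo, p[) ZU// /uniform_prob integral_uniform_pdf.
have -> : `]-oo, p[%classic `&` `[0, 1]%classic = `[0, p[%classic :> set R.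
  apply/seteqP; split=> x /=; rewrite !in_itv/=; first by move=> [-> /andP[->]].
  by move=> /andP[-> xp]; split=> //; rewrite (le_trans (ltW xp)).
rewrite (eq_integral (cst 1%E)); last first.
  move=> x; rewrite inE/= in_itv/= => /andP[x0 xp].
  by rewrite /uniform_pdf x0 (le_trans (ltW xp))//= subr0 invr1.
rewrite integral_cst//= lebesgue_measure_itv/= lte_fin mul1e.
by case: ltP => [_|p0']; rewrite ?oppr0 ?adde0 ?subr0//; congr (_%:E); apply/eqP;
    rewrite eq_le p0 p0'.
Qed.

End UniformVariable.

Section ExpBounds.
Context (R : realType).

(** Multiply by [1 - y]: the left side becomes at most 1 and the right side is
    [1 + y ^+ 2 * (1 - 2 * y)]. *)
Lemma expR_le_quad (y : R) : y <= 2^-1 -> expR y <= 1 + y + 2 * y ^+ 2.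
Proof.
move=> y2.
have h1 : 0 < 1 - y by lra.
have h2 : 1 - y <= expR (- y) by have := expR_ge1Dx (- y).
have h3 : expR y * (1 - y) <= 1.
  apply: (@le_trans _ _ (expR y * expR (- y))); last by rewrite expRxMexpNx_1.
  by rewrite ler_wpM2l// expR_ge0.
rewrite -(ler_pM2r h1) (le_trans h3)//.
have : 0 <= y ^+ 2 * (1 - 2 * y) by rewrite mulr_ge0 ?sqr_ge0//; lra.
by move=> ?; nra.
Qed.

End ExpBounds.

Section LatentTails.
Context d (T : measurableType d) (R : realType) (P : probability T R).
Context (n : nat) (V : 'I_n -> {RV P >-> R}).
Hypothesis Vind : mutually_independent P (fun i => V i : T -> R).
Hypothesis VU : forall i, uniform01 (V i).
Local Open Scope ereal_scope.

Let mV_lt k (p : R) : measurable [set w | V k w < p]%R.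
Proof.
have -> : [set w | V k w < p]%R = setT `&` V k @^-1` `]-oo, p[%classic.
  by rewrite setTI; apply/seteqP; split=> w /=; rewrite in_itv.
exact: measurable_funPT.
Qed.

Let integral_ind (B : set T) (u : R) : (0 <= u)%R -> measurable B ->
  \int[P]_w (u * \1_B w)%:E = u%:E * P B.
Proof.
move=> u0 mB; under eq_integral do rewrite EFinM.
rewrite ge0_integralZl_EFin//.
  by rewrite integral_indic// setIT.
by apply: measurableT_comp => //; exact: measurable_indic.
Qed.

(** A Chernoff bound, for both tails according to the sign of [s]. In the moment generating function
    of a centred indicator the linear terms of [expR_le_quad] cancel. *)
Lemma latent_count_tail (p s b : R) : (0 <= p <= 1)%R -> (`|s| <= 2^-1)%R ->
  P [set w | b <= s * (#|[set k | V k w < p]%SET|%:R - n%:R * p)]%R <=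
  (expR (2 * n%:R * s ^+ 2 - b))%:E.
Proof.
move=> p01 s2; have /andP[p0 p1] := p01.
have indE x : \1_(`]-oo, p[%classic : set R) x = (x < p)%R%:R :> R.
  by rewrite indicE mem_setE in_itv.
pose f (k : 'I_n) (x : R) := expR (s * (\1_(`]-oo, p[%classic : set R) x - p)).
have fE w : (\prod_k f k (V k w) = expR (s * (#|[set k | V k w < p]%SET|%:R - n%:R * p)))%R.
  rewrite /f; under eq_bigr do rewrite indE.
  rewrite -expR_sum; congr expR; rewrite -mulr_sumr sumrB sumr_const card_ord;
      congr (_ * (_ - _))%R.
    by rewrite -natr_sum -sum1dep_card [in RHS]big_mkcond.
  by rewrite mulr_natl.
have -> : [set w | b <= s * (#|[set k | V k w < p]%SET|%:R - n%:R * p)]%R =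
          [set w | expR b <= \prod_k f k (V k w)]%R.
  by apply/seteqP; split=> w /=; rewrite fE ler_expR.
apply: le_trans (indep_prod_markov Vind (c := fun=> expR (2 * s ^+ 2)) _ _ _ (expR_gt0 b)) _.
- move=> k; apply: measurableT_comp => //; apply: measurable_funM => //; exact: measurable_funB.
- by move=> k x; exact: expR_ge0.
- move=> k; set u := expR (s * (1 - p)); set v := expR (s * (0 - p)).
  have -> : \int[P]_w (f k (V k w))%:E =
      \int[P]_w ((u * \1_[set w | V k w < p]%R w)%:E + (v * \1_(~` [set w | V k w < p]%R) w)%:E).
    apply: eq_integral => w _; rewrite -EFinD /f indE !indicE in_setC; congr (_%:E).
    have [Vp|Vp] := boolP (V k w < p)%R.
      by rewrite mem_set//= mulr1 mulr0 addr0.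
    have Vp' : ~ [set w | V k w < p]%R w by exact/negP.
    by rewrite (memNset Vp')/= mulr0 mulr1 [RHS]add0r.
  rewrite ge0_integralD//=; last 4 first.
  - by move=> w _; rewrite lee_fin mulr_ge0// expR_ge0.
  - by apply: measurableT_comp => //; apply: measurable_funM => //; exact: measurable_indic.
  - by move=> w _; rewrite lee_fin mulr_ge0// expR_ge0.
  - apply: measurableT_comp => //; apply: measurable_funM => //; apply: measurable_indic;
      exact: measurableC.
  rewrite !integral_ind ?expR_ge0//; last exact: measurableC.
  rewrite probability_setC// uniform01_lt// -!EFinB -!EFinM -EFinD lee_fin.
  have u1 : (u <= 1 + s * (1 - p) + 2 * (s * (1 - p)) ^+ 2)%R.
    apply: expR_le_quad; apply: le_trans (ler_norm _) _; rewrite normrM.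
    by apply: le_trans s2; rewrite ler_piMr// ger0_norm ?subr_ge0// gerBl.
  have v1 : (v <= 1 + s * (0 - p) + 2 * (s * (0 - p)) ^+ 2)%R.
    apply: expR_le_quad; apply: le_trans (ler_norm _) _; rewrite normrM.
    by apply: le_trans s2; rewrite ler_piMr// sub0r normrN ger0_norm.
  apply: (@le_trans _ _ (1 + 2 * s ^+ 2)%R); last exact: expR_ge1Dx.
  have h1 := ler_wpM2r p0 u1.
  have q0 : (0 <= 1 - p)%R by rewrite subr_ge0.
  have h2 := ler_wpM2r q0 v1.
  have h3 : (s ^+ 2 * (p * (1 - p)) <= s ^+ 2 * 1)%R.
    by rewrite ler_wpM2l ?sqr_ge0// mulr_ile1// gerBl.
  by have := lerD h1 h2; rewrite ![(_ * p)%R]mulrC => ?; lra.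
by rewrite lee_fin prodr_const card_ord -expRM_natl -expRB;
    rewrite (_ : (n%:R * (2 * s ^+ 2) = 2 * n%:R * s ^+ 2)%R)//; ring.
Qed.

Lemma latent_gap_tail (x y : R) : (0 <= x)%R -> (x <= y)%R -> (y <= 1)%R ->
  P [set w | forall k, ~ (x <= V k w < y)%R] <= (expR (- (n%:R * (y - x))))%:E.
Proof.
move=> x0 xy y1.
have mI : measurable (~` `[x, y[%classic : set R) by exact: measurableC.
pose f (k : 'I_n) : R -> R := \1_(~` `[x, y[%classic).
have fE k w : f k (V k w) = (~~ (x <= V k w < y)%R)%:R.
  by rewrite /f indicE in_setC mem_setE in_itv.
have -> : [set w | forall k, ~ (x <= V k w < y)%R] = [set w | 1 <= \prod_k f k (V k w)]%R.
  apply/seteqP; split=> w /= Vw.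
    by rewrite big1// => k _; rewrite fE; have /negP -> := Vw k.
  move=> k Vk; move: Vw; rewrite (bigD1 k)//= fE Vk mul0r.
  by rewrite leNgt ltr01.
apply: le_trans (indep_prod_markov Vind (c := fun=> expR (x - y)) _ _ _ ltr01) _.
- by move=> k; exact: measurable_indic.
- by move=> k z; rewrite /f indicE.
- move=> k; have y01 : (0 <= y <= 1)%R by rewrite y1 (le_trans x0).
  have x01 : (0 <= x <= 1)%R by rewrite x0 (le_trans xy).
  apply: (@le_trans _ _ (1 - (y - x))%:E); last first.
    by rewrite lee_fin; have := expR_ge1Dx (x - y); move=> ?; lra.
  have -> : \int[P]_w (f k (V k w))%:E = P (~` ([set w | V k w < y]%R `\` [set w | V k w < x]%R)).
    rewrite -[X in _ = P X]setIT -integral_indic//; last first.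
      by apply: measurableC; exact: measurableD.
    apply: eq_integral => w _; congr (_%:E); rewrite fE indicE in_setC.
    congr (~~ _)%:R; apply/idP/idP => [/andP[xV Vy]|/set_mem/= [Vy /negP]].
      by apply/mem_set; split=> //=; apply/negP; rewrite -leNgt.
    by rewrite -leNgt => ->.
  rewrite probability_setC; last exact: measurableD.
  rewrite measureD//; last by rewrite -ge0_fin_numE// fin_num_measure.
  rewrite (_ : _ `&` _ = [set w | V k w < x]%R); last first.
    by apply/seteqP; split=> w /=; [case|move=> h; split=> //; exact: lt_le_trans xy].
  rewrite [X in 1 - (X - _)](uniform01_lt (VU k) y01) [X in 1 - (_ - X)](uniform01_lt (VU k) x01).
  by rewrite -!EFinB.
rewrite lee_fin prodr_const card_ord -expRM_natl divr1 ler_expR; lra.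
Qed.

Lemma latent_outside_rare k : rare P [set w | (V k w < 0)%R \/ (1 <= V k w)%R] 0.
Proof.
have h0 : P [set w | V k w < 0]%R = 0 by rewrite uniform01_lt// lexx ler01.
have h1 : P (~` [set w | V k w < 1]%R) = 0.
  by rewrite probability_setC// uniform01_lt ?lexx ?ler01// subee.
exists ([set w | V k w < 0]%R `|` ~` [set w | V k w < 1]%R).
  split; first by apply: measurableU => //; exact: measurableC.
  apply: le_trans (measureU2 _ _ _) _ => //; first exact: measurableC.
  by rewrite [X in X + _]h0 [X in _ + X]h1 adde0.
move=> w [V0|V1]; [by left|right => /=].
by apply/negP; rewrite -leNgt.
Qed.

End LatentTails.

(** * Exponential moment of the square of a subgaussian variable *)

Section SubgaussianSquare.
Context d (T : measurableType d) (R : realType) (P : probability T R) (Z : {RV P >-> R}).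
Hypothesis Zsub : centered_subgaussian1 Z.
Local Open Scope ereal_scope.

Lemma subgaussian_mgf (s : R) : \int[P]_w (expR (s * Z w))%:E <= (expR (s ^+ 2 / 2))%:E.
Proof.
have := Zsub.2 s; rewrite /mmt_gen_fun unlock; apply: le_trans.
by rewrite le_eqVlt; apply/orP; left; apply/eqP; apply: eq_integral => w _ /=; rewrite mulrC.
Qed.

(* [expR (x ^+ 2 / 8)] is dominated by the term of index [truncn `|x|] of a series
   of exponentials of multiples of [x], whose expectations are summable. *)
Let term (k : nat) (x : R) :=
  (expR ((k%:R + 1) ^+ 2 / 8 - k%:R ^+ 2) * (expR (k%:R * x) + expR (- k%:R * x)))%R.

Let term_ge0 k x : (0 <= term k x)%R.
Proof. by rewrite mulr_ge0 ?addr_ge0 ?expR_ge0. Qed.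

Let expR_sq_le_term (x : R) : (expR (x ^+ 2 / 8) <= term (Num.truncn `|x|) x)%R.
Proof.
set k := Num.truncn `|x|.
have /andP[k1 k2] : (k%:R <= `|x| < k.+1%:R)%R by apply: truncn_itv.
rewrite -natr1 in k2.
have H : (expR (k%:R * `|x|) <= expR (k%:R * x) + expR (- k%:R * x))%R.
  have [x0|x0] := leP 0%R x.
    by rewrite ger0_norm// lerDl expR_ge0.
  by rewrite ltr0_norm// mulrN -mulNr lerDr expR_ge0.
apply: (@le_trans _ _ (expR ((k%:R + 1) ^+ 2 / 8 - k%:R ^+ 2) * expR (k%:R * `|x|)))%R;
    last first.
  by rewrite ler_wpM2l// expR_ge0.
rewrite -expRD ler_expR -real_normK ?num_real//.
have k0 : (0 <= k%:R :> R)%R by exact: ler0n.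
have h1 : (`|x| ^+ 2 <= (k%:R + 1) ^+ 2)%R by rewrite lerXn2r ?nnegrE ?addr_ge0// ltW.
have h2 : (k%:R ^+ 2 <= k%:R * `|x|)%R by rewrite expr2 ler_wpM2l.
by move: h1 h2; set u := (_ ^+ 2)%R; set v := ((_ + _) ^+ 2)%R => ? ?; lra.
Qed.

Let mterm k : measurable_fun setT (fun w => term k (Z w)).
Proof.
apply: measurable_funM => //; apply: measurable_funD; apply: measurableT_comp => //;
    apply: measurable_funM => //; exact: measurable_funPT.
Qed.

Let term_integral k :
  \int[P]_w (term k (Z w))%:E <= (2 * expR 4^-1 * expR (- 4^-1) ^+ k)%:E.
Proof.
rewrite /term; set a := expR ((k%:R + 1) ^+ 2 / 8 - k%:R ^+ 2).
have a0 : (0 <= a)%R by exact: expR_ge0.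
have mE (s : R) : measurable_fun setT (fun w => (expR (s * Z w))%:E).
  apply/measurable_EFinP; apply: measurableT_comp => //; apply: measurable_funM => //;
      exact: measurable_funPT.
have E0 (s : R) w : setT w -> 0 <= (expR (s * Z w))%:E by rewrite lee_fin expR_ge0.
apply: (@le_trans _ _ (a * (2 * expR (k%:R ^+ 2 / 2)))%:E).
  rewrite (eq_integral (fun w => a%:E * ((expR (k%:R * Z w))%:E + (expR (- k%:R * Z w))%:E)));
      last first.
    by move=> w _; rewrite -EFinD -EFinM.
  rewrite ge0_integralZl_EFin//; last 2 first.
  - by move=> w _; rewrite -EFinD lee_fin addr_ge0 ?expR_ge0.
  - exact: emeasurable_funD.
  rewrite ge0_integralD// EFinM lee_wpmul2l ?lee_fin//.
  apply: le_trans (leeD (subgaussian_mgf _) (subgaussian_mgf _)) _.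
  by rewrite sqrrN -EFinD lee_fin; lra.
rewrite lee_fin /a -expRM_natl mulrCA -!mulrA -!expRD ler_wpM2l// ler_expR.
(* The comparison of exponents reduces to [3 k^2 - 4 k + 1 >= 0], true for integers but not for all
   reals. *)
have k0 : (k%:R <= k%:R ^+ 2 :> R)%R by rewrite -natrX ler_nat; case: (k) => // m;
    rewrite expnS leq_pmulr.
by have := sqr_ge0 (k%:R - 1 : R)%R; move=> ?; lra.
Qed.

Let geometric_le (N : nat) :
  (\sum_(0 <= k < N) 2 * expR 4^-1 * expR (- 4^-1) ^+ k <= expR 4 :> R)%R.
Proof.
rewrite -mulr_sumr; set r := expR (- 4^-1 : R); set S := (\sum_(0 <= k < N) r ^+ k)%R.
have q_le : (expR (4^-1 : R) * (3 / 4) <= 1)%R.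
  apply: (@le_trans _ _ (expR 4^-1 * expR (- 4^-1)))%R; last by rewrite expRxMexpNx_1.
  by rewrite ler_wpM2l ?expR_ge0//; have := expR_ge1Dx (- 4^-1 : R); move=> ?; lra.
have r_le : (r * (5 / 4) <= 1)%R.
  apply: (@le_trans _ _ (r * expR 4^-1))%R; last by rewrite /r mulrC expRxMexpNx_1.
  by rewrite ler_wpM2l ?expR_ge0//; have := expR_ge1Dx (4^-1 : R); move=> ?; lra.
have r0 : (0 <= r)%R by exact: expR_ge0.
have S0 : (0 <= S)%R by rewrite sumr_ge0// => k _; exact: exprn_ge0.
have S_le : (S <= 5)%R.
  have h : ((1 - r) * S <= 1)%R.
    have := subrX1 r N; rewrite -(big_mkord xpredT (fun k => r ^+ k)%R) -/S => h1.
    have -> : ((1 - r) * S = - (r ^+ N - 1))%R by rewrite h1; ring.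
    by have := exprn_ge0 N r0; move=> ?; lra.
  have h2 : (5^-1 * S <= (1 - r) * S)%R by rewrite ler_wpM2r//; lra.
  by lra.
have e4 : (16 <= expR 4 :> R)%R.
  have -> : (4 = 4 * 1 :> R)%R by rewrite mulr1.
  rewrite (expRM_natl 4%N); have e1 : (2 <= expR 1 :> R)%R by have := expR_ge1Dx (1 : R);
      move=> ?; lra.
  by apply: (@le_trans _ _ (2 ^+ 4)%R); [lra|rewrite lerXn2r ?nnegrE ?expR_ge0].
apply: le_trans e4; apply: (@le_trans _ _ (2 * (4 / 3) * 5)%R); last by lra.
by rewrite ler_pM// ?mulr_ge0 ?expR_ge0// ler_wpM2l//; lra.
Qed.

Lemma subgaussian_sq : \int[P]_w (expR (Z w ^+ 2 / 8))%:E <= (expR 4)%:E.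
Proof.
apply: (@le_trans _ _ (\int[P]_w (\sum_(k <oo) (term k (Z w))%:E))).
  apply: ge0_le_integral => //=.
  - apply/measurable_EFinP; apply: measurableT_comp => //; apply: measurable_funM => //.
    by apply: measurable_funX; exact: measurable_funPT.
  - apply: ge0_emeasurable_sum => //.
    + by move=> k w _ _; rewrite lee_fin.
    + by move=> k _; exact/measurable_EFinP.
  - move=> w _; set x := Z w.
    have := @nneseries_lim_ge R (fun k => (term k x)%:E) xpredT 0%N (Num.truncn `|x|).+1.
    move=> /(_ (fun k _ _ => term_ge0 k x)); apply: le_trans.
    rewrite big_nat_recr//= (@le_trans _ _ (term (Num.truncn `|x|) x)%:E) ?lee_fin
        ?expR_sq_le_term//.
    by rewrite leeDr// sume_ge0// => k _; rewrite lee_fin.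
rewrite integral_nneseries//; last 2 first.
- by move=> k; exact/measurable_EFinP.
- by move=> k w _; rewrite lee_fin.
apply: (@le_trans _ _ (\sum_(k <oo) (2 * expR 4^-1 * expR (- 4^-1) ^+ k)%:E)).
  apply: lee_nneseries => [k _ _|k _]; last exact: term_integral.
  by apply: integral_ge0 => w _; rewrite lee_fin.
apply: lime_le.
  by apply: is_cvg_nneseries => k _ _; rewrite lee_fin mulr_ge0// ?mulr_ge0 ?exprn_ge0 ?expR_ge0.
by apply: nearW => N; rewrite sumEFin lee_fin.
Qed.

End SubgaussianSquare.

Section Reindexing.
Context d (T : measurableType d) (R : realType) (P : probability T R).

Lemma mutually_independent_inj (I J : finType) (X : I -> T -> R) (g : J -> I) :
  injective g -> mutually_independent P X -> mutually_independent P (X \o g).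
Proof.
move=> ginj Xind J0 B mB.
pose B' i := [set x | forall j, g j = i -> B j x].
have B'E j : B' (g j) = B j.
  by apply/seteqP; split=> [x /(_ j erefl)//|x Bx k /ginj ->].
have -> : \bigcap_(j in [set` J0]) (X \o g) j @^-1` B j = \bigcap_(i in [set` (g @: J0)%SET]) X
    i @^-1` B' i.
  apply/seteqP; split=> w H.
    by move=> _ /imsetP[j jJ ->]; rewrite B'E; exact: H.
  by move=> j jJ /=; rewrite -B'E; apply: H; rewrite /= imset_f.
rewrite Xind; last by move=> _ /imsetP[j jJ ->]; rewrite B'E; exact: mB.
rewrite (big_imset (fun i => P (X i @^-1` B' i)))/=; last by move=> ? ? _ _; exact: ginj.
by apply: eq_bigr => j _; rewrite B'E.
Qed.

End Reindexing.

Section NoiseTails.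
Context d (T : measurableType d) (R : realType) (P : probability T R).
Context (I : finType) (E : I -> {RV P >-> R}).
Hypothesis Eind : mutually_independent P (fun i => E i : T -> R).
Hypothesis Esub : forall i, centered_subgaussian1 (E i).
Local Open Scope ereal_scope.

(** This mixed form replaces conditioning: the variables in [Q] are confined to given sets while a
    fixed linear form in the others has its Chernoff bound. *)
Lemma noise_tail (Q : pred I) (B : I -> set R) (th : I -> R) (b : R) :
  (forall i, measurable (B i)) ->
  P [set w | (forall i, Q i -> B i (E i w)) /\ (b <= \sum_(i | ~~ Q i) th i * E i w)%R] <=
  ((\prod_(i | Q i) fine (P (E i @^-1` B i))) * expR (\sum_(i | ~~ Q i) th i ^+ 2 / 2 - b))%:E.
Proof.
move=> mB.
pose f i (x : R) := if Q i then \1_(B i) x else expR (th i * x).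
have fE w : (\prod_i f i (E i w) =
    (\prod_(i | Q i) \1_(B i) (E i w)) * expR (\sum_(i | ~~ Q i) th i * E i w))%R.
  rewrite expR_sum (bigID Q)/=; congr (_ * _)%R; apply: eq_bigr => i.
    by rewrite /f => ->.
  by rewrite /f => /negbTE ->.
have -> : [set w | (forall i, Q i -> B i (E i w)) /\ (b <= \sum_(i | ~~ Q i) th i * E i w)%R] =
          [set w | expR b <= \prod_i f i (E i w)]%R.
  apply/seteqP; split=> w /=; rewrite fE.
    move=> [QB bw]; rewrite big1 ?mul1r ?ler_expR// => i Qi.
    by rewrite indicE mem_set//; exact: QB.
  have [QB|/existsNP[i /not_implyP[Qi Bi]]] := pselect (forall i, Q i -> B i (E i w)).
    rewrite big1 ?mul1r ?ler_expR// => i Qi.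
    by rewrite indicE mem_set//; exact: QB.
  rewrite (bigD1 i)//= indicE memNset// !mul0r => h.
  by have := expR_gt0 b; rewrite ltNge h.
pose c i := if Q i then fine (P (E i @^-1` B i)) else expR (th i ^+ 2 / 2).
have mEB i : measurable (E i @^-1` B i).
  by rewrite -[X in measurable X]setTI; exact: measurable_funPT.
apply: le_trans (indep_prod_markov Eind (c := c) _ _ _ (expR_gt0 b)) _.
- move=> i; rewrite /f; case: (Q i); first exact: measurable_indic.
  by apply: measurableT_comp => //; exact: measurable_funM.
- by move=> i x; rewrite /f; case: (Q i); [rewrite indicE|exact: expR_ge0].
- move=> i; rewrite /f /c; case: (Q i); last exact: subgaussian_mgf.
  rewrite fineK ?fin_num_measure// -[X in _ <= P X]setIT -integral_indic//.
- rewrite lee_fin (bigID Q)/= -mulrA expRB expR_sum le_eqVlt; apply/orP; left; apply/eqP.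
  congr (_ * (_ * _))%R; apply: eq_bigr => i; rewrite /c; first by move=> ->.
  by move=> /negbTE->.
Qed.

Lemma noise_sqnorm_tail (b : R) :
  P [set w | b <= \sum_i E i w ^+ 2]%R <= (expR (4 * #|I|%:R - b / 8))%:E.
Proof.
pose f (i : I) (x : R) := expR (x ^+ 2 / 8).
have -> : [set w | b <= \sum_i E i w ^+ 2]%R = [set w | expR (b / 8) <= \prod_i f i (E i w)]%R.
  apply/seteqP; split=> w /=; rewrite -expR_sum ler_expR -mulr_suml; first by move=> ?; lra.
  by move=> ?; lra.
apply: le_trans (indep_prod_markov Eind (c := fun=> expR 4) _ _ _ (expR_gt0 (b / 8))) _.
- move=> i; apply: measurableT_comp => //; apply: measurable_funM => //.
- by move=> i x; exact: expR_ge0.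
- by move=> i; exact: subgaussian_sq.
by rewrite prodr_const -expRM_natl -expRB mulrC.
Qed.

End NoiseTails.

Section NoiseRows.
Context d (T : measurableType d) (R : realType) (P : probability T R).
Context (n : nat) (E : 'I_n -> 'I_n -> {RV P >-> R}).
Hypothesis Eind : mutually_independent P (fun p : 'I_n * 'I_n => E p.1 p.2 : T -> R).
Hypothesis Esub : forall i j, centered_subgaussian1 (E i j).
Local Open Scope ereal_scope.

Let row_ind j : mutually_independent P (fun k => E j k : T -> R).
Proof.
have inj : injective (fun k : 'I_n => (j, k)) by move=> k l [].
exact: (mutually_independent_inj inj Eind).
Qed.

Lemma row_noise_tail (S : {set 'I_n}) j (s b : R) :
  P [set w | b <= s * \sum_(k in S) E j k w]%R <= (expR (s ^+ 2 * n%:R / 2 - b))%:E.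
Proof.
have := @noise_tail _ _ _ P _ (E j) (row_ind j) (Esub j) (fun k => k \notin S) (fun=> setT)
    (fun=> s) b (fun=> measurableT).
have -> : [set w | (forall i, i \notin S -> [set: R] (E j i w)) /\
    (b <= \sum_(i | ~~ (i \notin S)) s * E j i w)%R] = [set w | b <= s * \sum_(k in S) E j k w]%R.
  apply/seteqP; split=> w /=.
    by move=> [_]; rewrite mulr_sumr; under eq_bigl do rewrite negbK.
  by rewrite mulr_sumr => h; split => //; under eq_bigl do rewrite negbK.
move=> /le_trans; apply; rewrite lee_fin big1 ?mul1r; last first.
  by move=> k _; rewrite preimage_setT probability_setT.
rewrite ler_expR lerB// sumr_const -[leLHS]mulr_natr.
have -> : (s ^+ 2 * n%:R / 2 = s ^+ 2 / 2 * n%:R)%R by ring.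
rewrite ler_wpM2l// ?divr_ge0 ?sqr_ge0// ler_nat.
by rewrite -[leqRHS](card_ord n) max_card.
Qed.

Lemma row_sqnorm_tail j : P [set w | 64 * n%:R <= \sum_k E j k w ^+ 2]%R <= (expR (- 4 *
    n%:R))%:E.
Proof.
apply: le_trans (noise_sqnorm_tail (row_ind j) (Esub j) _) _.
by rewrite lee_fin ler_expR card_ord; lra.
Qed.

End NoiseRows.

Section FiniteUnion.
Context d (T : measurableType d) (R : realType) (P : probability T R).
Local Open Scope ereal_scope.

Lemma measure_bigcup_le_sum (I : finType) (F : I -> set T) : (forall i, measurable (F i)) ->
  P (\bigcup_i F i) <= \sum_i P (F i).
Proof.
move=> mF.
have mFs (s : seq I) : measurable (\bigcup_(i in [set` s]) F i).
  by apply: fin_bigcup_measurable.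
have H (s : seq I) : P (\bigcup_(i in [set` s]) F i) <= \sum_(i <- s) P (F i).
  elim: s => [|i s IH]; first by rewrite set_nil bigcup_set0 measure0 big_nil.
  have -> : [set` i :: s] = i |` [set` s].
    apply/seteqP; split=> x /=; rewrite in_cons; first by move=> /predU1P.
    by move=> xi; apply/predU1P.
  rewrite bigcup_setU1 big_cons (le_trans (measureU2 _ _ _))//.
  exact: leeD2l.
apply: le_trans (H (index_enum I)); rewrite (_ : [set: I] = [set` index_enum I])//.
by apply/seteqP; split=> i //= _; rewrite mem_index_enum.
Qed.

End FiniteUnion.

Section GeneratedSigmaAlgebra.
Context d (T : measurableType d) (R : realType) (I : Type) (X : I -> {mfun T >-> R}).

(** The same carrier with the smaller sigma-algebra, so that ordinary measurability lemmas prove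
    membership in [sigma_generated]. *)
Definition generated_type : measurableType _ :=
  g_sigma_algebraType (\bigcup_i preimage_set_system [set: T] (X i) measurable).

Lemma generated_typeP (A : set T) :
  measurable (A : set generated_type) = sigma_generated (fun i => X i : T -> R) A.
Proof. by []. Qed.

Lemma measurable_generated i : measurable_fun setT (X i : generated_type -> R).
Proof.
move=> _ B mB; apply: sub_sigma_algebra; exists i => //.
by exists B.
Qed.

Lemma sigma_generated_measurable (A : set T) :
  sigma_generated (fun i => X i : T -> R) A -> measurable A.
Proof.
move: A; apply: smallest_sub; first exact: sigma_algebra_measurable.
by move=> A [i _ [B mB <-]]; exact: measurable_funPT.
Qed.

End GeneratedSigmaAlgebra.

Section IntervalNoise.
Context d (T : measurableType d) (R : realType) (P : probability T R).
Context (n : nat) (V : 'I_n -> {RV P >-> R}) (E : 'I_n -> 'I_n -> {RV P >-> R}).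
Hypothesis EVind : independent_families P (fun p : 'I_n * 'I_n => E p.1 p.2 : T -> R)
    (fun i => V i : T -> R).
Hypothesis Eind : mutually_independent P (fun p : 'I_n * 'I_n => E p.1 p.2 : T -> R).
Hypothesis Esub : forall i j, centered_subgaussian1 (E i j).

Let window p r w := [set k | V p w <= V k w <= V r w]%SET.

Let window_sigma p r S : sigma_generated (fun i => V i : T -> R) [set w | window p r w = S].
Proof.
rewrite -generated_typeP.
have -> : [set w | window p r w = S] =
    \bigcap_(k in [set: 'I_n]) [set w | (V p w <= V k w <= V r w) = (k \in S)].
  apply/seteqP; split=> w /=; first by move=> <- k _ /=; rewrite inE.
  by move=> wS; apply/setP => k; rewrite inE; exact: wS.
apply: fin_bigcap_measurable => // k _.
have mle : measurable_fun setT (fun w : generated_type V => (V p w <= V k w) && (V k w <= V r w)).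
  by apply: measurable_and; apply: measurable_fun_ler; exact: measurable_generated.
have := mle measurableT [set k \in S] I; rewrite setTI; congr measurable.
Qed.

Let noise_sigma j (S : {set 'I_n}) (s b : R) :
  sigma_generated (fun p : 'I_n * 'I_n => E p.1 p.2 : T -> R)
    [set w | b <= s * \sum_(k in S) E j k w].
Proof.
pose E' (p : 'I_n * 'I_n) : {mfun T >-> R} := E p.1 p.2.
rewrite -(generated_typeP E') -[X in measurable X]setTI.
apply: measurable_fun_le => //; apply: measurable_funM => //.
rewrite (_ : (fun w => _) = (fun w : generated_type E' => \sum_k if k \in S then E j k w else
    0)); last first.
  by apply/funext => w; rewrite big_mkcond.
apply: measurable_sum => k; case: (k \in S) => //.
exact: (@measurable_generated _ _ _ _ E' (j, k)).
Qed.

(* The window takes finitely many values and is independent of the noise. *)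
Lemma window_noise_rare j p r (s b : R) :
  rare P [set w | b <= s * \sum_(k | V p w <= V k w <= V r w) E j k w]
    (expR (s ^+ 2 * n%:R / 2 - b)).
Proof.
pose D S := [set w | window p r w = S].
pose F (S : {set 'I_n}) := [set w | b <= s * \sum_(k in S) E j k w].
have mD S : measurable (D S) by apply: (@sigma_generated_measurable _ _ _ _ V);
    exact: window_sigma.
have mF S : measurable (F S).
  by apply: (@sigma_generated_measurable _ _ _ _ (fun p : 'I_n * 'I_n => E p.1 p.2 : {mfun T
      >-> R})); exact: noise_sigma.
exists (\bigcup_(S in [set: {set 'I_n}]) (F S `&` D S)); last first.
  move=> w /= bw; exists (window p r w) => //; split=> //.
  rewrite /F/= (eq_bigl (fun k => V p w <= V k w <= V r w))// => k.
  by rewrite inE.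
split; first by apply: fin_bigcup_measurable => // S _; exact: measurableI.
apply: le_trans (measure_bigcup_le_sum _ _) _; first by move=> S; exact: measurableI.
apply: (@le_trans _ _ (\sum_(S : {set 'I_n}) (expR (s ^+ 2 * n%:R / 2 - b))%:E * P (D S))%E).
  apply: lee_sum => S _; rewrite EVind; [|exact: noise_sigma|exact: window_sigma].
  by rewrite lee_wpmul2r// row_noise_tail.
rewrite -ge0_sume_distrr// -[leRHS]mule1 lee_wpmul2l ?lee_fin ?expR_ge0//.
by apply: sum_disjoint_le1 => // S S' w <- <-.
Qed.

End IntervalNoise.

(** * Inner products of two noise rows *)

Section GramNoise.
Context d (T : measurableType d) (R : realType) (P : probability T R).
Context (n : nat) (E : 'I_n -> 'I_n -> {RV P >-> R}).
Hypothesis n0 : (0 < n)%N.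
Hypothesis Eind : mutually_independent P (fun p : 'I_n * 'I_n => E p.1 p.2 : T -> R).
Hypothesis Esub : forall i j, centered_subgaussian1 (E i j).

(* Rounding row [i] to a grid of mesh [1 / n] makes it take finitely many values;
   given its rounded value, the inner product is a fixed linear form in row [j]. *)
Let M := (16 * n ^ 2)%N.
(** The cells cover [[- 8 n, 8 n[], which contains any entry whose square is less than [64 n]. *)
Let node (m : 'I_M) : R := (m%:R - 8 * n%:R ^+ 2) / n%:R.
Let cell (m : 'I_M) : set R := `[node m, node m + n%:R^-1[%classic.

Let nR1 : 1 <= n%:R :> R. Proof. by rewrite ler1n. Qed.
Let nR0 : 0 < n%:R :> R. Proof. by rewrite ltr0n. Qed.

Let nodeD m : node m + n%:R^-1 = (m%:R + 1 - 8 * n%:R ^+ 2) / n%:R.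
Proof. by rewrite addrAC mulrDl mul1r. Qed.

Let cell_disjoint m m' x : cell m x -> cell m' x -> m = m'.
Proof.
rewrite /cell /= !in_itv/= => /andP[h1 h2] /andP[h3 h4].
have H (u v : 'I_M) : node u <= x -> x < node v + n%:R^-1 -> (u <= v)%N.
  move=> ux xv; rewrite -ltnS -(ltr_nat R) -natr1.
  have := le_lt_trans ux xv; rewrite nodeD /node ltr_pM2r ?invr_gt0//.
  by move=> ?; lra.
by apply/val_inj/eqP; rewrite eqn_leq (H m m')// (H m' m).
Qed.

Let cell_cover x : x ^+ 2 < 64 * n%:R -> exists m, cell m x.
Proof.
move=> x64; have xn : `|x| < 8 * n%:R.
  rewrite -(@ltr_pXn2r _ 2)// ?nnegrE ?mulr_ge0 ?ltW// real_normK ?num_real//.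
  apply: lt_le_trans x64 _; rewrite exprMn;
      have : n%:R <= n%:R ^+ 2 :> R by rewrite expr2 ler_peMr// ltW.
  by move=> ?; lra.
pose y := n%:R * x + 8 * n%:R ^+ 2.
have /andP[y0 y16] : 0 <= y < 16 * n%:R ^+ 2.
  have : `|n%:R * x| < 8 * n%:R ^+ 2 by rewrite normrM gtr0_norm// expr2 mulrCA ltr_pM2l.
  by rewrite ltr_norml /y => /andP[? ?]; apply/andP; split; lra.
have /andP[m1 m2] := truncn_itv y0.
have mM : (Num.truncn y < M)%N by rewrite -(ltr_nat R) (le_lt_trans m1)// natrM natrX.
exists (Ordinal mM); rewrite /cell /= in_itv/= nodeD /node/=.
rewrite ler_pdivrMr// ltr_pdivlMr//; rewrite -natr1 in m2.
by rewrite /y in m1 m2; apply/andP; split; lra.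
Qed.

Let prob_cell k i m := fine (P (E i k @^-1` cell m)).

Let measurable_cell k i m : measurable (E i k @^-1` cell m).
Proof.
have mc : measurable (cell m) by exact: measurable_itv.
by rewrite -[X in measurable X]setTI; exact: measurable_funPT.
Qed.

Let sum_prob_cell i k : \sum_m prob_cell k i m <= 1.
Proof.
rewrite -lee_fin -sumEFin (eq_bigr (fun m => P (E i k @^-1` cell m))); last first.
  by move=> m _; rewrite /prob_cell fineK// fin_num_measure.
by apply: sum_disjoint_le1 => // m m' w; exact: cell_disjoint.
Qed.

Let grid_noise i j (e : {ffun 'I_n -> 'I_M}) (s b : R) :=
  [set w | (forall k, cell (e k) (E i k w)) /\ b <= s * \sum_k node (e k) * E j k w].

Let measurable_grid_noise i j e s b : measurable (grid_noise i j e s b).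
Proof.
have -> : grid_noise i j e s b = (\bigcap_(k in [set: 'I_n]) (E i k @^-1` cell (e k))) `&`
    [set w | b <= s * \sum_k node (e k) * E j k w].
  by apply/seteqP; split=> w /= [H1 H2]; split=> //; [move=> k _|move=> k]; exact: H1.
apply: measurableI; first exact: fin_bigcap_measurable.
rewrite -[X in measurable X]setTI; apply: measurable_fun_le => //.
apply: measurable_funM => //; by apply: measurable_sum => k; exact: measurable_funM.
Qed.

Let grid_noise_tail i j e s b : i != j ->
  (P (grid_noise i j e s b) <=
   ((\prod_k prob_cell k i (e k)) * expR (s ^+ 2 * (\sum_k node (e k) ^+ 2) / 2 - b))%:E)%E.
Proof.
move=> ij; pose g (x : 'I_n + 'I_n) := match x with inl k => (i, k) | inr k => (j, k) end.
have ginj : injective g.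
  move=> [k|k] [l|l]; rewrite /g => -[]; try by move=> ->.
    by move=> eij; rewrite eij eqxx in ij.
  by move=> eij; rewrite eij eqxx in ij.
pose E' (x : 'I_n + 'I_n) : {RV P >-> R} := E (g x).1 (g x).2.
pose Q (x : 'I_n + 'I_n) := if x is inl _ then true else false.
pose B (x : 'I_n + 'I_n) := if x is inl k then cell (e k) else setT.
pose th (x : 'I_n + 'I_n) := if x is inr k then s * node (e k) else 0.
have mB x : measurable (B x) by case: x => k; [exact: measurable_itv|exact: measurableT].
have := @noise_tail _ _ _ P _ E' (mutually_independent_inj ginj Eind) (fun x => Esub _ _) Q B
    th b mB.
have -> : [set w | (forall x, Q x -> B x (E' x w)) /\ b <= \sum_(x | ~~ Q x) th x * E' x w] =
    grid_noise i j e s b.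
  have thE w : \sum_(x | ~~ Q x) th x * E' x w = s * \sum_k node (e k) * E j k w.
    rewrite big_sumType/= big_pred0_eq add0r mulr_sumr.
    by apply: eq_bigr => k _; rewrite /th /E' /= mulrA.
  apply/seteqP; split=> w /=; rewrite thE => -[H1 H2]; split=> //.
    by move=> k; exact: (H1 (inl k)).
  by case=> k // _; exact: H1.
move=> /le_trans; apply; rewrite lee_fin !big_sumType/= !big_pred0_eq mulr1 add0r.
have <- : \sum_k (s * node (e k)) ^+ 2 / 2 = s ^+ 2 * (\sum_k node (e k) ^+ 2) / 2.
  by rewrite mulr_sumr mulr_suml; apply: eq_bigr => k _; rewrite exprMn.
exact: lexx.
Qed.

Lemma gram_noise_rare i j (s b : R) : i != j ->
  rare P [set w | [/\ b <= s * \sum_k E i k w * E j k w,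
                      \sum_k E i k w ^+ 2 < 64 * n%:R & \sum_k E j k w ^+ 2 < 64 * n%:R]]
    (expR (65 * n%:R * s ^+ 2 + 33 * `|s| - b)).
Proof.
move=> ij; pose b' := b - 33 * `|s|.
(* Rounding at most doubles [64 n] and adds at most 2; half of 130 is the 65 of the exponent. *)
pose small (e : {ffun 'I_n -> 'I_M}) := \sum_k node (e k) ^+ 2 <= 130 * n%:R.
pose D e := if small e then grid_noise i j e s b' else set0.
have mD e : measurable (D e) by rewrite /D; case: ifP.
have PD e : (P (D e) <= ((\prod_k prob_cell k i (e k)) * expR (65 * n%:R * s ^+ 2 - b'))%:E)%E.
  have p0 : 0 <= \prod_k prob_cell k i (e k) by apply: prodr_ge0 => k _; exact: fine_ge0.
  rewrite /D; case: ifPn => [se|_]; last by rewrite measure0 lee_fin mulr_ge0// expR_ge0.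
  apply: le_trans (grid_noise_tail _ _ _ ij) _; rewrite lee_fin ler_wpM2l// ler_expR lerB//.
  have h := ler_wpM2l (sqr_ge0 s) se.
  by move: h; set u := s ^+ 2 * _ => h; lra.
exists (\bigcup_(e in [set: {ffun 'I_n -> 'I_M}]) D e).
  split; first exact: fin_bigcup_measurable.
  apply: le_trans (measure_bigcup_le_sum P mD) _.
  apply: le_trans (lee_sum _ (fun e _ => PD e)) _.
  (* The sum over all rounded rows factorizes into sums over cells, each at most 1, so this huge
     union costs nothing. *)
  rewrite sumEFin lee_fin -mulr_suml -(bigA_distr_bigA (fun k m => prob_cell k i m)).
  have -> : 65 * n%:R * s ^+ 2 + 33 * `|s| - b = 65 * n%:R * s ^+ 2 - b' by rewrite /b'; ring.
  rewrite ler_piMl ?expR_ge0//; apply: prodr_ile1 => k _.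
  by rewrite sum_prob_cell sumr_ge0// => m _; exact: fine_ge0.
move=> w /= [bw Ei Ej].
have /choice[e eP] : forall k, exists m, cell m (E i k w).
  move=> k; apply: cell_cover; apply: le_lt_trans Ei.
  by rewrite (bigD1 k)//= lerDl sumr_ge0// => l _; exact: sqr_ge0.
have e_close k : `|E i k w - node (e k)| <= n%:R^-1.
  have := eP k; rewrite /cell /= in_itv/= => /andP[h1 h2].
  by rewrite ger0_norm ?subr_ge0// lerBlDl ltW.
exists (finfun e) => //.
have -> : D (finfun e) = grid_noise i j (finfun e) s b'.
  rewrite /D ifT// /small.
  apply: (@le_trans _ _ (\sum_k (2 * E i k w ^+ 2 + 2 * (n%:R^-1) ^+ 2))).
    apply: ler_sum => k _; rewrite ffunE.
    have h1 : (E i k w - node (e k)) ^+ 2 <= (n%:R^-1) ^+ 2.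
      by rewrite -(real_normK (num_real (_ - _))) lerXn2r ?nnegrE// invr_ge0 ltW.
    have := sqr_ge0 (2 * E i k w - node (e k)).
    by move: h1; set x := E i k w; set y := node _; set z := (n%:R^-1) ^+ 2 => ? ?; nra.
  rewrite big_split/= -mulr_sumr sumr_const card_ord -mulr_natl.
  have : n%:R * (2 * n%:R^-1 ^+ 2) <= 2 :> R.
    rewrite mulrCA ler_piMr// expr2 mulrA divff ?gt_eqF// mul1r invf_le1//.
  by have := nR1; lra.
split=> [k|]; first by rewrite ffunE; exact: eP.
under eq_bigr do rewrite ffunE.
(* [|x| <= (1 + x ^+ 2) / 2] gives [n / 2 + 32 n]; with mesh [1 / n] the rounding error is then at
   most 33 times |s|. *)
have Ej1 : \sum_k `|E j k w| <= 33 * n%:R.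
  apply: (@le_trans _ _ (\sum_k (2^-1 + 2^-1 * E j k w ^+ 2))).
    apply: ler_sum => k _; rewrite -(real_normK (num_real (E j k w))).
    by have := sqr_ge0 (`|E j k w| - 1); move=> ?; nra.
  rewrite big_split/= -mulr_sumr sumr_const card_ord -mulr_natl.
  by have := nR1; lra.
have H : `|s * \sum_k E i k w * E j k w - s * \sum_k node (e k) * E j k w| <= 33 * `|s|.
  rewrite -mulrBr normrM mulrC ler_wpM2r// -sumrB.
  apply: le_trans (ler_norm_sum _ _ _) _.
  apply: (@le_trans _ _ (\sum_k n%:R^-1 * `|E j k w|)).
    by apply: ler_sum => k _; rewrite -mulrBl normrM ler_wpM2r.
  by rewrite -mulr_sumr mulrC ler_pdivrMr.
move: H; rewrite ler_norml /b' => /andP[? ?]; lra.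
Qed.

End GramNoise.

(** * Risk of PINES *)

Section ExpectationBound.
Context d (T : measurableType d) (R : realType) (P : probability T R).
Local Open Scope ereal_scope.

Import HBNNSimple.

(* [f] is not assumed measurable: the integral of a nonnegative function is a
   supremum over the simple functions below it. *)
Lemma expectation_le_rare (f : T -> R) (B : set T) (g M c : R) : rare P B c ->
  (forall w, 0 <= f w <= M)%R -> (forall w, ~ B w -> f w <= g)%R -> (0 <= g)%R -> (0 <= M)%R ->
  'E_P[f] <= (g + M * c)%:E.
Proof.
move=> [D [mD PD] BD] fM fg g0 M0.
pose bound w := (g + M * \1_D w)%R.
have fb w : (f w <= bound w)%R.
  have /andP[f0 fwM] := fM w; rewrite /bound indicE; have [/set_mem Dw|wD] := boolP (w \in D).
    by rewrite mulr1 (le_trans fwM)// lerDr.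
  by rewrite mulr0 addr0; apply: fg => /BD Dw; rewrite mem_set in wD.
have mbound : measurable_fun setT (EFin \o bound).
  apply/measurable_EFinP; apply: measurable_funD => //; exact: measurable_funM.
rewrite unlock ge0_integralTE; last by move=> w; rewrite lee_fin; have /andP[] := fM w.
apply: ge_ereal_sup => _ [h /= hf <-].
rewrite -integralT_nnsfun.
apply: (@le_trans _ _ (\int[P]_w (bound w)%:E)).
  apply: ge0_le_integral => //=.
  - by move=> w _; rewrite lee_fin.
  - exact/measurable_EFinP.
  - by move=> w _; rewrite (le_trans (hf w))// lee_fin.
rewrite /bound; under eq_integral do rewrite EFinD EFinM.
rewrite ge0_integralD//=; last 2 first.
- by move=> w _; rewrite -EFinM lee_fin mulr_ge0.
- by apply: measurable_funeM; apply: measurableT_comp => //; exact: measurable_indic.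
rewrite integral_cst// [X in _ * X + _]probability_setT mule1 EFinD leeD2l//.
rewrite ge0_integralZl_EFin//; last by apply: measurableT_comp => //; exact: measurable_indic.
by rewrite integral_indic// setIT EFinM lee_wpmul2l.
Qed.

End ExpectationBound.

(** * Probability of the good event *)

Section GoodEvent.
Context d (T : measurableType d) (R : realType) (P : probability T R).
Context (n : nat) (V : 'I_n -> {RV P >-> R}) (E : 'I_n -> 'I_n -> {RV P >-> R}) (h : nat).
Hypothesis n2 : (2 <= n)%N.
Hypothesis Vind : mutually_independent P (fun i => V i : T -> R).
Hypothesis VU : forall i, uniform01 (V i).
Hypothesis EVind : independent_families P (fun p : 'I_n * 'I_n => E p.1 p.2 : T -> R)
    (fun i => V i : T -> R).
Hypothesis Eind : mutually_independent P (fun p : 'I_n * 'I_n => E p.1 p.2 : T -> R).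
Hypothesis Esub : forall i j, centered_subgaussian1 (E i j).

Let L : R := ln n%:R.
Let q := Num.sqrt (n%:R * L).
Hypothesis hL : 4 * L <= h%:R.

Definition good_event (kappa : R) (w : T) : Prop :=
  [/\ forall k, 0 <= V k w < 1,
      forall v, (v <= n)%N -> `|#|[set k | V k w < v%:R / n%:R]%SET|%:R - v%:R| <= kappa * q,
      forall v, (v + h <= n)%N -> exists k, v%:R / n%:R <= V k w < (v + h)%:R / n%:R,
      forall j p r, `|\sum_(k | V p w <= V k w <= V r w) E j k w| <= kappa * q &
      forall i j, i != j -> `|\sum_k E i k w * E j k w| <= kappa * q].

Let n0 : (0 < n)%N. Proof. exact: ltnW. Qed.
Let nR0 : 0 < n%:R :> R. Proof. by rewrite ltr0n. Qed.
Let expL : expR L = n%:R. Proof. by rewrite lnK// posrE. Qed.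

Lemma ln_nat_ge : 2^-1 <= L.
Proof.
rewrite -ler_expR expL.
have h1 := expR_ge1Dx (- 2^-1 : R).
have h3 : expR (2^-1 : R) * (1 - 2^-1) <= 1.
  apply: (@le_trans _ _ (expR 2^-1 * expR (- 2^-1))); last by rewrite expRxMexpNx_1.
  by rewrite ler_wpM2l ?expR_ge0.
have : 2 <= n%:R :> R by rewrite ler_nat.
by move=> ?; lra.
Qed.

Lemma ln_nat_le : L <= n%:R.
Proof. by rewrite -expL; have := expR_ge1Dx L; move=> ?; lra. Qed.

Let L_ge0 : 0 <= L. Proof. by apply: le_trans ln_nat_ge; rewrite invr_ge0. Qed.

Lemma sqrt_nlogn_ge1 : 1 <= q.
Proof.
rewrite -[leLHS]sqrtr1 ler_wsqrtr//.
have h1 := ln_nat_ge; have h2 : 2 <= n%:R :> R by rewrite ler_nat.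
have : (n%:R - 2) * (2^-1) <= (n%:R - 2) * L by rewrite ler_wpM2l// subr_ge0.
by move=> ?; lra.
Qed.

Lemma ln_le_sqrt_nlogn : L <= q.
Proof.
by rewrite -[leLHS]ger0_norm// -sqrtr_sqr ler_wsqrtr// expr2 ler_wpM2r// ln_nat_le.
Qed.

(** The common Chernoff parameter: [s * q = L] turns a threshold [kappa * q] into [kappa * L], and
    [s ^+ 2 * n = L], so all exponents are multiples of [L] up to [s <= L]. *)
Let s := Num.sqrt (L / n%:R).
Let s_ge0 : 0 <= s. Proof. exact: sqrtr_ge0. Qed.
Let s2 : s ^+ 2 = L / n%:R. Proof. by rewrite sqr_sqrtr// divr_ge0// ltW. Qed.
Let sq : s * q = L.
Proof.
rewrite -sqrtrM ?divr_ge0 ?(ltW nR0)// (_ : L / n%:R * (n%:R * L) = L ^+ 2).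
  by rewrite sqrtr_sqr ger0_norm.
by rewrite mulrA divfK ?gt_eqF// expr2.
Qed.
Let q0 : 0 <= q. Proof. exact: sqrtr_ge0. Qed.
Let s_le1 : s <= 1.
Proof. by rewrite -[leRHS]sqrtr1 ler_wsqrtr// ler_pdivrMr// mul1r ln_nat_le. Qed.
Let s_leL : s <= L.
Proof. by rewrite -[leLHS]mulr1 -sq ler_wpM2l// sqrt_nlogn_ge1. Qed.

Let sgn (c : bool) : R := if c then 1 else -1.

Let sgn2 c : sgn c ^+ 2 = 1.
Proof. by case: c; rewrite /sgn ?expr1n// sqrrN expr1n. Qed.

Let abs_sgn (x t u : R) : (0 < u) -> (forall c, sgn c * u * x < u * t) -> `|x| <= t.
Proof.
move=> u0 H; have := H true; have := H false; rewrite /sgn mul1r mulN1r mulNr -mulrN.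
by rewrite !ltr_pM2l// => ? ?; rewrite ler_norml; lra.
Qed.

Let s_gt0 : 0 < s.
Proof. by rewrite sqrtr_gt0 divr_gt0//; apply: lt_le_trans ln_nat_ge; rewrite invr_gt0. Qed.

Let B0 k := [set w | V k w < 0 \/ 1 <= V k w].
(** The parameter is halved to meet the constraint of [latent_count_tail], whence 55 instead of
    110. *)
Let B1 (vc : 'I_n.+1 * bool) := [set w | 55 * L <= sgn vc.2 * (s / 2) *
  (#|[set k | V k w < vc.1%:R / n%:R]%SET|%:R - n%:R * (vc.1%:R / n%:R))].
Let B2 (v : 'I_n) := [set w | (v + h <= n)%N /\
  forall k, ~ (v%:R / n%:R <= V k w < (v + h)%:R / n%:R)].
Let B3 (x : 'I_n * 'I_n * 'I_n * bool) := [set w | 110 * L <=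
  sgn x.2 * s * \sum_(k | V x.1.1.2 w <= V k w <= V x.1.2 w) E x.1.1.1 k w].
Let B4 j := [set w | 64 * n%:R <= \sum_k E j k w ^+ 2].
Let B5 (x : 'I_n * 'I_n * bool) := [set w | x.1.1 != x.1.2 /\
  [/\ 110 * L <= sgn x.2 * s * \sum_k E x.1.1 k w * E x.1.2 k w,
      \sum_k E x.1.1 k w ^+ 2 < 64 * n%:R & \sum_k E x.1.2 k w ^+ 2 < 64 * n%:R]].

Let bad_cover w : ~ good_event 110 w ->
  ((\bigcup_k B0 k) `|` (\bigcup_x B1 x) `|` (\bigcup_v B2 v) `|` (\bigcup_x B3 x) `|`
   (\bigcup_j B4 j) `|` (\bigcup_x B5 x)) w.
Proof.
apply: contra_notP => NB.
have N0 k : ~ B0 k w by move=> Bw; apply: NB; do 5 left; exists k.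
have N1 x : ~ B1 x w by move=> Bw; apply: NB; do 4 left; right; exists x.
have N2 x : ~ B2 x w by move=> Bw; apply: NB; do 3 left; right; exists x.
have N3 x : ~ B3 x w by move=> Bw; apply: NB; do 2 left; right; exists x.
have N4 x : ~ B4 x w by move=> Bw; apply: NB; left; right; exists x.
have N5 x : ~ B5 x w by move=> Bw; apply: NB; right; exists x.
split.
- move=> k; apply/andP; split; rewrite leNgt || rewrite ltNge; apply/negP => H; apply: (N0 k).
    by left.
  by right.
- move=> v vn; apply: (@abs_sgn _ _ (s / 2)); first by rewrite divr_gt0.
  move=> c; have := N1 (inord v, c); rewrite /B1 /= inordK//.
  rewrite (_ : n%:R * (v%:R / n%:R) = v%:R) => [/negP|]; last by rewrite mulrC divfK ?gt_eqF.
  rewrite -ltNge; congr (_ < _).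
  by rewrite -sq; field.
- move=> v vhn.
  have hn : (v < n)%N.
    apply: leq_trans vhn; rewrite -[X in (X < _)%N]addn0 ltn_add2l -(ltr_nat R).
    by apply: lt_le_trans hL; have := ln_nat_ge; move=> ?; lra.
  apply: contrapT => /forallNP H; apply: (N2 (Ordinal hn)); split=> // k; exact: H.
- move=> j p r; apply: (@abs_sgn _ _ s) => // c.
  have := N3 (j, p, r, c); rewrite /B3 /= => /negP; rewrite -ltNge.
  by rewrite [X in _ -> _ < X]mulrCA sq.
- move=> i j ij; apply: (@abs_sgn _ _ s) => // c.
  have [|small_i] := leP (64 * n%:R) (\sum_k E i k w ^+ 2); first by move/(N4 i).
  have [|small_j] := leP (64 * n%:R) (\sum_k E j k w ^+ 2); first by move/(N4 j).
  rewrite [X in _ < X]mulrCA sq ltNge; apply/negP => H.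
  by apply: (N5 (i, j, c)); split.
Qed.

(** At most [10 n^3] events each have probability at most [n^-4], apart from those of probability 0.
    On this exceptional event the loss is at most [n A], which contributes only [10 A] to the
    risk. *)
Lemma good_event_rare : rare P [set w | ~ good_event 110 w] (10 / n%:R).
Proof.
pose nu := expR (- 4 * L).
have nu0 : 0 <= nu by exact: expR_ge0.
have R0 k : rare P (B0 k) 0 by exact: latent_outside_rare.
have R1 x : rare P (B1 x) nu.
  case: x => v c; have nv : n%:R * (v%:R / n%:R) = v%:R :> R by rewrite mulrC divfK ?gt_eqF.
  have v01 : 0 <= (v%:R / n%:R : R) <= 1.
    by rewrite divr_ge0// ler_pdivrMr// mul1r ler_nat -ltnS ltn_ord.
  have s12 : `|sgn c * (s / 2)| <= 2^-1.
    rewrite normrM (_ : `|sgn c| = 1) ?mul1r; last by case: c; rewrite ?normr1// normrN1.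
    by rewrite ger0_norm ?divr_ge0// ler_piMl.
  have H := latent_count_tail Vind VU (55 * L) v01 s12.
  exists (B1 (v, c)) => //; split.
    rewrite /B1 -[X in measurable X]setTI; apply: measurable_fun_le => //.
    apply: measurable_funM => //; apply: measurable_funB => //.
    rewrite (_ : (fun w => _) = fun w => \sum_k \1_(V k @^-1` `]-oo, (v%:R / n%:R)[%classic) w).
      by apply: measurable_sum => k; apply: measurable_indic;
          rewrite -[X in measurable X]setTI; exact: measurable_funPT.
    apply/funext => w; rewrite -sum1dep_card natr_sum [LHS]big_mkcond/=; apply: eq_bigr => k _.
    by rewrite indicE; case: ifPn => Vk;
        [rewrite mem_set//= in_itv|rewrite memNset//= in_itv/=; exact/negP].
  - apply: le_trans H _; rewrite lee_fin ler_expR exprMn sgn2 mul1r expr_div_n s2.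
    have -> : 2 * n%:R * (L / n%:R / 2 ^+ 2) = L / 2 by field; rewrite gt_eqF.
    by have := L_ge0; move=> ?; lra.
have R2 v : rare P (B2 v) nu.
  have [vhn|vhn] := boolP (v + h <= n)%N; last first.
    exists set0; first by split=> //; rewrite measure0 lee_fin.
    by move=> w [/(negP vhn)].
  have vn0 : 0 <= v%:R / n%:R :> R by rewrite divr_ge0.
  have vle : v%:R / n%:R <= (v + h)%:R / n%:R :> R by rewrite ler_pM2r ?invr_gt0// ler_nat
      leq_addr.
  have vh1 : (v + h)%:R / n%:R <= 1 :> R by rewrite ler_pdivrMr// mul1r ler_nat.
  have H := latent_gap_tail Vind VU vn0 vle vh1.
  exists [set w | forall k, ~ (v%:R / n%:R <= V k w < (v + h)%:R / n%:R)]; last by move=> w [].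
  split.
    rewrite (_ : [set w | _] = \bigcap_(k in [set: 'I_n]) (V k @^-1` (~` `[(v%:R / n%:R), ((v +
        h)%:R / n%:R)[%classic))); last first.
      by apply/seteqP; split=> w /= Vw k; have := Vw k; rewrite /= in_itv/=; [move=> + _|apply].
    apply: fin_bigcap_measurable => // k _; rewrite -[X in measurable X]setTI.
    by apply: measurable_funPT => //; exact: measurableC.
  - apply: le_trans H _; rewrite lee_fin ler_expR natrD.
    have -> : n%:R * ((v%:R + h%:R) / n%:R - v%:R / n%:R) = h%:R :> R by field; rewrite gt_eqF.
    by rewrite mulNr lerN2.
have R3 x : rare P (B3 x) nu.
  apply: rare_le (window_noise_rare EVind Eind Esub x.1.1.1 x.1.1.2 x.1.2 (sgn x.2 * s) (110 *
      L)) => //.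
  rewrite ler_expR exprMn sgn2 mul1r s2.
  have -> : L / n%:R * n%:R / 2 = L / 2 by rewrite divfK ?gt_eqF.
  by have := L_ge0; move=> ?; lra.
have R4 j : rare P (B4 j) nu.
  exists (B4 j) => //; split.
    rewrite /B4 -[X in measurable X]setTI; apply: measurable_fun_le => //.
    by apply: measurable_sum => k; apply: measurable_funX.
  -     apply: le_trans (row_sqnorm_tail Eind Esub j) _.
    by rewrite lee_fin ler_expR; have := ln_nat_le; move=> ?; lra.
have R5 x : rare P (B5 x) nu.
  have [ij|ij] := boolP (x.1.1 != x.1.2); last first.
    exists set0; first by split=> //; rewrite measure0 lee_fin.
    by move=> w [/(negP ij)].
  apply: rare_le (gram_noise_rare n0 Eind Esub (sgn x.2 * s) (110 * L) ij); first by move=> w [].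
  rewrite ler_expR exprMn sgn2 mul1r s2 normrM (_ : `|sgn x.2| = 1) ?mul1r; last first.
    by case: (x.2); rewrite /sgn ?normr1// normrN1.
  (* The tightest use of 110: [65 + 33 - 110 = - 12], below the required [- 4]. *)
  have -> : 65 * n%:R * (L / n%:R) = 65 * L by field; rewrite gt_eqF.
  by rewrite ger0_norm//; have := s_leL; have := L_ge0; move=> ? ?; lra.
have := rareU (rareU (rareU (rareU (rareU (rare_bigcup R0) (rare_bigcup R1)) (rare_bigcup R2))
    (rare_bigcup R3)) (rare_bigcup R4)) (rare_bigcup R5).
apply: rare_le; first exact: bad_cover.
rewrite !card_prod !card_ord card_bool !natrM mulr0 add0r -!mulrDl -natr1.
have nuE : nu = n%:R ^- 4.
  by rewrite /nu mulNr expRN (expRM_natl 4%N) expL.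
rewrite nuE; have : 2 <= n%:R :> R by rewrite ler_nat.
move: (n%:R : R) => x x2; have x0 : 0 < x by lra.
have H : (x + 1) * 2 + x + x * x * x * 2 + x + x * x * 2 <= 10 * x ^+ 3.
  by have := ler_wpM2l (ltW x0) x2; have := ler_wpM2l (sqr_ge0 x) x2; move=> ? ?; nra.
rewrite ler_pdivrMr ?exprn_gt0//.
by have -> : 10 / x * x ^+ 4 = 10 * x ^+ 3 by field; rewrite gt_eqF.
Qed.

End GoodEvent.

(** The mode need not be 0, but one of the two half-lines at 0 lies on a single side of it, and
    evenness carries monotonicity to the other one. *)
Lemma even_unimodal_antitone (R : realType) (phi : R -> R) :
  (forall x, phi (- x) = phi x) -> unimodal phi ->
  forall x y, `|x| <= `|y| -> phi y <= phi x.
Proof.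
move=> phiN [t [up down]] x y xy.
have abs z : phi z = phi `|z|.
  by have [z0|z0] := leP 0 z; [rewrite ger0_norm|rewrite ltr0_norm// phiN].
rewrite (abs x) (abs y); have [t0|t0] := leP 0 t.
  rewrite -(phiN `|x|) -(phiN `|y|); apply: up; first by rewrite lerN2.
  by apply: le_trans t0; rewrite oppr_le0.
by apply: down => //; apply: le_trans (ltW t0) _.
Qed.

Lemma good_event_ell2 d (T : measurableType d) (R : realType) (P : probability T R)
  (n : nat) (V : 'I_n -> {RV P >-> R}) (E : 'I_n -> 'I_n -> {RV P >-> R}) (h : nat)
  (phi : R -> R) (A kappa delta e0 : R) (w : T) (r0 r : 'S_n) :
  (2 <= n)%N -> 1 <= A -> 1 <= kappa -> (forall x, 0 <= phi x <= A) ->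
  (forall x y, `|x| <= `|y| -> phi y <= phi x) ->
  1 <= e0 -> Num.sqrt (n%:R * ln n%:R) = e0 ^+ 2 ->
  (h.*2 <= n)%N -> h%:R <= 5 * e0 ^+ 2 -> 0 <= delta -> 2 * A ^+ 2 * h%:R <= delta ^+ 2 ->
  good_event V E h kappa w ->
  let X : 'M[R]_n := \matrix_(i, j) phi (V i w - V j w) in
  let alpha : R := Num.sqrt 2 in
  let eps := 100 * kappa * A * e0 in
  let rho1 := alpha ^+ 2 * delta + (2 * alpha ^+ 2 + 3 * alpha + 2) * eps in
  pines_output (dhat (20 * kappa) A (X + \matrix_(i, j) E i j w)) rho1
    (alpha * delta + 2 * (1 + alpha) * eps) (delta + eps) r0 r ->
  ell2 X r <= 2 * Num.sqrt n%:R * (alpha * ((1 + alpha) * (rho1 + eps)) + 4 * kappa * A * e0).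
Proof.
move=> n2 A1 k1 phiA phiM e01 qE h2 h5 d0 hd [V01 count gap noise gram] X alpha eps rho1 out.
have n0 : (0 < n)%N by exact: ltnW.
have nR0 : 0 < n%:R :> R by rewrite ltr0n.
pose a k := Num.truncn (n%:R * V k w).
have nV0 k : 0 <= n%:R * V k w by rewrite mulr_ge0//; have /andP[] := V01 k.
have aV k : (a k)%:R <= n%:R * V k w < (a k).+1%:R by exact: truncn_itv.
have a_lt k v : (a k < v)%N = (V k w < v%:R / n%:R).
  rewrite ltr_pdivlMr// mulrC; have /andP[a1 a2] := aV k.
  apply/idP/idP => [av|nv]; first by apply: lt_le_trans a2 _; rewrite ler_nat.
  by rewrite -(ltr_nat R) (le_lt_trans a1).
have [s sV] := rank_perm_exists (fun k => V k w).
apply: (@good_sample_ell2 R n phi A (fun k => V k w) (fun i j => E i j w) a kappa e0 h n0 A1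
    phiA phiM aV _ k1 e01 h2 h5 _ _ _ _ qE s delta sV d0 hd r0 r) => //.
- move=> k; rewrite a_lt divff ?gt_eqF//; by have /andP[] := V01 k.
- move=> v vn; rewrite -qE (_ : [set k | (a k < v)%N]%SET = [set k | V k w < v%:R / n%:R]%SET);
    first exact: count.
  by apply/setP => k; rewrite !inE a_lt.
- move=> v /gap[k /andP[k1' k2]]; exists k; rewrite a_lt k2 andbT leqNgt a_lt -leNgt//.
- by rewrite -qE.
- by rewrite -qE.
Qed.

Section NumericalBounds.
Context (R : realType) (n : nat).
Hypothesis n2 : (2 <= n)%N.
Let L : R := ln n%:R.
Let e0 : R := powR (n%:R * L) 4^-1.

Let nR0 : 0 < n%:R :> R. Proof. by rewrite ltr0n ltnW. Qed.
Let L_ge : 2^-1 <= L. Proof. exact: ln_nat_ge. Qed.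
Let L0 : 0 < L. Proof. by apply: lt_le_trans L_ge; rewrite invr_gt0. Qed.

Lemma root4_sqr : Num.sqrt (n%:R * L) = e0 ^+ 2.
Proof.
rewrite -powR12_sqrt ?mulr_ge0 ?ltW// -powR_mulrn ?powR_ge0// -powRrM.
by congr (powR _ _); field.
Qed.

Lemma root4_ge1 : 1 <= e0.
Proof.
have e00 : 0 <= e0 by exact: powR_ge0.
rewrite leNgt; apply/negP => e1; have := sqrt_nlogn_ge1 R n2.
by rewrite -/L root4_sqr leNgt expr_lt1// e1.
Qed.

Lemma rate_split : powR n%:R (3 / 4) * powR L 4^-1 = Num.sqrt n%:R * e0.
Proof.
rewrite /e0 powRM ?(ltW nR0) ?(ltW L0)// mulrA; congr (_ * _).
rewrite -powR12_sqrt ?(ltW nR0)// -powRD; last by rewrite (gt_eqF nR0) implybT.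
by congr (powR _ _); field.
Qed.

Lemma sqrt_ln_le_root4 : powR L 2^-1 <= e0.
Proof.
rewrite powR12_sqrt ?(ltW L0)//; have e00 : 0 <= e0 by exact: powR_ge0.
rewrite -[leRHS]ger0_norm// -sqrtr_sqr ler_wsqrtr// -root4_sqr.
exact: ln_le_sqrt_nlogn.
Qed.

Lemma rate_ge1 : 1 <= Num.sqrt n%:R * e0.
Proof.
rewrite mulr_ege1 ?root4_ge1//.
by rewrite -[leLHS]sqrtr1 ler_wsqrtr// ler1n ltnW.
Qed.

Lemma small_dim_rate : n%:R <= 12 * L -> n%:R <= 12 * (Num.sqrt n%:R * e0).
Proof.
move=> nL; have e00 : 0 <= e0 by exact: powR_ge0.
have sn0 : 0 <= Num.sqrt n%:R :> R by exact: sqrtr_ge0.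
have -> : 12 * (Num.sqrt n%:R * e0) = Num.sqrt n%:R * (12 * e0) by ring.
rewrite -[leLHS](sqr_sqrtr (ltW nR0)) expr2 ler_wpM2l//.
rewrite -[leRHS]ger0_norm ?mulr_ge0// -sqrtr_sqr ler_wsqrtr//.
rewrite exprMn -root4_sqr -[leLHS]ger0_norm ?(ltW nR0)// -sqrtr_sqr.
rewrite (_ : 12 ^+ 2 = Num.sqrt ((12 ^+ 2) ^+ 2));
    last by rewrite sqrtr_sqr ger0_norm// exprn_ge0.
rewrite -sqrtrM ?exprn_ge0// ler_wsqrtr// expr2 mulrCA ler_wpM2l ?(ltW nR0)//.
by apply: le_trans nL _; rewrite ler_wpM2r ?(ltW L0)//; lra.
Qed.

End NumericalBounds.

Lemma radius_bound (R : realFieldType) (alpha delta b : R) :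
  1 <= alpha -> alpha <= 3 / 2 -> alpha ^+ 2 = 2 -> 0 <= b -> delta <= 4 * b ->
  alpha * ((1 + alpha) * (alpha ^+ 2 * delta + (2 * alpha ^+ 2 + 3 * alpha + 2) * (100 * 110 *
      b) +
    100 * 110 * b)) + 4 * 110 * b <= 500 * 1000 * b.
Proof.
move=> al1 al2 al22 b0 delta_b; rewrite al22.
set rho := 2 * delta + _ + _.
(* As [alpha <= 3 / 2], [eps] is counted at most 4 + 9/2 + 2 + 1 = 23/2 times, and [2 * delta] adds
   at most [8 * b]. *)
have rho_b : rho <= 130 * 1000 * b.
  have : alpha * b <= 3 / 2 * b by rewrite ler_wpM2r.
  by rewrite /rho => ?; lra.
have aa : alpha * (1 + alpha) <= 15 / 4 by rewrite mulrDr mulr1 -expr2 al22; lra.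
have aa0 : 0 <= alpha * (1 + alpha) by rewrite mulr_ge0//; lra.
have b10 : 0 <= 130 * 1000 * b by lra.
rewrite mulrA; have := ler_wpM2l aa0 rho_b; have := ler_wpM2r b10 aa.
by move=> ? ?; lra.
Qed.

Theorem theorem8 (R : realType) :
  exists c1 c2 c3 C : R, [/\ 0 < c1, 0 < c2, 0 < c3 & 0 < C] /\
  forall (n : nat) (A : R) (phi : R -> R)
    (d : measure_display) (T : measurableType d) (P : probability T R)
    (V : 'I_n -> {RV P >-> R}) (E : 'I_n -> 'I_n -> {RV P >-> R})
    (pines : 'M[R]_n -> 'S_n),
  (2 <= n)%N -> 1 <= A ->
  (forall x, 0 <= phi x <= A) -> (forall x, phi (- x) = phi x) ->
  unimodal phi ->
  mutually_independent P (fun i => V i : T -> R) ->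
  (forall i, uniform01 (V i)) ->
  independent_families P (fun p : 'I_n * 'I_n => E p.1 p.2 : T -> R)
    (fun i => V i : T -> R) ->
  mutually_independent P (fun p : 'I_n * 'I_n => E p.1 p.2 : T -> R) ->
  (forall i j, centered_subgaussian1 (E i j)) ->
  let X (w : T) : 'M[R]_n := \matrix_(i, j) phi (V i w - V j w) in
  let Y (w : T) : 'M[R]_n := X w + \matrix_(i, j) E i j w in
  let alpha : R := Num.sqrt 2 in
  let delta : R := c2 * A * powR (ln n%:R) 2^-1 in
  let eps : R := c3 * A * powR (n%:R * ln n%:R) 4^-1 in
  let rho3 := delta + eps in
  let rho2 := alpha * delta + 2 * (1 + alpha) * eps in
  let rho1 := alpha ^+ 2 * delta + (2 * alpha ^+ 2 + 3 * alpha + 2) * eps in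
  pines_rule c1 A rho1 rho2 rho3 pines ->
  ('E_P[fun w => ell2 (X w) (pines (dhat c1 A (Y w)))] <=
   (C * A * powR n%:R (3 / 4) * powR (ln n%:R) 4^-1)%:E)%E.
Proof.
(* Here [kappa = 110]; [c1] and [c3] are the factors [20 * kappa] and [100 * kappa] found on a good
   sample. With [c2 = 4], [delta ^+ 2 = 16 A^2 L] dominates [2 A^2 h], as [h <= 6 L]. The last
   constant is twice the bound on a good sample, to absorb the exceptional event. *)
exists (20 * 110), 4, (100 * 110), (2000 * 1000); split; first by split; lra.
move=> n A phi d T P V E pines n2 A1 phiA phiN phiU Vind VU EVind Eind Esub X Y alpha delta eps
  rho3 rho2 rho1 [_ [r0 out]].
pose L : R := ln n%:R; pose e0 : R := powR (n%:R * L) 4^-1.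
pose W := Num.sqrt n%:R * e0.
have phiM := even_unimodal_antitone phiN phiU.
have A0 : 0 <= A by exact: le_trans A1.
have W1 : 1 <= W by exact: rate_ge1.
have L2 : 2^-1 <= L by exact: ln_nat_ge.
have nR0 : 0 < n%:R :> R by rewrite ltr0n ltnW.
have -> : 2000 * 1000 * A * powR n%:R (3 / 4) * powR L 4^-1 = 2000 * 1000 * (A * W).
  by rewrite -mulrA rate_split// [RHS]mulrA.
have AW : 0 <= A * W by rewrite mulr_ge0//; exact: le_trans W1.
have XA w i j : 0 <= X w i j <= A by rewrite mxE.
have ell0 w : 0 <= ell2 (X w) (pines (dhat (20 * 110) A (Y w))) <= n%:R * A.
  by apply/andP; split; [exact: ell2_ge0|exact: ell2_le_dim].
(* An integer just above [4 L] makes a gap of [h] cells have probability at most [n^-4];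
   [L >= 1 / 2] absorbs the rounding in [6 L]. *)
pose h := (Num.truncn (4 * L)).+1.
have /andP[h1 h2] : (Num.truncn (4 * L))%:R <= 4 * L < h%:R by apply: truncn_itv; lra.
have hL : h%:R <= 6 * L by rewrite /h -natr1; lra.
(* If [n] is of order [ln n], the trivial bound [ell2 <= n A] suffices. *)
have [h2n|nh] := leqP h.*2 n; last first.
  have nL : n%:R <= 12 * L.
    have : n%:R <= (h.*2)%:R :> R by rewrite ler_nat ltnW.
    by rewrite -muln2 natrM; move=> ?; lra.
  have nW := small_dim_rate n2 nL; rewrite -/L -/e0 -/W in nW.
  have R0 : rare P set0 0 by exists set0 => //; split=> //; rewrite measure0.
  have nA : n%:R * A <= 12 * (A * W) by rewrite mulrC mulrCA ler_wpM2l.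
  apply: (le_trans (expectation_le_rare R0 ell0 (g := n%:R * A) _ _ _)).
  - by move=> w _; have /andP[] := ell0 w.
  - by rewrite mulr_ge0// ltW.
  - by rewrite mulr_ge0// ltW.
  - by rewrite lee_fin mulr0 addr0; lra.
have e01 : 1 <= e0 by exact: root4_ge1.
have qE : Num.sqrt (n%:R * ln n%:R) = e0 ^+ 2 by exact: root4_sqr.
have Lq : L <= e0 ^+ 2 by rewrite -qE; exact: ln_le_sqrt_nlogn.
have q1 : 1 <= e0 ^+ 2 by rewrite exprn_ege1.
have h5 : h%:R <= 5 * e0 ^+ 2 by rewrite /h -natr1; lra.
have L_ge0 : 0 <= L by lra.
have delta0 : 0 <= delta by rewrite !mulr_ge0// powR_ge0.
have sL : powR L 2^-1 ^+ 2 = L by rewrite powR12_sqrt// sqr_sqrtr.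
have hdelta : 2 * A ^+ 2 * h%:R <= delta ^+ 2.
  rewrite /delta -/L !exprMn sL.
  have := ler_wpM2l (sqr_ge0 A) hL; have : 0 <= A ^+ 2 * L by rewrite mulr_ge0// sqr_ge0.
  by move=> ? ?; lra.
have k1 : 1 <= 110 :> R by lra.
have good w : good_event V E h 110 w ->
    ell2 (X w) (pines (dhat (20 * 110) A (Y w))) <= 1000 * 1000 * (A * W).
  move=> gw; apply: le_trans (good_event_ell2 n2 A1 k1 phiA phiM e01 qE h2n h5 delta0 hdelta gw
      (out (Y w))) _.
  have [al1 al2] : 1 <= alpha /\ alpha <= 3 / 2.
    split; first by rewrite -[leLHS]sqrtr1 ler_wsqrtr// ler1n.
    by rewrite -[leRHS]ger0_norm ?divr_ge0// -sqrtr_sqr ler_wsqrtr//; lra.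
  have al22 : alpha ^+ 2 = 2 by rewrite sqr_sqrtr.
  pose b := A * e0.
  have b0 : 0 <= b by rewrite mulr_ge0//; exact: le_trans e01.
  have delta_b : delta <= 4 * b.
    by rewrite /delta /b mulrA ler_wpM2l ?mulr_ge0//; exact: sqrt_ln_le_root4.
  have -> : 1000 * 1000 * (A * W) = 2 * Num.sqrt n%:R * (500 * 1000 * b) by rewrite /W /b; ring.
  rewrite -/L -/e0 ler_wpM2l ?mulr_ge0 ?sqrtr_ge0//.
  have -> : 4 * 110 * A * e0 = 4 * 110 * b by rewrite /b mulrA.
  have -> : 100 * 110 * A * e0 = 100 * 110 * b by rewrite /b mulrA.
  exact: radius_bound.
have bad := good_event_rare n2 Vind VU EVind Eind Esub (ltW h2).
apply: (le_trans (expectation_le_rare bad ell0 (g := 1000 * 1000 * (A * W)) _ _ _)).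
- by move=> w /contrapT; exact: good.
- by lra.
- by rewrite mulr_ge0// ltW.
- rewrite lee_fin; have -> : n%:R * A * (10 / n%:R) = 10 * A by field; rewrite gt_eqF.
  have : A <= A * W by rewrite ler_peMr.
  by move=> ?; lra.
Qed.
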